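(* With $\phi,\phi^\star,\psi,\psi^\star$ the real constants, and the term ''standard solution'' and the sets $B$, $E$ as given in the context, the following three statements hold. (1.) The following formulas hold (all roots of positive reals are the positive ones): $\Gamma(\frac12)=\sqrt{\pi}$, $\Gamma(\frac23)=\frac{2\pi}{\sqrt3}\Gamma(\frac13)^{-1}$, $\Gamma(\frac34)=\pi\sqrt2\,\Gamma(\frac14)^{-1}$, $\Gamma(\frac16)=\frac{\sqrt3}{\sqrt\pi\,2^{1/3}}\Gamma(\frac13)^2$, $\Gamma(\frac35)=\frac{\pi\sqrt2\sqrt{\phi^\star}}{\sqrt5}\Gamma(\frac25)^{-1}$, $\Gamma(\frac56)=\frac{\pi^{3/2}2^{4/3}}{\sqrt3}\Gamma(\frac13)^{-2}$, $\Gamma(\frac45)=\frac{\pi\sqrt2\sqrt{\phi}}{\sqrt5}\Gamma(\frac15)^{-1}$, $\Gamma(\frac38)=\sqrt{\pi}\sqrt{\sqrt2-1}\,\Gamma(\frac14)^{-1}\Gamma(\frac18)$, $\Gamma(\frac58)=\sqrt{\pi}\,2^{3/4}\Gamma(\frac14)\Gamma(\frac18)^{-1}$, $\Gamma(\frac78)=\pi\,2^{3/4}\sqrt{\sqrt2+1}\,\Gamma(\frac18)^{-1}$, $\Gamma(\frac1{10})=\frac{\sqrt{\phi}}{\sqrt{\pi}\,2^{7/10}}\Gamma(\frac15)\Gamma(\frac25)$, $\Gamma(\frac3{10})=\frac{\sqrt{\pi}\,\phi^\star}{2^{3/5}\sqrt5}\Gamma(\frac15)\Gamma(\frac25)^{-1}$,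 $\Gamma(\frac7{10})=\sqrt{\pi}\,2^{3/5}\Gamma(\frac15)^{-1}\Gamma(\frac25)$, $\Gamma(\frac9{10})=\frac{\pi^{3/2}2^{7/10}\sqrt{\phi}}{\sqrt5}\Gamma(\frac15)^{-1}\Gamma(\frac25)^{-1}$, $\Gamma(\frac1{12})=\frac{3^{3/8}\sqrt{\sqrt3+1}}{\sqrt{\pi}\,2^{1/4}}\Gamma(\frac13)\Gamma(\frac14)$, $\Gamma(\frac5{12})=\frac{\sqrt{\pi}\,2^{1/4}\sqrt{\sqrt3-1}}{3^{1/8}}\Gamma(\frac14)\Gamma(\frac13)^{-1}$, $\Gamma(\frac7{12})=\sqrt{\pi}\,2^{1/4}3^{1/8}\sqrt{\sqrt3-1}\,\Gamma(\frac13)\Gamma(\frac14)^{-1}$, $\Gamma(\frac{11}{12})=\frac{\pi^{3/2}2^{3/4}\sqrt{\sqrt3+1}}{3^{3/8}}\Gamma(\frac13)^{-1}\Gamma(\frac14)^{-1}$, $\Gamma(\frac2{15})=\frac{\sqrt{\phi^\star}\sqrt{\sqrt{15}-\psi^\star}}{2\cdot3^{7/20}5^{1/3}}\Gamma(\frac13)^{-1}\Gamma(\frac25)\Gamma(\frac1{15})$, $\Gamma(\frac4{15})=\frac{\sqrt{\phi}\sqrt{\sqrt{15}-\psi}\sqrt{\sqrt{15}-\psi^\star}}{2^{3/2}3^{3/10}\sqrt5}\Gamma(\frac15)^{-1}\Gamma(\frac25)\Gamma(\frac1{15})$, $\Gamma(\frac7{15})=\frac{3^{9/20}\sqrt{\phi^\star}\sqrt{\sqrt{15}+\psi^\star}}{2\cdot5^{1/6}}\Gamma(\frac13)\Gamma(\frac15)\Gamma(\frac1{15})^{-1}$,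 $\Gamma(\frac8{15})=\frac{\pi\sqrt2\sqrt{\sqrt{15}-\psi}}{3^{9/20}5^{1/3}}\Gamma(\frac13)^{-1}\Gamma(\frac15)^{-1}\Gamma(\frac1{15})$, $\Gamma(\frac{11}{15})=2\pi\cdot3^{3/10}\Gamma(\frac15)\Gamma(\frac25)^{-1}\Gamma(\frac1{15})^{-1}$, $\Gamma(\frac{13}{15})=\frac{\pi\sqrt2\,3^{7/20}\sqrt{\sqrt{15}+\psi}}{5^{1/6}}\Gamma(\frac13)\Gamma(\frac25)^{-1}\Gamma(\frac1{15})^{-1}$, $\Gamma(\frac{14}{15})=\frac{\pi\sqrt{\phi}\sqrt{\sqrt{15}+\psi}\sqrt{\sqrt{15}+\psi^\star}}{\sqrt2\sqrt5}\Gamma(\frac1{15})^{-1}$, $\Gamma(\frac3{20})=\frac{\sqrt\pi\,\phi^\star\sqrt{\sqrt{10}-\sqrt{\phi^\star}}}{2^{21/20}5^{7/8}}\Gamma(\frac25)^{-1}\Gamma(\frac1{20})$, $\Gamma(\frac7{20})=\frac{\sqrt\pi\sqrt{\sqrt{10}-\sqrt{\phi}}}{2^{3/20}5^{3/8}}\Gamma(\frac15)^{-1}\Gamma(\frac1{20})$, $\Gamma(\frac9{20})=\frac{\pi\sqrt{\sqrt{10}-\sqrt{\phi}}\sqrt{\sqrt{10}-\sqrt{\phi^\star}}}{2^{1/5}\sqrt5}\Gamma(\frac15)^{-1}\Gamma(\frac25)^{-1}\Gamma(\frac1{20})$, $\Gamma(\frac{11}{20})=2^{1/5}\sqrt\phi\,\Gamma(\frac15)\Gamma(\frac25)\Gamma(\frac1{20})^{-1}$,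 $\Gamma(\frac{13}{20})=\frac{\sqrt\pi\,2^{3/20}\sqrt{\phi^\star}\sqrt{\sqrt{10}+\sqrt{\phi^\star}}}{5^{1/8}}\Gamma(\frac15)\Gamma(\frac1{20})^{-1}$, $\Gamma(\frac{17}{20})=\frac{\sqrt\pi\,2^{1/20}\sqrt{\phi}\sqrt{\sqrt{10}+\sqrt{\phi}}}{5^{1/8}}\Gamma(\frac25)\Gamma(\frac1{20})^{-1}$, $\Gamma(\frac{19}{20})=\frac{\pi\sqrt\phi\sqrt{\sqrt{10}+\sqrt{\phi}}\sqrt{\sqrt{10}+\sqrt{\phi^\star}}}{\sqrt5}\Gamma(\frac1{20})^{-1}$, $\Gamma(\frac5{24})=\frac{\sqrt\pi\sqrt{\sqrt2-1}\sqrt{\sqrt3-1}}{2^{1/6}\sqrt3}\Gamma(\frac13)^{-1}\Gamma(\frac1{24})$, $\Gamma(\frac7{24})=\frac{\sqrt\pi\sqrt{\sqrt3-1}\sqrt{\sqrt3-\sqrt2}}{2^{1/4}3^{3/8}}\Gamma(\frac14)^{-1}\Gamma(\frac1{24})$, $\Gamma(\frac{11}{24})=\frac{\pi\,2^{1/12}\sqrt{\sqrt2-1}\sqrt{\sqrt3-\sqrt2}}{3^{3/8}}\Gamma(\frac13)^{-1}\Gamma(\frac14)^{-1}\Gamma(\frac1{24})$, $\Gamma(\frac{13}{24})=2^{2/3}3^{3/8}\sqrt{\sqrt3+1}\,\Gamma(\frac13)\Gamma(\frac14)\Gamma(\frac1{24})^{-1}$, $\Gamma(\frac{17}{24})=2\sqrt\pi\,3^{3/8}\sqrt{\sqrt2+1}\,\Gamma(\frac14)\Gamma(\frac1{24})^{-1}$,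 $\Gamma(\frac{19}{24})=\sqrt\pi\,2^{11/12}\sqrt3\sqrt{\sqrt3+\sqrt2}\,\Gamma(\frac13)\Gamma(\frac1{24})^{-1}$, $\Gamma(\frac{23}{24})=\pi\,2^{3/4}\sqrt{\sqrt2+1}\sqrt{\sqrt3+1}\sqrt{\sqrt3+\sqrt2}\,\Gamma(\frac1{24})^{-1}$, $\Gamma(\frac1{30})=\frac{3^{9/20}\sqrt{\phi}\sqrt{\sqrt{15}+\psi}}{\sqrt\pi\,2^{16/15}5^{1/6}}\Gamma(\frac13)\Gamma(\frac15)$, $\Gamma(\frac7{30})=\frac{3^{3/20}\sqrt{\phi^\star}\sqrt{\sqrt{15}+\psi^\star}}{\sqrt\pi\,2^{22/15}5^{1/6}}\Gamma(\frac13)\Gamma(\frac25)$, $\Gamma(\frac{11}{30})=\frac{\sqrt\pi\sqrt{\phi}\sqrt{\sqrt{15}-\psi}}{2^{11/15}3^{1/20}5^{1/3}}\Gamma(\frac13)^{-1}\Gamma(\frac15)$, $\Gamma(\frac{13}{30})=\frac{\sqrt\pi\,3^{7/20}\phi^\star\sqrt{\sqrt{15}-\psi^\star}}{2^{41/30}5^{2/3}}\Gamma(\frac13)\Gamma(\frac25)^{-1}$, $\Gamma(\frac{17}{30})=\frac{\sqrt\pi\sqrt{\phi^\star}\sqrt{\sqrt{15}-\psi^\star}}{2^{2/15}3^{7/20}5^{1/3}}\Gamma(\frac13)^{-1}\Gamma(\frac25)$, $\Gamma(\frac{19}{30})=\frac{\sqrt\pi\,3^{1/20}\phi\sqrt{\sqrt{15}-\psi}}{2^{23/30}5^{2/3}}\Gamma(\frac13)\Gamma(\frac15)^{-1}$,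 $\Gamma(\frac{23}{30})=\frac{\pi^{3/2}\phi^\star\sqrt{\sqrt{15}+\psi^\star}}{2^{1/30}3^{3/20}5^{5/6}}\Gamma(\frac13)^{-1}\Gamma(\frac25)^{-1}$, $\Gamma(\frac{29}{30})=\frac{\pi^{3/2}\phi\sqrt{\sqrt{15}+\psi}}{2^{13/30}3^{9/20}5^{5/6}}\Gamma(\frac13)^{-1}\Gamma(\frac15)^{-1}$, $\Gamma(\frac{11}{60})=\frac{\sqrt\pi\sqrt{\phi}\sqrt{\sqrt{15}-\psi}\sqrt{\sqrt{10}-\sqrt{\phi}}}{2^{5/4}\sqrt3\,5^{17/24}}\Gamma(\frac13)^{-1}\Gamma(\frac1{60})$, $\Gamma(\frac{13}{60})=\frac{\sqrt\pi\sqrt{\phi^\star}\sqrt{\sqrt3+1}\sqrt{\sqrt5-\sqrt3}\sqrt{\sqrt{15}-\psi^\star}}{2^{13/10}3^{3/20}5^{3/8}}\Gamma(\frac25)^{-1}\Gamma(\frac7{60})$, $\Gamma(\frac{17}{60})=\frac{\sqrt\pi\sqrt{\phi^\star}\sqrt{\sqrt{15}-\psi^\star}\sqrt{\sqrt{10}-\sqrt{\phi^\star}}}{2^{3/4}\sqrt3\,5^{11/24}}\Gamma(\frac13)^{-1}\Gamma(\frac7{60})$, $\Gamma(\frac{19}{60})=\frac{\sqrt\pi\sqrt{\phi}\sqrt{\sqrt3-1}\sqrt{\sqrt5-\sqrt3}\sqrt{\sqrt{15}-\psi}}{2^{7/5}3^{9/20}5^{5/8}}\Gamma(\frac15)^{-1}\Gamma(\frac1{60})$,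 $\Gamma(\frac{23}{60})=\frac{\pi\sqrt{\phi^\star}\sqrt{\sqrt3+1}\sqrt{\sqrt5-\sqrt3}\sqrt{\sqrt{10}-\sqrt{\phi^\star}}}{2^{11/20}3^{3/20}5^{7/12}}\Gamma(\frac13)^{-1}\Gamma(\frac25)^{-1}\Gamma(\frac7{60})$, $\Gamma(\frac{29}{60})=\frac{\pi\sqrt{\phi}\sqrt{\sqrt3-1}\sqrt{\sqrt5-\sqrt3}\sqrt{\sqrt{10}-\sqrt{\phi}}}{2^{23/20}3^{9/20}5^{7/12}}\Gamma(\frac13)^{-1}\Gamma(\frac15)^{-1}\Gamma(\frac1{60})$, $\Gamma(\frac{31}{60})=\frac{3^{9/20}\sqrt\phi\sqrt{\sqrt{15}+\psi}}{2^{1/10}5^{1/6}}\Gamma(\frac13)\Gamma(\frac15)\Gamma(\frac1{60})^{-1}$, $\Gamma(\frac{37}{60})=\frac{3^{3/20}\sqrt{\phi^\star}\sqrt{\sqrt{15}+\psi^\star}}{2^{7/10}5^{1/6}}\Gamma(\frac13)\Gamma(\frac25)\Gamma(\frac7{60})^{-1}$, $\Gamma(\frac{41}{60})=\frac{\sqrt\pi\,2^{3/20}3^{9/20}\sqrt\phi\sqrt{\sqrt{10}+\sqrt\phi}}{5^{1/8}}\Gamma(\frac15)\Gamma(\frac1{60})^{-1}$, $\Gamma(\frac{43}{60})=\frac{\sqrt\pi\sqrt3\sqrt{\phi^\star}\sqrt{\sqrt3-1}\sqrt{\sqrt5+\sqrt3}}{\sqrt2\,5^{7/24}}\Gamma(\frac13)\Gamma(\frac7{60})^{-1}$,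 $\Gamma(\frac{47}{60})=\frac{\sqrt\pi\,2^{1/20}3^{3/20}\sqrt{\phi^\star}\sqrt{\sqrt{10}+\sqrt{\phi^\star}}}{5^{3/8}}\Gamma(\frac25)\Gamma(\frac7{60})^{-1}$, $\Gamma(\frac{49}{60})=\frac{\sqrt\pi\sqrt3\sqrt\phi\sqrt{\sqrt3+1}\sqrt{\sqrt5+\sqrt3}}{5^{1/24}}\Gamma(\frac13)\Gamma(\frac1{60})^{-1}$, $\Gamma(\frac{53}{60})=\frac{\pi\phi^\star\sqrt{\sqrt3-1}\sqrt{\sqrt5+\sqrt3}\sqrt{\sqrt{15}+\psi^\star}\sqrt{\sqrt{10}+\sqrt{\phi^\star}}}{2^{5/4}5^{3/4}}\Gamma(\frac7{60})^{-1}$, $\Gamma(\frac{59}{60})=\frac{\pi\phi\sqrt{\sqrt3+1}\sqrt{\sqrt5+\sqrt3}\sqrt{\sqrt{15}+\psi}\sqrt{\sqrt{10}+\sqrt\phi}}{2^{5/4}5^{3/4}}\Gamma(\frac1{60})^{-1}$. (2.) The standard equations imply that any gamma value at a rational point with denominator dividing $120$ can be expressed in terms of the gamma values at the points of $B$ and of $E$. Precisely: for every $x\in\mathbb{Q}\setminus\{0,-1,-2,\ldots\}$ with $120x\in\mathbb{Z}$ there exist a nonzero real algebraic number $\alpha$, a rational number $r$ and rational numbers $m_y$ ($y\in B\cup E$) such that every standard solution $G$ satisfies $G(x)=\alpha\,\pi^{r}\prod_{y\in B\cup E}G(y)^{m_y}$. (3.) The standard equations do not imply any relations between the ten gamma values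 at the points of $B$. Precisely: for every choice of positive real numbers $(t_y)_{y\in B}$ there is a standard solution $G$ with $G(y)=t_y$ for all $y\in B$. The same holds for the total set of sixteen gamma values at the points of $B\cup E$.
   Context: $\Gamma$ is Euler's gamma function. Constants: $\phi=5+\sqrt5$, $\phi^\star=5-\sqrt5$, $\psi=\sqrt{5+2\sqrt5}$, $\psi^\star=\sqrt{5-2\sqrt5}$. Sets of rational points: $B=\{\frac13,\frac14,\frac15,\frac25,\frac18,\frac1{15},\frac1{20},\frac1{24},\frac1{60},\frac7{60}\}$ and $E=\{\frac1{40},\frac3{40},\frac7{40},\frac1{120},\frac7{120},\frac{11}{120}\}$. The ''standard equations'' for the gamma function are the difference equation $\Gamma(x+1)=x\Gamma(x)$, the Euler reflection formula $\Gamma(x)\Gamma(1-x)=\pi/\sin(\pi x)$, and the Gauss multiplication formula $\prod_{k=0}^{n-1}\Gamma(x+\frac kn)=n^{\frac12-nx}(2\pi)^{\frac{n-1}2}\Gamma(nx)$ for positive integers $n$. A ''standard solution'' is a function $G:\mathbb{Q}\setminus\{0,-1,-2,\ldots\}\to\mathbb{R}\setminus\{0\}$ with $G(x)>0$ for $x>0$, $G(1)=1$, which satisfies all standard equations at rational points, i.e. $G(x+1)=xG(x)$ for all $x$ in the domain; $G(x)G(1-x)=\pi/\sin(\pi x)$ for all $x\in\mathbb{Q}\setminus\mathbb{Z}$; and $\prod_{k=0}^{n-1}G(x+\frac kn)=n^{\frac12-nx}(2\pi)^{\frac{n-1}2}G(nx)$ for all integers $n\ge1$ and $x\in\mathbb{Q}$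 with $nx\notin\{0,-1,-2,\ldots\}$. (The restriction of $\Gamma$ is one standard solution.) *)

(* Defs.v *)
From mathcomp Require Import all_boot all_order all_algebra.
From mathcomp Require Import all_classical all_reals all_analysis.

Set Implicit Arguments.
Unset Strict Implicit.
Unset Printing Implicit Defensive.

Import Order.TTheory GRing.Theory Num.Theory.
Import numFieldNormedType.Exports.

Local Open Scope classical_set_scope.
Local Open Scope ring_scope.

Local Notation sqrt := Num.sqrt.

(* Euler's integral; it is the gamma function for 0 < x, the only arguments at
   which it is used. *)
Definition Gamma {R : realType} (x : R) : R :=
  \int[lebesgue_measure]_(t in `]0, +oo[) (t `^ (x - 1) * expR (- t)).

Definition phi {R : realType} : R := 5 + sqrt 5.
Definition phi_star {R : realType} : R := 5 - sqrt 5.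
Definition psi {R : realType} : R := sqrt (5 + 2 * sqrt 5).
Definition psi_star {R : realType} : R := sqrt (5 - 2 * sqrt 5).

Definition setB : seq rat :=
  [:: 1 / 3; 1 / 4; 1 / 5; 2 / 5; 1 / 8; 1 / 15; 1 / 20; 1 / 24; 1 / 60;
      7 / 60].

Definition setE : seq rat :=
  [:: 1 / 40; 3 / 40; 7 / 40; 1 / 120; 7 / 120; 11 / 120].

(* The rational numbers other than 0, -1, -2, ... *)
Definition gamma_dom (x : rat) : bool := - x \isn't a Num.nat.

(* G is a total function on rat, but only its values on gamma_dom are
   constrained or ever used. *)
Definition standard_solution (R : realType) (G : rat -> R) : Prop :=
  (forall x : rat, gamma_dom x -> G x != 0) /\
  (forall x : rat, 0 < x -> 0 < G x) /\
  G 1 = 1 /\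
  (forall x : rat, gamma_dom x -> G (x + 1) = ratr x * G x) /\
  (forall x : rat, x \isn't a Num.int ->
     G x * G (1 - x) = pi / sin (pi * ratr x)) /\
  (forall (n : nat) (x : rat), (1 <= n)%N -> gamma_dom (n%:R * x) ->
     \prod_(k < n) G (x + k%:R / n%:R) =
     n%:R `^ (1 / 2 - n%:R * ratr x) * (2 * pi) `^ ((n%:R - 1) / 2) *
     G (n%:R * x)).

Definition gamma_formulas (R : realType) (G : R -> R) : Prop :=
  G (1 / 2) = sqrt pi /\
  G (2 / 3) = 2 * pi / sqrt 3 * (G (1 / 3))^-1 /\
  G (3 / 4) = pi * sqrt 2 * (G (1 / 4))^-1 /\
  G (1 / 6) = sqrt 3 / (sqrt pi * 2 `^ (1 / 3)) * G (1 / 3) ^+ 2 /\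
  G (3 / 5) = pi * sqrt 2 * sqrt phi_star / sqrt 5 * (G (2 / 5))^-1 /\
  G (5 / 6) = pi `^ (3 / 2) * 2 `^ (4 / 3) / sqrt 3 * G (1 / 3) ^- 2 /\
  G (4 / 5) = pi * sqrt 2 * sqrt phi / sqrt 5 * (G (1 / 5))^-1 /\

  G (3 / 8) = sqrt pi * sqrt (sqrt 2 - 1) * (G (1 / 4))^-1 * G (1 / 8) /\
  G (5 / 8) = sqrt pi * 2 `^ (3 / 4) * G (1 / 4) * (G (1 / 8))^-1 /\
  G (7 / 8) = pi * 2 `^ (3 / 4) * sqrt (sqrt 2 + 1) * (G (1 / 8))^-1 /\

  G (1 / 10) =
    sqrt phi / (sqrt pi * 2 `^ (7 / 10)) * G (1 / 5) * G (2 / 5) /\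
  G (3 / 10) =
    sqrt pi * phi_star / (2 `^ (3 / 5) * sqrt 5) * G (1 / 5) *
    (G (2 / 5))^-1 /\
  G (7 / 10) = sqrt pi * 2 `^ (3 / 5) * (G (1 / 5))^-1 * G (2 / 5) /\
  G (9 / 10) =
    pi `^ (3 / 2) * 2 `^ (7 / 10) * sqrt phi / sqrt 5 * (G (1 / 5))^-1 *
    (G (2 / 5))^-1 /\

  G (1 / 12) =
    3 `^ (3 / 8) * sqrt (sqrt 3 + 1) / (sqrt pi * 2 `^ (1 / 4)) *
    G (1 / 3) * G (1 / 4) /\
  G (5 / 12) =
    sqrt pi * 2 `^ (1 / 4) * sqrt (sqrt 3 - 1) / 3 `^ (1 / 8) *
    G (1 / 4) * (G (1 / 3))^-1 /\
  G (7 / 12) =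
    sqrt pi * 2 `^ (1 / 4) * 3 `^ (1 / 8) * sqrt (sqrt 3 - 1) *
    G (1 / 3) * (G (1 / 4))^-1 /\
  G (11 / 12) =
    pi `^ (3 / 2) * 2 `^ (3 / 4) * sqrt (sqrt 3 + 1) / 3 `^ (3 / 8) *
    (G (1 / 3))^-1 * (G (1 / 4))^-1 /\

  G (2 / 15) =
    sqrt phi_star * sqrt (sqrt 15 - psi_star) /
    (2 * 3 `^ (7 / 20) * 5 `^ (1 / 3)) * (G (1 / 3))^-1 * G (2 / 5) *
    G (1 / 15) /\
  G (4 / 15) =
    sqrt phi * sqrt (sqrt 15 - psi) * sqrt (sqrt 15 - psi_star) /
    (2 `^ (3 / 2) * 3 `^ (3 / 10) * sqrt 5) * (G (1 / 5))^-1 * G (2 / 5) *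
    G (1 / 15) /\
  G (7 / 15) =
    3 `^ (9 / 20) * sqrt phi_star * sqrt (sqrt 15 + psi_star) /
    (2 * 5 `^ (1 / 6)) * G (1 / 3) * G (1 / 5) * (G (1 / 15))^-1 /\
  G (8 / 15) =
    pi * sqrt 2 * sqrt (sqrt 15 - psi) / (3 `^ (9 / 20) * 5 `^ (1 / 3)) *
    (G (1 / 3))^-1 * (G (1 / 5))^-1 * G (1 / 15) /\
  G (11 / 15) =
    2 * pi * 3 `^ (3 / 10) * G (1 / 5) * (G (2 / 5))^-1 * (G (1 / 15))^-1 /\
  G (13 / 15) =
    pi * sqrt 2 * 3 `^ (7 / 20) * sqrt (sqrt 15 + psi) / 5 `^ (1 / 6) *
    G (1 / 3) * (G (2 / 5))^-1 * (G (1 / 15))^-1 /\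
  G (14 / 15) =
    pi * sqrt phi * sqrt (sqrt 15 + psi) * sqrt (sqrt 15 + psi_star) /
    (sqrt 2 * sqrt 5) * (G (1 / 15))^-1 /\

  G (3 / 20) =
    sqrt pi * phi_star * sqrt (sqrt 10 - sqrt phi_star) /
    (2 `^ (21 / 20) * 5 `^ (7 / 8)) * (G (2 / 5))^-1 * G (1 / 20) /\
  G (7 / 20) =
    sqrt pi * sqrt (sqrt 10 - sqrt phi) / (2 `^ (3 / 20) * 5 `^ (3 / 8)) *
    (G (1 / 5))^-1 * G (1 / 20) /\
  G (9 / 20) =
    pi * sqrt (sqrt 10 - sqrt phi) * sqrt (sqrt 10 - sqrt phi_star) /
    (2 `^ (1 / 5) * sqrt 5) * (G (1 / 5))^-1 * (G (2 / 5))^-1 * G (1 / 20) /\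
  G (11 / 20) =
    2 `^ (1 / 5) * sqrt phi * G (1 / 5) * G (2 / 5) * (G (1 / 20))^-1 /\
  G (13 / 20) =
    sqrt pi * 2 `^ (3 / 20) * sqrt phi_star *
    sqrt (sqrt 10 + sqrt phi_star) / 5 `^ (1 / 8) * G (1 / 5) *
    (G (1 / 20))^-1 /\
  G (17 / 20) =
    sqrt pi * 2 `^ (1 / 20) * sqrt phi * sqrt (sqrt 10 + sqrt phi) /
    5 `^ (1 / 8) * G (2 / 5) * (G (1 / 20))^-1 /\
  G (19 / 20) =
    pi * sqrt phi * sqrt (sqrt 10 + sqrt phi) *
    sqrt (sqrt 10 + sqrt phi_star) / sqrt 5 * (G (1 / 20))^-1 /\

  G (5 / 24) =
    sqrt pi * sqrt (sqrt 2 - 1) * sqrt (sqrt 3 - 1) /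
    (2 `^ (1 / 6) * sqrt 3) * (G (1 / 3))^-1 * G (1 / 24) /\
  G (7 / 24) =
    sqrt pi * sqrt (sqrt 3 - 1) * sqrt (sqrt 3 - sqrt 2) /
    (2 `^ (1 / 4) * 3 `^ (3 / 8)) * (G (1 / 4))^-1 * G (1 / 24) /\
  G (11 / 24) =
    pi * 2 `^ (1 / 12) * sqrt (sqrt 2 - 1) * sqrt (sqrt 3 - sqrt 2) /
    3 `^ (3 / 8) * (G (1 / 3))^-1 * (G (1 / 4))^-1 * G (1 / 24) /\
  G (13 / 24) =
    2 `^ (2 / 3) * 3 `^ (3 / 8) * sqrt (sqrt 3 + 1) * G (1 / 3) *
    G (1 / 4) * (G (1 / 24))^-1 /\
  G (17 / 24) =
    2 * sqrt pi * 3 `^ (3 / 8) * sqrt (sqrt 2 + 1) * G (1 / 4) *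
    (G (1 / 24))^-1 /\
  G (19 / 24) =
    sqrt pi * 2 `^ (11 / 12) * sqrt 3 * sqrt (sqrt 3 + sqrt 2) *
    G (1 / 3) * (G (1 / 24))^-1 /\
  G (23 / 24) =
    pi * 2 `^ (3 / 4) * sqrt (sqrt 2 + 1) * sqrt (sqrt 3 + 1) *
    sqrt (sqrt 3 + sqrt 2) * (G (1 / 24))^-1 /\

  G (1 / 30) =
    3 `^ (9 / 20) * sqrt phi * sqrt (sqrt 15 + psi) /
    (sqrt pi * 2 `^ (16 / 15) * 5 `^ (1 / 6)) * G (1 / 3) * G (1 / 5) /\
  G (7 / 30) =
    3 `^ (3 / 20) * sqrt phi_star * sqrt (sqrt 15 + psi_star) /
    (sqrt pi * 2 `^ (22 / 15) * 5 `^ (1 / 6)) * G (1 / 3) * G (2 / 5) /\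
  G (11 / 30) =
    sqrt pi * sqrt phi * sqrt (sqrt 15 - psi) /
    (2 `^ (11 / 15) * 3 `^ (1 / 20) * 5 `^ (1 / 3)) * (G (1 / 3))^-1 *
    G (1 / 5) /\
  G (13 / 30) =
    sqrt pi * 3 `^ (7 / 20) * phi_star * sqrt (sqrt 15 - psi_star) /
    (2 `^ (41 / 30) * 5 `^ (2 / 3)) * G (1 / 3) * (G (2 / 5))^-1 /\
  G (17 / 30) =
    sqrt pi * sqrt phi_star * sqrt (sqrt 15 - psi_star) /
    (2 `^ (2 / 15) * 3 `^ (7 / 20) * 5 `^ (1 / 3)) * (G (1 / 3))^-1 *
    G (2 / 5) /\
  G (19 / 30) =
    sqrt pi * 3 `^ (1 / 20) * phi * sqrt (sqrt 15 - psi) /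
    (2 `^ (23 / 30) * 5 `^ (2 / 3)) * G (1 / 3) * (G (1 / 5))^-1 /\
  G (23 / 30) =
    pi `^ (3 / 2) * phi_star * sqrt (sqrt 15 + psi_star) /
    (2 `^ (1 / 30) * 3 `^ (3 / 20) * 5 `^ (5 / 6)) * (G (1 / 3))^-1 *
    (G (2 / 5))^-1 /\
  G (29 / 30) =
    pi `^ (3 / 2) * phi * sqrt (sqrt 15 + psi) /
    (2 `^ (13 / 30) * 3 `^ (9 / 20) * 5 `^ (5 / 6)) * (G (1 / 3))^-1 *
    (G (1 / 5))^-1 /\

  G (11 / 60) =
    sqrt pi * sqrt phi * sqrt (sqrt 15 - psi) *
    sqrt (sqrt 10 - sqrt phi) / (2 `^ (5 / 4) * sqrt 3 * 5 `^ (17 / 24)) *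
    (G (1 / 3))^-1 * G (1 / 60) /\
  G (13 / 60) =
    sqrt pi * sqrt phi_star * sqrt (sqrt 3 + 1) * sqrt (sqrt 5 - sqrt 3) *
    sqrt (sqrt 15 - psi_star) /
    (2 `^ (13 / 10) * 3 `^ (3 / 20) * 5 `^ (3 / 8)) * (G (2 / 5))^-1 *
    G (7 / 60) /\
  G (17 / 60) =
    sqrt pi * sqrt phi_star * sqrt (sqrt 15 - psi_star) *
    sqrt (sqrt 10 - sqrt phi_star) /
    (2 `^ (3 / 4) * sqrt 3 * 5 `^ (11 / 24)) * (G (1 / 3))^-1 * G (7 / 60) /\
  G (19 / 60) =
    sqrt pi * sqrt phi * sqrt (sqrt 3 - 1) * sqrt (sqrt 5 - sqrt 3) *
    sqrt (sqrt 15 - psi) / (2 `^ (7 / 5) * 3 `^ (9 / 20) * 5 `^ (5 / 8)) *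
    (G (1 / 5))^-1 * G (1 / 60) /\
  G (23 / 60) =
    pi * sqrt phi_star * sqrt (sqrt 3 + 1) * sqrt (sqrt 5 - sqrt 3) *
    sqrt (sqrt 10 - sqrt phi_star) /
    (2 `^ (11 / 20) * 3 `^ (3 / 20) * 5 `^ (7 / 12)) * (G (1 / 3))^-1 *
    (G (2 / 5))^-1 * G (7 / 60) /\
  G (29 / 60) =
    pi * sqrt phi * sqrt (sqrt 3 - 1) * sqrt (sqrt 5 - sqrt 3) *
    sqrt (sqrt 10 - sqrt phi) /
    (2 `^ (23 / 20) * 3 `^ (9 / 20) * 5 `^ (7 / 12)) * (G (1 / 3))^-1 *
    (G (1 / 5))^-1 * G (1 / 60) /\
  G (31 / 60) =
    3 `^ (9 / 20) * sqrt phi * sqrt (sqrt 15 + psi) /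
    (2 `^ (1 / 10) * 5 `^ (1 / 6)) * G (1 / 3) * G (1 / 5) *
    (G (1 / 60))^-1 /\
  G (37 / 60) =
    3 `^ (3 / 20) * sqrt phi_star * sqrt (sqrt 15 + psi_star) /
    (2 `^ (7 / 10) * 5 `^ (1 / 6)) * G (1 / 3) * G (2 / 5) *
    (G (7 / 60))^-1 /\
  G (41 / 60) =
    sqrt pi * 2 `^ (3 / 20) * 3 `^ (9 / 20) * sqrt phi *
    sqrt (sqrt 10 + sqrt phi) / 5 `^ (1 / 8) * G (1 / 5) * (G (1 / 60))^-1 /\
  G (43 / 60) =
    sqrt pi * sqrt 3 * sqrt phi_star * sqrt (sqrt 3 - 1) *
    sqrt (sqrt 5 + sqrt 3) / (sqrt 2 * 5 `^ (7 / 24)) * G (1 / 3) *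
    (G (7 / 60))^-1 /\
  G (47 / 60) =
    sqrt pi * 2 `^ (1 / 20) * 3 `^ (3 / 20) * sqrt phi_star *
    sqrt (sqrt 10 + sqrt phi_star) / 5 `^ (3 / 8) * G (2 / 5) *
    (G (7 / 60))^-1 /\
  G (49 / 60) =
    sqrt pi * sqrt 3 * sqrt phi * sqrt (sqrt 3 + 1) *
    sqrt (sqrt 5 + sqrt 3) / 5 `^ (1 / 24) * G (1 / 3) * (G (1 / 60))^-1 /\
  G (53 / 60) =
    pi * phi_star * sqrt (sqrt 3 - 1) * sqrt (sqrt 5 + sqrt 3) *
    sqrt (sqrt 15 + psi_star) * sqrt (sqrt 10 + sqrt phi_star) /
    (2 `^ (5 / 4) * 5 `^ (3 / 4)) * (G (7 / 60))^-1 /\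
  G (59 / 60) =
    pi * phi * sqrt (sqrt 3 + 1) * sqrt (sqrt 5 + sqrt 3) *
    sqrt (sqrt 15 + psi) * sqrt (sqrt 10 + sqrt phi) /
    (2 `^ (5 / 4) * 5 `^ (3 / 4)) * (G (1 / 60))^-1.

(* Main.v *)
Require Import Defs.
From mathcomp Require Import all_boot all_order all_algebra.
From mathcomp Require Import all_classical all_reals all_analysis.
From mathcomp Require Import measurable_realfun ring lra zify.
From mathcomp Require complex.

Import Order.TTheory GRing.Theory Num.Theory.
Local Open Scope ring_scope.

(** Everything said about the gamma function below is derived from a short list
of properties, the predicate [gamma_like]: positivity on the positive axis,
the value 1 at 1, the difference equation, and Wendel's inequality
G(y+s) <= y^s G(y) for 0 <= s <= 1.  For Euler's integral the difference
equation is integration by parts, and Wendel's inequality is weighted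
arithmetic-geometric mean under the integral sign; it also yields convergence
of the integral ([Gamma_gamma_like]).

Wendel's inequality gives the asymptotic behaviour that proves the two other
standard equations.  For the reflection formula ([gamma_reflection]) it shows
that x G(x) G(1-x) times the finite product over 0 < k <= m of 1 - x^2/k^2
tends to 1; that this product tends to sin(pi x) / (pi x) is proved with
explicit error bounds by comparing the integrals of cos(2xt) cos(t)^n over
[0, pi/2] for x and for 0 ([sine_prod_bounds]).  For the multiplication formula
([gamma_multiplication]) the quotient of its two sides is 1/n-periodic and, by
Wendel's inequality, nonincreasing up to an error that vanishes far to the
right; hence it is constant, and its value at 1/n comes from the reflection
formula and from the product of the numbers 2 sin(pi k/n) for 0 < k < n, which
is n.

The closed formulas ([gamma_like_formulas]) are linear algebra once logarithms
are taken.  The numbers ln G(k/120) satisfy the linear relations given by the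
reflection formula and by the multiplication formulas for n = 2, 3, 5, whose
inhomogeneous terms are combinations of the logarithms of pi, 2, 3, 5 and of
sines sin(pi k/120).  The sines that are needed are expressed in turn through
the radicals of the formulas, by the duplication and triplication of the sine
and by one identity between each radical and such sines.

That every value at a point with denominator dividing 120 is expressible in the
sixteen basis values ([gamma_values_120]) is again an elimination in the same
relations, now for an arbitrary standard solution: an explicit list says which
combination of relations isolates which point, and it is verified by
computation ([elimination_plan_ok]).  The constants are algebraic because the
sines of rational angles involved are.  Translations by integers only cost
rational factors.

For the independence, a function h on the rationals that is 1-periodic, odd
and satisfies the distribution relation (h(x) + ... + h(x + (n-1)/n) = h(n x))
can be added to the logarithm of a standard solution
([twisted_gamma_standard]). The sawtooth function, x - 1/2 on ]0,1[ and 0 at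
the integers, is such a distribution, and so is its composition with any
automorphism of Q/Z. For u prime to 120 there is an automorphism that
multiplies the 120-torsion by u; it acts by u on the 2-, 3- and 5-primary
parts, and as the identity on the others. The values of these twisted
sawtooths at the sixteen basis points, for sixteen representatives u of the
units modulo 120 up to sign, form an invertible matrix. The rows of the
inverse matrix ([dual_weights]) give distributions dual to the basis points,
and with them prescribed positive values are attained
([standard_solution_free]). *)

(** * Euler's integral *)

Section RealAnalysis.
Import numFieldNormedType.Exports.
Local Open Scope classical_set_scope.
Local Open Scope ring_scope.
Context {R : realType}.
Local Notation mu := (@lebesgue_measure R).

Lemma integral_is_derive (f F : R -> R) (a b : R) : a < b ->
  {in `[a, b], forall t, {for t, continuous f}} ->
  {in `[a, b], forall t, is_derive t (1 : R) F (f t)} ->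
  (\int[mu]_(t in `[a, b]) (f t)%:E = (F b - F a)%:E)%E.
Proof.
move=> ab cf dF; rewrite EFinB; apply: continuous_FTC2 => //.
- by apply: continuous_in_subspaceT => t; rewrite inE => tab; exact: cf.
- have cF : {within `[a, b], continuous F}.
    by apply: derivable_within_continuous => t tab; have [] := dF t tab.
  have /continuous_within_itvP := cF => /(_ ab)[_ Fa Fb].
  by split=> // t tab; have [] := dF t (subset_itv_oo_cc tab).
- move=> t tab; by rewrite derive1E; have [_ ->] := dF t (subset_itv_oo_cc tab).
Qed.

Lemma continuous_powR (a t : R) : 0 < t -> {for t, continuous (fun u => u `^ a)}.
Proof.
move=> t0; have [d _] := is_derive1_powR a t0.
by apply: differentiable_continuous; apply/derivable1_diffP.
Qed.

Lemma continuous_expRN (t : R) : {for t, continuous (fun u : R => expR (- u))}.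
Proof.
apply: (@continuous_comp _ _ _ -%R expR); last exact: continuous_expR.
exact: opp_continuous.
Qed.

Lemma is_derive_powR_expRN (x t : R) : 0 < t ->
  is_derive t (1 : R) (fun u => u `^ x * expR (- u))
    (x * (t `^ (x - 1) * expR (- t)) - t `^ x * expR (- t)).
Proof.
move=> t0; have d1 := is_derive1_powR x t0.
by apply: is_derive_eq; rewrite /GRing.scale/=; ring.
Qed.

Definition gamma_integrand (x t : R) : R := t `^ (x - 1) * expR (- t).

(** The extended-real integral is the convenient object: it needs no
integrability, which is only deduced from [eGamma_wendel] below. *)
Definition eGamma (x : R) : \bar R :=
  (\int[mu]_(t in `]0%R, +oo[) (gamma_integrand x t)%:E)%E.

Lemma GammaE (x : R) : Gamma x = fine (eGamma x). Proof. by []. Qed.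

Lemma gamma_integrand_ge0 x t : 0 <= gamma_integrand x t.
Proof. by rewrite mulr_ge0 ?powR_ge0 ?expR_ge0. Qed.

Lemma measurable_gamma_integrand (x : R) (D : set R) : measurable D ->
  measurable_fun D (fun t => (gamma_integrand x t)%:E).
Proof.
move=> mD; apply/measurable_EFinP/measurable_funM.
  by apply: measurable_funTS; exact: measurable_powR.
apply: measurable_funTS; apply: measurableT_comp; first exact: measurable_expR.
exact: oppr_measurable.
Qed.

Lemma eGamma_ge0 x : (0 <= eGamma x)%E.
Proof. by apply: integral_ge0 => t _; rewrite lee_fin gamma_integrand_ge0. Qed.

(** An exhaustion by segments that stay away from both endpoints, where the
integrand is continuous; monotone convergence along it transports the
integration by parts to the whole half-line. *)
Lemma bigcup_itvV : \bigcup_n `[(n.+2%:R^-1 : R), n.+2%:R]%classic = `]0, +oo[%classic.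
Proof.
apply/seteqP; split => [t [n _]|t] /=; rewrite !in_itv/=.
  by case/andP => nt _; rewrite andbT (lt_le_trans _ nt)// invr_gt0.
rewrite andbT => t0; pose m := Num.truncn (t + t^-1).
have mt : t + t^-1 < m.+1%:R by apply: truncnS_gt.
exists m => //=; rewrite in_itv/=; apply/andP; split.
  rewrite -[leRHS]invrK lef_pV2 ?posrE ?invr_gt0//.
  by rewrite (@le_trans _ _ m.+1%:R) ?ler_nat// ltW// (le_lt_trans _ mt)// lerDr ltW.
rewrite (@le_trans _ _ m.+1%:R) ?ler_nat// ltW// (le_lt_trans _ mt)// lerDl.
by rewrite invr_ge0 ltW.
Qed.

Lemma eGamma_cvg (x : R) :
  (\int[mu]_(t in `[n.+2%:R^-1%R, n.+2%:R%R]) (gamma_integrand x t)%:E)%E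
    @[n --> \oo] --> eGamma x.
Proof.
rewrite /eGamma -bigcup_itvV; apply: ge0_nondecreasing_set_cvg_integral.
- apply/nondecreasing_seqP => n; rewrite subsetEset => t /=; rewrite !in_itv/=.
  case/andP => nt tn; rewrite (le_trans _ nt) ?(le_trans tn) ?ler_nat//.
  by rewrite lef_pV2 ?posrE ?ler_nat.
- by move=> i; exact: measurable_itv.
- by move=> i; exact: measurable_gamma_integrand.
- by move=> i t _; rewrite lee_fin gamma_integrand_ge0.
Qed.

Lemma powR_expRN_le (x t : R) : 1 <= t ->
  t `^ x * expR (- t) <= (Num.truncn x).+2`!%:R / t.
Proof.
move=> t1; have t0 : 0 < t by apply: lt_le_trans t1.
set m := Num.truncn x; rewrite expRN ler_pdivrMr ?expR_gt0//.
rewrite mulrAC ler_pdivlMr//.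
have tx : t `^ x <= t ^+ m.+1.
  rewrite -powR_mulrn ?(ltW t0)//; apply: (ler_powR t1).
  by rewrite ltW// truncnS_gt.
rewrite (@le_trans _ _ (t ^+ m.+2))//; first by rewrite exprSr ler_pM2r.
have := expR_ge1Dxn m.+1 (ltW t0); rewrite -ler_pdivrMl ?ltr0n ?fact_gt0//.
by apply: le_trans; rewrite mulrC lerDr.
Qed.

Lemma gamma_boundary_cvg (x : R) : 0 < x ->
  (n.+2%:R `^ x * expR (- n.+2%:R) - n.+2%:R^-1 `^ x * expR (- n.+2%:R^-1) : R)
    @[n --> \oo] --> (0 : R).
Proof.
move=> x0; rewrite -[X in _ --> X]subr0; apply: cvgB.
  apply: (@squeeze_cvgr _ _ _ _ (cst 0) (fun n => (Num.truncn x).+2`!%:R * n.+2%:R^-1)).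
  - apply: nearW => n; rewrite mulr_ge0 ?powR_ge0 ?expR_ge0//=.
    by apply: powR_expRN_le; rewrite ler1n.
  - exact: cvg_cst.
  - rewrite -[X in _ --> X](mulr0 (Num.truncn x).+2`!%:R); apply: cvgMr.
    by have := @cvg_harmonic R; rewrite -cvg_shiftS.
have cx : (n.+2%:R^-1 `^ x : R) @[n --> \oo] --> (0 : R).
  have /cvg_at_rightP := powR_cvg0 x0; apply; split=> [n|].
    by rewrite invr_gt0.
  by have := @cvg_harmonic R; rewrite -cvg_shiftS.
apply: (@squeeze_cvgr _ _ _ _ (cst 0) (fun n => n.+2%:R^-1 `^ x)) => //.
  apply: nearW => n; rewrite mulr_ge0 ?powR_ge0 ?expR_ge0//=.
  by rewrite ler_piMr ?powR_ge0// expR_le1 oppr_le0 invr_ge0.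
exact: cvg_cst.
Qed.

Lemma continuous_gamma_integrand (x t : R) : 0 < t ->
  {for t, continuous (gamma_integrand x)}.
Proof.
move=> t0; apply: (@continuousM _ _ _ _ t).
  exact: continuous_powR.
exact: continuous_expRN.
Qed.

Lemma integrable_gamma_integrand (x a b : R) : 0 < a ->
  mu.-integrable `[a, b] (fun t => (gamma_integrand x t)%:E).
Proof.
move=> a0; apply: continuous_compact_integrable; first exact: segment_compact.
apply: continuous_in_subspaceT => t; rewrite inE/= in_itv/= => /andP[at_ _].
by apply: continuous_gamma_integrand; apply: lt_le_trans at_.
Qed.

Lemma gamma_integral_by_parts (x a b : R) : 0 < a -> a < b ->
  (x%:E * \int[mu]_(t in `[a, b]) (gamma_integrand x t)%:E =
   \int[mu]_(t in `[a, b]) (gamma_integrand (x + 1) t)%:E +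
   (b `^ x * expR (- b) - a `^ x * expR (- a))%:E)%E.
Proof.
move=> a0 ab.
have <- : (\int[mu]_(t in `[a, b])
    (x * gamma_integrand x t - gamma_integrand (x + 1) t)%:E =
    (b `^ x * expR (- b) - a `^ x * expR (- a))%:E)%E.
  apply: (integral_is_derive (fun t => x * gamma_integrand x t -
     gamma_integrand (x + 1) t) (fun t => t `^ x * expR (- t))) => // t.
    rewrite in_itv/= => /andP[at_ _]; have t0 := lt_le_trans a0 at_.
    apply: (@continuousB _ _ _ _ _ t); last exact: continuous_gamma_integrand.
    by apply: continuousM; [exact: cvg_cst|exact: continuous_gamma_integrand].
  rewrite in_itv/= => /andP[at_ _]; have t0 := lt_le_trans a0 at_.
  by rewrite /gamma_integrand addrK; exact: is_derive_powR_expRN.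
have i1 := integrable_gamma_integrand x a b a0.
have i2 := integrable_gamma_integrand (x + 1) a b a0.
have i3 : mu.-integrable `[a, b] (fun t => x%:E * (gamma_integrand x t)%:E)%E.
  exact: integrableZl.
under [X in (_ + X)%E]eq_integral do rewrite EFinB EFinM.
rewrite integralB// integralZl//.
by rewrite addeC subeK//; exact: integrable_fin_num.
Qed.

Lemma eGammaD1 (x : R) : 0 < x -> (eGamma (x + 1) = x%:E * eGamma x)%E.
Proof.
move=> x0; have lim1 := cvgeZl (isT : x%:E \is a fin_num) (eGamma_cvg x).
have lim0 : ((n.+2%:R `^ x * expR (- n.+2%:R) -
    n.+2%:R^-1 `^ x * expR (- n.+2%:R^-1) : R)%:E @[n --> \oo] --> 0%E)%E.
  by apply: cvg_EFin; [exact: nearW|exact: gamma_boundary_cvg].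
have fin0 : (0 : \bar R)%E \is a fin_num by [].
have lim2 := cvgeD (fin_num_adde_defl (eGamma (x + 1)) fin0) (eGamma_cvg (x + 1)) lim0.
rewrite adde0 in lim2; apply/esym/(cvg_unique _ lim1) => //=.
under eq_fun => n.
  rewrite gamma_integral_by_parts ?invr_gt0//; last first.
    by rewrite (@lt_trans _ _ 1) ?invf_lt1 ?ltr1n.
  over.
exact: lim2.
Qed.

Lemma eGamma1 : eGamma 1 = 1%E.
Proof.
rewrite /eGamma /gamma_integrand subrr.
under eq_integral do rewrite powRr0 mul1r.
rewrite integral_itv_obnd_cbnd; last first.
  by apply/measurable_EFinP/measurable_funTS/measurableT_comp; [exact: measurable_expR|exact: oppr_measurable].
have d (t : R) : is_derive t (1 : R) (fun u => - expR (- u)) (expR (- t)).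
  by apply: is_derive_eq; rewrite /GRing.scale/=; ring.
rewrite (@ge0_continuous_FTC2y _ _ (fun u => - expR (- u)) 0 0).
- by rewrite oppr0 expR0 -EFinB opprK add0r.
- by move=> t _; exact: expR_ge0.
- by apply: continuous_subspaceT => t; exact: continuous_expRN.
- by rewrite -[X in _ --> X]oppr0; apply: cvgN; exact: cvgr_expR.
- by move=> t _; have [] := d t.
- by apply: cvg_at_right_filter; apply: cvgN; exact: continuous_expRN.
- by move=> t _; rewrite derive1E; have [_ ->] := d t.
Qed.

Lemma eGamma_nat n : eGamma n.+1%:R = n`!%:R%:E.
Proof.
elim: n => [|n IH]; first by rewrite eGamma1.
by rewrite -natr1 eGammaD1// IH factS natrM EFinM.
Qed.

(** A concave function lies below its tangent, here at u = 1.  In exponential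
form this is the convexity inequality between s and 1 - s, obtained by adding
the two tangent inequalities for the exponential. *)
Lemma powR_le_tangent (s u : R) : 0 <= s <= 1 -> 0 < u ->
  u `^ s <= 1 - s + s * u.
Proof.
move=> /andP[s0 s1] u0; have uE : u = expR (ln u) by rewrite lnK.
rewrite {1}uE -expRM {2}uE; set L := ln u.
have h1 := expR_ge1Dx ((1 - s) * L); have h2 := expR_ge1Dx (- (L * s)).
have -> : expR L = expR (L * s) * expR ((1 - s) * L).
  by rewrite -expRD; congr expR; ring.
have e0 : 0 < expR (L * s) by exact: expR_gt0.
have eV : expR (L * s) * expR (- (L * s)) = 1 by exact: expRxMexpNx_1.
have k1 := ler_wpM2l s0 h1.
have k2 : (1 - s) * (1 + - (L * s)) <= (1 - s) * expR (- (L * s)).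
  by rewrite ler_wpM2l// subr_ge0.
have k : 1 <= (1 - s) * expR (- (L * s)) + s * expR ((1 - s) * L) by nra.
have := ler_wpM2l (ltW e0) k; rewrite mulr1 => /le_trans; apply.
by rewrite mulrDr mulrCA eV mulr1 (mulrCA (expR _) s).
Qed.

(** The integrand of G(y+s) is y^s times that of G(y) times (t/y)^s, and
(t/y)^s <= 1 - s + s t/y.  Integrating, the right-hand side becomes
y^s ((1-s) G(y) + (s/y) G(y+1)), that is y^s G(y). *)
Lemma eGamma_wendel (y s : R) : 0 < y -> 0 <= s <= 1 ->
  (eGamma (y + s) <= (y `^ s)%:E * eGamma y)%E.
Proof.
move=> y0 s01; have /andP[s0 s1] := s01.
have e1 : (eGamma y = (1 - s)%:E * eGamma y + (s / y)%:E * eGamma (y + 1))%E.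
  rewrite eGammaD1// muleA -EFinM divfK ?gt_eqF//.
  by rewrite -ge0_muleDl ?lee_fin ?subr_ge0// -EFinD subrK mul1e.
rewrite [in leRHS]e1 /eGamma.
have m1 z := measurable_gamma_integrand z _ (measurable_itv `]0%R, +oo[).
have g0 z t : (0 <= (gamma_integrand z t)%:E)%E.
  by rewrite lee_fin gamma_integrand_ge0.
have sy0 : 0 <= s / y by rewrite divr_ge0// ltW.
have s10 : 0 <= 1 - s by rewrite subr_ge0.
have mZ (c z : R) : measurable_fun (`]0%R, +oo[%classic : set R)
    (fun t : R => c%:E * (gamma_integrand z t)%:E)%E.
  by apply: measurable_funeM; exact: m1.
have gZ (c z t : R) : 0 <= c -> (0 <= c%:E * (gamma_integrand z t)%:E)%E.
  by move=> c0; rewrite mule_ge0.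
rewrite -!ge0_integralZl//; try exact: m1.
rewrite -ge0_integralD//; try exact: mZ; try by move=> t _; exact: gZ.
have mD : measurable_fun (`]0%R, +oo[%classic : set R) (fun t : R =>
    (1 - s)%:E * (gamma_integrand y t)%:E +
    (s / y)%:E * (gamma_integrand (y + 1) t)%:E)%E.
  by apply: emeasurable_funD; exact: mZ.
rewrite -ge0_integralZl//; last 2 first.
- by move=> t _; rewrite adde_ge0 ?gZ.
- by rewrite lee_fin powR_ge0.
apply: ge0_le_integral => //; first exact: m1.
  by apply: measurable_funeM; exact: mD.
move=> t; rewrite /= in_itv/= andbT => t0.
suff : gamma_integrand (y + s) t <= y `^ s *
    ((1 - s) * gamma_integrand y t + s / y * gamma_integrand (y + 1) t).
  by rewrite -lee_fin EFinM EFinD !EFinM.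
rewrite /gamma_integrand addrK.
have -> : y + s - 1 = (y - 1) + s by ring.
rewrite powRD; last by rewrite (gt_eqF t0) implybT.
have := powR_le_tangent s (t / y) s01 (divr_gt0 t0 y0).
rewrite -(mulr_powRB1 (ltW t0) y0).
have yV : y `^ s * y^-1 `^ s = 1.
  by rewrite -powRM ?invr_ge0 ?(ltW t0) ?(ltW y0)// divff ?gt_eqF// powR1.
rewrite powRM ?invr_ge0 ?(ltW t0) ?(ltW y0)//.
have Q : 0 <= y `^ s * (t `^ (y - 1) * expR (- t)).
  by rewrite mulr_ge0 ?powR_ge0 ?gamma_integrand_ge0.
move/(ler_wpM2l Q); rewrite -!mulrA => /le_trans tangent.
rewrite [leLHS](_ : _ = y `^ s * y^-1 `^ s *
   (t `^ (y - 1) * (t `^ s * expR (- t)))); last by rewrite yV mul1r.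
rewrite [leLHS](_ : _ = y `^ s * (t `^ (y - 1) * (expR (- t) *
   (t `^ s * y^-1 `^ s)))); last by ring.
by apply: tangent; rewrite le_eqVlt; apply/orP; left; apply/eqP; ring.
Qed.

(** Between consecutive integers, Wendel's inequality bounds the integral by
its value at an integer, which is a factorial. *)
Lemma eGamma_lty (x : R) : 0 < x -> (eGamma x < +oo)%E.
Proof.
move=> x0; set m := Num.truncn x.
have /andP[mx xm] : m%:R <= x < m.+1%:R by apply: truncn_itv; exact: ltW.
have : (eGamma (x + 1) < +oo)%E.
  have -> : x + 1 = m.+1%:R + (x - m%:R) by rewrite -natr1; ring.
  apply: (le_lt_trans (eGamma_wendel _ _ _ _)) => //.
    by rewrite subr_ge0 mx/= lerBlDl natr1 ltW.
  by rewrite eGamma_nat -EFinM ltry.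
have := eGamma_ge0 x.
rewrite eGammaD1//; case: (eGamma x) => [r|_|//]; first by rewrite !ltry.
by rewrite gt0_muley ?lte_fin.
Qed.

Lemma eGammaE (x : R) : 0 < x -> eGamma x = (Gamma x)%:E.
Proof. by move=> x0; rewrite GammaE fineK// ge0_fin_numE ?eGamma_ge0 ?eGamma_lty. Qed.

Lemma GammaD1 (x : R) : 0 < x -> Gamma (x + 1) = x * Gamma x.
Proof.
move=> x0; apply: EFin_inj; rewrite EFinM -!eGammaE ?addr_gt0//.
exact: eGammaD1.
Qed.

Lemma Gamma_nat n : Gamma n.+1%:R = n`!%:R :> R.
Proof. by rewrite GammaE eGamma_nat. Qed.

Lemma Gamma_wendel (y s : R) : 0 < y -> 0 <= s <= 1 ->
  Gamma (y + s) <= y `^ s * Gamma y.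
Proof.
move=> y0 s01; have /andP[s0 _] := s01.
by rewrite -lee_fin EFinM -!eGammaE ?ltr_wpDr// eGamma_wendel.
Qed.

Lemma Gamma_gt0 (x : R) : 0 < x -> 0 < Gamma x.
Proof.
move=> x0; set m := Num.truncn x.
have /andP[mx xm] : m%:R <= x < m.+1%:R by apply: truncn_itv; exact: ltW.
have : 0 < Gamma (x + (m.+1%:R - x)) by rewrite addrC subrK Gamma_nat ltr0n fact_gt0.
move/lt_le_trans => /(_ _ (Gamma_wendel x (m.+1%:R - x) x0 _)).
rewrite subr_ge0 ltW//= lerBlDr -natr1 addrC lerD2l => /(_ mx).
by rewrite pmulr_rgt0 ?powR_gt0.
Qed.

End RealAnalysis.

(** * Wallis integrals and the product formula for the sine *)

Section SineProduct.
Import numFieldNormedType.Exports.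
Local Open Scope classical_set_scope.
Local Open Scope ring_scope.
Context {R : realType}.
Local Notation mu := (@lebesgue_measure R).

Lemma sin_le_id (u : R) : 0 <= u -> sin u <= u.
Proof.
rewrite le_eqVlt => /predU1P[<-|u0]; first by rewrite sin0.
have [c _] := MVT u0 (fun t _ => is_derive_sin t)
  (continuous_subspaceT (@continuous_sin R)).
by rewrite sin0 !subr0 => ->; rewrite ler_piMl ?cos_le1// ltW.
Qed.

Lemma sqr_sin_le (u : R) : sin u ^+ 2 <= u ^+ 2.
Proof.
wlog u0 : u / 0 <= u.
  move=> H; have [/H//|/ltW u0] := leP 0 u.
  by rewrite -sqrrN -sinN -(sqrrN u) H// oppr_ge0.
have := sin_le_id u u0; have := cos2Dsin2 u.
have [s0|s0] := leP 0 (sin u); first by move=> _ h; rewrite ler_sqr// nnegrE.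
have [u1|u1] := leP u 1.
  have : 0 <= sin u.
    by apply: sin_ge0_pi; rewrite u0/= (le_trans u1)// (le_trans _ (pi_ge2 R))// ler1n.
  by rewrite leNgt s0.
move=> h _; apply: (@le_trans _ _ 1); last by rewrite expr_ge1// ltW.
by rewrite -h lerDr sqr_ge0.
Qed.

(** The difference sin u - u cos u vanishes at 0 and has derivative u sin u.
This is the inequality t <= tan t without division. *)
Lemma tcos_le_sin (t : R) : 0 <= t <= pi / 2 -> t * cos t <= sin t.
Proof.
case/andP; rewrite le_eqVlt => /predU1P[<-|t0] tp; first by rewrite mul0r sin0.
pose f (u : R) := sin u - u * cos u.
have df (u : R) : is_derive u (1 : R) f (u * sin u).
  by apply: is_derive_eq; rewrite /GRing.scale/=; ring.
have cf : {within `[0, t], continuous f}.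
  by apply: derivable_within_continuous => u _; have [] := df u.
have [c] := MVT t0 (fun u _ => df u) cf.
rewrite in_itv/= => /andP[c0 ct].
rewrite /f sin0 mul0r !subr0 => E; rewrite -subr_ge0 E.
rewrite mulr_ge0 ?mulr_ge0 ?ltW// sin_gt0_pihalf// c0 (lt_le_trans ct)//.
Qed.

(** At x = 0 the integral of this function is the classical Wallis integral;
the recurrence in n produces one factor of the product for the sine. *)
Definition wallis_integrand (n : nat) (x t : R) : R := cos (2 * x * t) * cos t ^+ n.

Definition wallis (n : nat) (x : R) : R :=
  \int[mu]_(t in `[0, pi / 2]) wallis_integrand n x t.

Lemma is_derive_cosM (c t : R) : is_derive t (1 : R) (fun u => cos (c * u)) (- (c * sin (c * t))).
Proof.
apply: (is_derive_eq (@is_derive1_comp _ cos (fun u => c * u) t _ c _ _)).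
  by apply: is_derive_eq; rewrite /GRing.scale/=; ring.
by ring.
Qed.

Lemma is_derive_sinM (c t : R) : is_derive t (1 : R) (fun u => sin (c * u)) (c * cos (c * t)).
Proof.
apply: (is_derive_eq (@is_derive1_comp _ sin (fun u => c * u) t _ c _ _)).
  by apply: is_derive_eq; rewrite /GRing.scale/=; ring.
by ring.
Qed.

Lemma is_derive_cosX n (t : R) :
  is_derive t (1 : R) (fun u => cos u ^+ n) (- (n%:R * cos t ^+ n.-1 * sin t)).
Proof.
have -> : (fun u => cos u ^+ n) = cos ^+ n :> (R -> R) by apply/funext => u; rewrite fctE.
by apply: is_derive_eq; rewrite /GRing.scale/=; ring.
Qed.

Lemma continuous_wallis_integrand n (x : R) : continuous (wallis_integrand n x).
Proof.
move=> t; apply: (@continuousM _ _ _ _ t); apply: differentiable_continuous;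
  apply/derivable1_diffP.
  by have [] := is_derive_cosM (2 * x) t.
by have [] := is_derive_cosX n t.
Qed.

Lemma integrable_segment (f : R -> R) (a b : R) : continuous f ->
  mu.-integrable `[a, b] (fun t => (f t)%:E).
Proof.
move=> cf; apply: continuous_compact_integrable; first exact: segment_compact.
exact: continuous_subspaceT.
Qed.

Lemma integrable_wallis n (x : R) :
  mu.-integrable `[0, pi / 2] (fun t => (wallis_integrand n x t)%:E).
Proof. by apply: integrable_segment; exact: continuous_wallis_integrand. Qed.

Lemma pihalf_gt0 : 0 < pi / 2 :> R.
Proof. by rewrite divr_gt0// pi_gt0. Qed.

(** Two integrations by parts, done at once by exhibiting a primitive of the
difference of the two sides which vanishes at 0 and at pi/2. *)
Lemma wallis_rec n (x : R) :
  (n.+2%:R ^+ 2 - 4 * x ^+ 2) * wallis n.+2 x = n.+2%:R * n.+1%:R * wallis n x.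
Proof.
pose F (t : R) := n.+2%:R * (cos (2 * x * t) * (cos t ^+ n.+1 * sin t))
  - 2 * x * (sin (2 * x * t) * cos t ^+ n.+2).
pose f (t : R) := (n.+2%:R ^+ 2 - 4 * x ^+ 2) * wallis_integrand n.+2 x t
  - n.+2%:R * n.+1%:R * wallis_integrand n x t.
have dF (t : R) : is_derive t (1 : R) F (f t).
  have d1 := is_derive_cosM (2 * x) t.
  have d2 := is_derive_sinM (2 * x) t.
  have d3 := is_derive_cosX n.+1 t.
  have d4 := is_derive_cosX n.+2 t.
  apply: is_derive_eq; rewrite /GRing.scale/= /f /wallis_integrand.
  apply/eqP; rewrite -subr_eq0; apply/eqP.
  transitivity (n.+2%:R * n.+1%:R * cos (2 * x * t) * cos t ^+ n *
    (1 - (cos t ^+ 2 + sin t ^+ 2))); last by rewrite cos2Dsin2 subrr mulr0.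
  by rewrite -(natr1 n.+1) !exprS; ring.
have cf : {in `[0, pi / 2], forall t, {for t, continuous f}}.
  move=> t _; apply: (@continuousB _ _ _ _ _ t);
    apply: (@continuousM _ _ _ _ t); try exact: cvg_cst;
    exact: continuous_wallis_integrand.
have := integral_is_derive f F 0 (pi / 2) pihalf_gt0 cf (fun t _ => dF t).
have iZ c m : mu.-integrable `[0, pi / 2] (fun t => (c * wallis_integrand m x t)%:E).
  apply: integrable_segment => t; apply: (@continuousM _ _ _ _ t).
    exact: cvg_cst.
  exact: continuous_wallis_integrand.
move/(congr1 fine); rewrite /= -/(Rintegral _ _ _) RintegralB//.
rewrite !RintegralZl//; try exact: integrable_wallis.
rewrite /F !mulr0 cos0 sin0 sin_pihalf cos_pihalf !expr0n/= !mul0r !mulr0 subrr.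
by move/eqP; rewrite subr_eq0 => /eqP.
all: exact: iZ.
Qed.

Lemma wallis00 : wallis 0 0 = pi / 2.
Proof.
rewrite /wallis /wallis_integrand.
under eq_Rintegral do rewrite mulr0 mul0r cos0 expr0 mul1r.
rewrite Rintegral_cst//= lebesgue_measure_itv/= lte_fin pihalf_gt0 /=.
by rewrite subr0 mul1r.
Qed.

Lemma wallis0 (x : R) : x != 0 -> wallis 0 x = sin (pi * x) / (2 * x).
Proof.
move=> x0.
pose F (t : R) := (2 * x)^-1 * sin (2 * x * t).
have dF (t : R) : is_derive t (1 : R) F (wallis_integrand 0 x t).
  have d2 := is_derive_sinM (2 * x) t.
  apply: is_derive_eq; rewrite /GRing.scale/= /wallis_integrand; field.
  by rewrite x0.
have := integral_is_derive _ F 0 (pi / 2) pihalf_gt0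
  (fun t _ => continuous_wallis_integrand 0 x t) (fun t _ => dF t).
move/(congr1 fine); rewrite /= -/(Rintegral _ _ _) -/(wallis 0 x) => ->.
rewrite /F mulr0 sin0 mulr0 subr0 mulrC; congr (sin _ / _).
by field.
Qed.

Lemma wallis_gt0 m : 0 < wallis m.*2 0.
Proof.
elim: m => [|m IH]; first by rewrite wallis00 pihalf_gt0.
have := wallis_rec m.*2 0; rewrite expr0n mulr0 subr0 doubleS => E.
have n0 k : 0 < k.+1%:R :> R by rewrite ltr0n.
have : 0 < m.*2.+2%:R ^+ 2 * wallis m.*2.+2 0 by rewrite E !mulr_gt0.
by rewrite pmulr_rgt0// exprn_gt0.
Qed.

Lemma wallis_le n (x : R) : wallis n x <= wallis n 0.
Proof.
apply: le_Rintegral => //; try exact: integrable_wallis.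
move=> t; rewrite /= in_itv/= => /andP[t0 tp].
rewrite /wallis_integrand mulr0 mul0r cos0 ler_wpM2r ?cos_le1//.
by rewrite exprn_ge0// cos_ge0_pihalf// tp andbT (le_trans _ t0)// oppr_le0 ltW ?pihalf_gt0.
Qed.

(** Since 1 - cos(2xt) = 2 sin(xt)^2 <= 2 (xt)^2 and t cos t <= sin t, the two
extra factors cos t turn the loss into 2 x^2 cos(t)^n sin(t)^2, and
sin^2 = 1 - cos^2. *)
Lemma wallis_ge n (x : R) :
  wallis n.+2 0 - wallis n.+2 x <= 2 * x ^+ 2 * (wallis n 0 - wallis n.+2 0).
Proof.
have cB m1 y1 m2 y2 :
    continuous (fun t => wallis_integrand m1 y1 t - wallis_integrand m2 y2 t).
  by move=> t; apply: (@continuousB _ _ _ _ _ t); exact: continuous_wallis_integrand.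
have iB m1 y1 m2 y2 := integrable_segment _ 0 (pi / 2) (cB m1 y1 m2 y2).
rewrite -!RintegralB//; try exact: integrable_wallis.
rewrite -RintegralZl//; last exact: iB.
apply: le_Rintegral => //; first exact: iB.
  apply: integrable_segment => t; apply: (@continuousM _ _ _ _ t).
    exact: cvg_cst.
  exact: cB.
move=> t; rewrite /= in_itv/= => /andP[t0 tp].
rewrite /wallis_integrand mulr0 mul0r cos0 !mul1r.
have c0 : 0 <= cos t ^+ n.
  by rewrite exprn_ge0// cos_ge0_pihalf// tp andbT (le_trans _ t0)// oppr_le0 ltW ?pihalf_gt0.
have -> : cos (2 * x * t) = 1 - 2 * sin (x * t) ^+ 2.
  have -> : 2 * x * t = x * t + x * t by ring.
  by rewrite cosD -!expr2 cos2sin2; ring.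
have h1 := sqr_sin_le (x * t); have h2 := tcos_le_sin t.
have h3 : (t * cos t) ^+ 2 <= sin t ^+ 2.
  rewrite ler_sqr ?nnegrE ?h2 ?t0 ?mulr_ge0//.
    by rewrite cos_ge0_pihalf// tp andbT (le_trans _ t0)// oppr_le0 ltW ?pihalf_gt0.
  by rewrite sin_ge0_pi// t0/= (le_trans tp)// ler_pdivrMr// ler_peMr ?pi_ge0// ler1n.
rewrite [leRHS](_ : _ = cos t ^+ n * (2 * x ^+ 2 * sin t ^+ 2)); last first.
  by rewrite sin2cos2 !exprS; ring.
rewrite [leLHS](_ : _ = cos t ^+ n * (2 * cos t ^+ 2 * sin (x * t) ^+ 2)); last first.
  by rewrite !exprS; ring.
rewrite ler_wpM2l//.
apply: (@le_trans _ _ (2 * cos t ^+ 2 * (x * t) ^+ 2)).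
  by rewrite ler_wpM2l// mulr_ge0// sqr_ge0.
rewrite [leLHS](_ : _ = 2 * x ^+ 2 * (t * cos t) ^+ 2); last by ring.
by rewrite ler_wpM2l// mulr_ge0// sqr_ge0.
Qed.

Definition sine_prod (m : nat) (x : R) : R := \prod_(k < m) (1 - x ^+ 2 / k.+1%:R ^+ 2).

Lemma sine_prod_gt0 m (x : R) : 0 < x < 1 -> 0 < sine_prod m x.
Proof.
move=> /andP[x0 x1]; apply: prodr_gt0 => k _.
rewrite subr_gt0 ltr_pdivrMr ?exprn_gt0// mul1r ltr_sqr ?nnegrE ?ltW//.
by rewrite (lt_le_trans x1)// ler1n.
Qed.

(** By [wallis_rec] the quotient of the integrals for x and for 0 is multiplied
by 1 / (1 - x^2/k^2) when n goes from 2k - 2 to 2k, and for n = 0 the integrals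
are explicit. *)
Lemma wallis_sine_prod m (x : R) : 0 < x < 1 ->
  sine_prod m x * wallis m.*2 x = sin (pi * x) / (pi * x) * wallis m.*2 0.
Proof.
move=> x01; have /andP[x0 x1] := x01.
elim: m => [|m IH].
  rewrite /sine_prod big_ord0 mul1r wallis0 ?gt_eqF// wallis00.
  move: (sin (pi * x)) (pi : R) (pi_gt0 R) => s p p0; field.
  by rewrite !gt_eqF.
rewrite /sine_prod big_ord_recr/= -/(sine_prod m x).
have := wallis_rec m.*2 0; rewrite expr0n mulr0 subr0 doubleS => E.
have := wallis_rec m.*2 x => Ex.
have n0 k : 0 < k.+1%:R :> R by rewrite ltr0n.
have m2 : m.*2.+2%:R = 2 * m.+1%:R :> R by rewrite -doubleS -mul2n natrM.
apply: (mulfI (lt0r_neq0 (exprn_gt0 2 (n0 m.*2.+1)))).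
rewrite [RHS]mulrCA E [RHS]mulrCA -IH.
rewrite [RHS](_ : _ = sine_prod m x * (m.*2.+2%:R * m.*2.+1%:R * wallis m.*2 x)); last by ring.
rewrite -Ex m2; move: (m.+1%:R : R) (n0 m) => c c0; field.
by rewrite gt_eqF.
Qed.

(** The quotient of the Wallis integrals for x and for 0 is at most 1, and by
[wallis_ge] at least 1 - O(1/m), because the recurrence shows that the integrals
for 0 at n and n + 2 differ by the factor 1 + 1/(n+1). *)
Lemma sine_prod_bounds m (x : R) : 0 < x < 1 ->
  sine_prod m.+1 x * (1 - 2 / m.*2.+1%:R) <= sin (pi * x) / (pi * x) <= sine_prod m.+1 x.
Proof.
move=> x01; have /andP[x0 x1] := x01.
have w0 := wallis_gt0 m.+1; have s0 := sine_prod_gt0 m.+1 x x01.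
have E := wallis_sine_prod m.+1 x x01.
have n0 k : 0 < k.+1%:R :> R by rewrite ltr0n.
apply/andP; split; rewrite -(ler_pM2r w0) -E -?mulrA ler_pM2l//; last exact: wallis_le.
have Hge := wallis_ge m.*2 x; rewrite doubleS in w0 *.
have := wallis_rec m.*2 0; rewrite expr0n mulr0 subr0 expr2 -!mulrA.
move/(mulfI (lt0r_neq0 (n0 _))) => Er.
have q0 : m.*2.+1%:R != 0 :> R by rewrite gt_eqF.
have Ew : wallis m.*2 0 = (1 + m.*2.+1%:R^-1) * wallis m.*2.+2 0.
  by apply: (mulfI q0); rewrite -Er -(natr1 m.*2.+1); field.
rewrite Ew in Hge; set q := m.*2.+1%:R in q0 Hge *.
have q1 : 0 < q^-1 by rewrite invr_gt0 n0.
have x2 : x ^+ 2 <= 1 by rewrite expr_le1// ltW.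
have := ler_wpM2r (ltW (mulr_gt0 q1 w0)) x2.
move: Hge; move: (wallis m.*2.+2 0) (wallis m.*2.+2 x) (q^-1) (x ^+ 2) => w wx v y.
by clear; nra.
Qed.

End SineProduct.

(** * The reflection formula *)

(** The last clause is Wendel's inequality, a consequence of log-convexity and
the only form in which log-convexity is needed: it compares G(n + x) with
n^x G(n) for large n, which determines G from the other three properties. *)
Definition gamma_like (R : realType) (G : R -> R) : Prop :=
  [/\ forall x, 0 < x -> 0 < G x, G 1 = 1,
      forall x, 0 < x -> G (x + 1) = x * G x &
      forall y s, 0 < y -> 0 <= s <= 1 -> G (y + s) <= y `^ s * G y].

Section Gamma.
Context {R : realType} (G : R -> R) (HG : gamma_like R G).
Implicit Types x y s : R.

Lemma gamma_pos x : 0 < x -> 0 < G x.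
Proof. by case: HG => + _ _ _; apply. Qed.

Lemma gamma_add1 x : 0 < x -> G (x + 1) = x * G x.
Proof. by case: HG => _ _ + _; apply. Qed.

Lemma gamma_wendel y s : 0 < y -> 0 <= s <= 1 -> G (y + s) <= y `^ s * G y.
Proof. by case: HG => _ _ _; apply. Qed.

Lemma gamma_addn x n : 0 < x -> G (x + n%:R) = \prod_(k < n) (x + k%:R) * G x.
Proof.
move=> x0; elim: n => [|n IH]; first by rewrite addr0 big_ord0 mul1r.
by rewrite -natr1 addrA gamma_add1 ?ltr_wpDr// IH big_ord_recr/= mulrCA mulrA.
Qed.

Lemma gamma_nat n : G n.+1%:R = n`!%:R.
Proof.
elim: n => [|n IH]; first by case: HG.
by rewrite -natr1 gamma_add1// IH factS natrM.
Qed.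

(** Wendel's inequality from y + s to y + 1, a step of length 1 - s. *)
Lemma gamma_wendel_ge y s : 0 < y -> 0 <= s <= 1 ->
  y * G y <= (y + s) `^ (1 - s) * G (y + s).
Proof.
move=> y0 /andP[s0 s1]; rewrite -gamma_add1//.
have -> : y + 1 = (y + s) + (1 - s) by ring.
apply: gamma_wendel; first by rewrite ltr_wpDr.
by rewrite subr_ge0 s1 lerBlDr lerDl.
Qed.

Lemma le0_small (a c : R) : (forall m, a <= c / m.+1%:R) -> a <= 0.
Proof.
move=> H; rewrite leNgt; apply/negP => a0.
have c0 : 0 < c by have := lt_le_trans a0 (H 0%N); rewrite divr1.
have := H (Num.truncn (c / a)).
rewrite ler_pdivlMr// leNgt => /negP; apply.
by rewrite mulrC -ltr_pdivrMr// truncnS_gt.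
Qed.

Lemma eq_small_dist (a c : R) : (forall n, `|a| <= c / n.+1%:R) -> a = 0.
Proof. by move=> H; apply/eqP; rewrite -normr_le0; exact: le0_small H. Qed.

(** Descending from n + 1 + x to x and from n + 2 - x to 1 - x produces the
factors k + x and k - x, that is k^2 (1 - x^2/k^2). *)
Lemma gamma_reflection_prod n x : 0 < x < 1 ->
  G x * G (1 - x) * (x * (n.+1%:R - x) * sine_prod n x) * n`!%:R ^+ 2 =
  G (n.+1%:R + x) * G (n.+1%:R + (1 - x)).
Proof.
move=> /andP[x0 x1].
have y0 : 0 < 1 - x by rewrite subr_gt0.
rewrite !(addrC n.+1%:R) !gamma_addn//.
rewrite big_ord_recl/= addr0 [X in _ = _ * (X * _)]big_ord_recr/=.
have -> : 1 - x + n%:R = n.+1%:R - x by rewrite -natr1; ring.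
have -> : n`!%:R ^+ 2 = \prod_(k < n) k.+1%:R ^+ 2 :> R.
  elim: n => [|n IH]; first by rewrite big_ord0 expr1n.
  by rewrite factS natrM exprMn big_ord_recr/= -IH mulrC.
have -> : (\prod_(k < n) (x + (bump 0 k)%:R)) = \prod_(k < n) (k.+1%:R + x).
  by apply: eq_bigr => k _; rewrite /bump/= add1n addrC.
have -> : (\prod_(k < n) (1 - x + k%:R)) = \prod_(k < n) (k.+1%:R - x).
  by apply: eq_bigr => k _; rewrite -natr1; ring.
have E : sine_prod n x * (\prod_(k < n) k.+1%:R ^+ 2) =
    \prod_(k < n) (k.+1%:R + x) * \prod_(k < n) (k.+1%:R - x).
  rewrite /sine_prod -!big_split/=; apply: eq_bigr => k _.
  have : k.+1%:R != 0 :> R by rewrite pnatr_eq0.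
  by move: (k.+1%:R : R) => c c0; field.
transitivity (G x * G (1 - x) * x * (n.+1%:R - x) *
   (sine_prod n x * (\prod_(k < n) k.+1%:R ^+ 2))); first by ring.
by rewrite E; ring.
Qed.

(** By [gamma_reflection_prod] and Wendel's inequality on both sides,
T = x G(x) G(1-x) times the finite sine product is 1 + O(1/m); by
[sine_prod_bounds] replacing the finite product by sin(pi x) / (pi x) costs
another O(1/m). *)
Lemma gamma_reflection x : 0 < x < 1 -> G x * G (1 - x) = pi / sin (pi * x).
Proof.
move=> x01; have /andP[x0 x1] := x01.
have y0 : 0 < 1 - x by rewrite subr_gt0.
have p0 := pi_gt0 R.
have sx0 : 0 < sin (pi * x) by rewrite sin_gt0_pi// mulr_gt0//= gtr_pMr.
set a := G x * G (1 - x).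
have a0 : 0 < a by rewrite mulr_gt0 ?gamma_pos.
suff : a * (x * (sin (pi * x) / (pi * x))) - 1 = 0.
  move/eqP; rewrite subr_eq0 => /eqP E.
  have key (s p : R) : 0 < s -> 0 < p -> a = a * (x * (s / (p * x))) * (p / s).
    by move=> s0 q0; field; rewrite !gt_eqF.
  by rewrite (key _ _ sx0 p0) E mul1r.
(* both error terms are O(1/m); 10 leaves room in the final estimate, where
   T differs from 1 by a multiple of 1/m and is at most 2 *)
apply: (eq_small_dist _ 10) => m.
set N : R := m.+2%:R; set S := sine_prod m.+1 x.
have N1 : 2 <= N by rewrite ler_nat.
have N0 : 0 < N by lra.
have S0 : 0 < S by exact: sine_prod_gt0.
have /andP[lo up] := sine_prod_bounds m x x01.
have f0 : 0 < (m.+1)`!%:R :> R by rewrite ltr0n fact_gt0.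
have E := gamma_reflection_prod m.+1 x x01; rewrite -/a -/N -/S in E.
clearbody a.
have GN : G N = (m.+1)`!%:R by rewrite gamma_nat.
have u1 : G (N + x) <= N `^ x * G N by apply: gamma_wendel; rewrite ?ltW.
have u2 : G (N + (1 - x)) <= N `^ (1 - x) * G N.
  by apply: gamma_wendel => //; rewrite subr_ge0 gerBl !ltW.
have l1 : N * G N <= (N + x) `^ (1 - x) * G (N + x).
  by apply: gamma_wendel_ge; rewrite ?ltW.
have l2 : N * G N <= (N + (1 - x)) `^ (1 - (1 - x)) * G (N + (1 - x)).
  by apply: gamma_wendel_ge => //; rewrite subr_ge0 gerBl !ltW.
rewrite GN in u1 u2 l1 l2; set f := (m.+1)`!%:R in f0 E u1 u2 l1 l2.
have g1 : 0 < G (N + x) by rewrite gamma_pos// addr_gt0.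
have g2 : 0 < G (N + (1 - x)) by rewrite gamma_pos// addr_gt0.
set T := a * x * S.
have T0 : 0 < T by apply: mulr_gt0 => //; apply: mulr_gt0.
have pN b c : 0 < b -> b `^ c * b `^ (1 - c) = b.
  by move=> b0; rewrite -powRD ?subrKC ?powRr1 ?ltW// (gt_eqF b0) implybT.
have Tup : T * (N - x) <= N.
  have f20 : 0 < f ^+ 2 by rewrite exprn_gt0.
  rewrite -(ler_pM2r f20) [leLHS](_ : _ = a * (x * (N - x) * S) * f ^+ 2); last by rewrite /T; ring.
  rewrite E; have -> : N * f ^+ 2 = N `^ x * f * (N `^ (1 - x) * f).
    by rewrite mulrACA pN// expr2.
  by apply: ler_pM => //; exact: ltW.
have Tlo : N <= (N + 1) * T.
  have k1 : (N + x) `^ (1 - x) <= (N + 1) `^ (1 - x).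
    by apply: ge0_ler_powR; rewrite ?nnegrE; lra.
  have k2 : (N + (1 - x)) `^ (1 - (1 - x)) <= (N + 1) `^ x.
    by rewrite subKr; apply: ge0_ler_powR; rewrite ?nnegrE; lra.
  have h1 := le_trans l1 (ler_wpM2r (ltW g1) k1).
  have h2 := le_trans l2 (ler_wpM2r (ltW g2) k2).
  have Nf : 0 <= N * f by rewrite ltW// mulr_gt0.
  have := ler_pM Nf Nf h1 h2.
  have N10 : 0 < N + 1 by lra.
  rewrite [leRHS](_ : _ = (N + 1) `^ x * (N + 1) `^ (1 - x) * (G (N + x) * G (N + (1 - x)))); last by ring.
  rewrite pN// -E.
  rewrite [leLHS](_ : _ = N ^+ 2 * f ^+ 2); last by ring.
  rewrite mulrA ler_pM2r ?exprn_gt0// => h.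
  have : N * N <= N * ((N + 1) * T).
    apply: (le_trans h).
    rewrite [leLHS](_ : _ = (N + 1) * T * (N - x)); last by rewrite /T; ring.
    by rewrite [leRHS]mulrC (ler_pM2l (mulr_gt0 N10 T0)) gerBl ltW.
  by rewrite ler_pM2l.
set s := sin (pi * x) / (pi * x) in lo up *.
have ax : 0 < a * x by rewrite mulr_gt0.
set d := 2 / m.*2.+1%:R in lo.
have Alo : T * (1 - d) <= a * (x * s).
  by rewrite /T -!mulrA ler_pM2l// ler_pM2l.
have Aup : a * (x * s) <= T by rewrite /T -!mulrA ler_pM2l// ler_pM2l.
set M : R := m.+1%:R.
have M1 : 1 <= M by rewrite ler1n.
have NM : N = M + 1 by rewrite /N /M natr1.
have dM : d * M <= 2.
  have q0 : 0 < m.*2.+1%:R :> R by rewrite ltr0n.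
  by rewrite /d mulrAC ler_pdivrMr// ler_pM2l// ler_nat ltnS -addnn leq_addr.
rewrite ler_pdivlMr; last by lra.
rewrite NM in Tup Tlo.
have T2 : T * M <= M + 1 by apply: le_trans Tup; rewrite ler_pM2l//; lra.
have T3 : T <= 2 by nra.
have d0 : 0 < d by rewrite divr_gt0.
have M0 : 0 <= M by lra.
have t1 := ler_wpM2r M0 Aup; have t2 := ler_wpM2r M0 Alo.
have t3 : T * (d * M) <= 2 * 2 by apply: ler_pM => //; rewrite ltW ?mulr_gt0//; lra.
rewrite -[X in _ * X](ger0_norm M0) -normrM ler_norml.
by apply/andP; split; nra.
Qed.
End Gamma.

Lemma Gamma_gamma_like (R : realType) : gamma_like R (@Gamma R).
Proof.
split; [exact: Gamma_gt0|exact: (Gamma_nat 0)|exact: GammaD1|exact: Gamma_wendel].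
Qed.

(** * The product of the sines of the multiples of pi/n *)

Section RootsOfUnity.
Import complex.
Local Open Scope complex_scope.
Context {R : realType}.

Definition cis (a : R) : R[i] := cos a +i* sin a.

Lemma cisX a n : cis a ^+ n = cis (n%:R * a).
Proof.
elim: n => [|n IH]; first by rewrite mul0r /cis cos0 sin0 expr0.
rewrite exprSr IH -natr1 mulrDl mul1r /cis cosD sinD.
by apply/eqP; rewrite eq_complex/=; apply/andP; split; apply/eqP; ring.
Qed.

Lemma sin_pi_nat_gt0 (k n : nat) : (0 < k < n)%N -> 0 < sin (pi * (k%:R / n%:R) : R).
Proof.
move=> /andP[k0 kn]; have n0 : (0 < n)%N by apply: leq_ltn_trans kn.
rewrite sin_gt0_pi// mulr_gt0 ?pi_gt0 ?divr_gt0 ?ltr0n//=.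
by rewrite gtr_pMr ?pi_gt0// ltr_pdivrMr ?ltr0n// mul1r ltr_nat.
Qed.

Lemma cis_double (a : R) : cis (2 * a) = (1 - 2 * sin a ^+ 2) +i* (2 * (sin a * cos a)).
Proof.
rewrite /cis (_ : 2 * a = a + a); last by ring.
rewrite cosD sinD -!expr2 cos2sin2.
by apply/eqP; rewrite eq_complex/=; apply/andP; split; apply/eqP; ring.
Qed.

(** A power e^(2 i a) is 1 only if sin a = 0, by the duplication formula for the
real part. *)
Lemma cis_primitive (n : nat) : (0 < n)%N -> n.-primitive_root (cis (2 * (pi / n%:R))).
Proof.
move=> n0; apply/andP; split=> //; apply/forallP => k; apply/eqP.
rewrite unity_rootE cisX (_ : _ * _ = 2 * (pi * (k.+1%:R / n%:R))); last by ring.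
rewrite cis_double.
have [kn|nk|kn] := ltngtP k.+1 n.
- have s0 := sin_pi_nat_gt0 k.+1 n kn.
  apply/negbTE; rewrite eq_complex/= negb_and.
  by rewrite lt_eqF// ltrBlDr ltrDl mulr_gt0// exprn_gt0.
- by have := ltn_ord k; rewrite ltnNge -ltnS nk.
- rewrite kn divff ?pnatr_eq0 -?lt0n// mulr1 sinpi.
  by rewrite expr0n mulr0 subr0 mul0r mulr0 eqxx.
Qed.

(** The factorization of 1 + X + ... + X^(n-1), evaluated at 1. *)
Lemma prod_one_sub_cis (n : nat) : (0 < n)%N ->
  \prod_(1 <= k < n) (1 - cis (2 * (pi * (k%:R / n%:R)))) = n%:R.
Proof.
move=> n0; have := factor_Xn_sub_1 (cis_primitive n n0).
rewrite big_ltn// expr0 subrX1 => /(mulfI (negbT (polyXsubC_eq0 1))).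
move/(congr1 (horner ^~ 1)); rewrite horner_prod horner_sum.
under [X in _ = X]eq_bigr do rewrite hornerXn expr1n.
rewrite sumr_const card_ord => <-; apply: eq_bigr => k _.
by rewrite hornerXsubC cisX; congr (1 - cis _); ring.
Qed.

(** The square of the modulus, which spares the square root. *)
Definition sqnorm (z : R[i]) : R := Re z ^+ 2 + Im z ^+ 2.

Lemma sqnormM : {morph sqnorm : z w / z * w}.
Proof. by move=> [a b] [c d]; rewrite /sqnorm/=; ring. Qed.

Lemma sqnorm_nat n : sqnorm n%:R = n%:R ^+ 2.
Proof. by rewrite /sqnorm !raddfMn/= mul0rn expr0n/= addr0. Qed.

(** The modulus of 1 - e^(2ia) is 2 |sin a|; so this is the modulus of the
previous product. *)
Lemma prod_sin (n : nat) : (0 < n)%N ->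
  \prod_(1 <= k < n) (2 * sin (pi * (k%:R / n%:R))) = n%:R :> R.
Proof.
move=> n0; have := congr1 sqnorm (prod_one_sub_cis n n0).
rewrite (big_morph _ sqnormM (_ : sqnorm 1 = 1)); last first.
  by rewrite /sqnorm/=; ring.
rewrite sqnorm_nat => E; apply/eqP.
rewrite -(@eqrXn2 _ 2)//; last first.
  rewrite big_nat_cond; apply: prodr_ge0 => k /andP[/sin_pi_nat_gt0 s0 _].
  by rewrite mulr_ge0// ltW.
rewrite -E -prodrXl; apply/eqP; apply: eq_bigr => k _.
set a := pi * _; rewrite cis_double /sqnorm/=.
rewrite [RHS](_ : _ = 4 * sin a ^+ 2 * (cos a ^+ 2 + sin a ^+ 2)); last by ring.
by rewrite cos2Dsin2 mulr1; ring.
Qed.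
End RootsOfUnity.

(** * The multiplication formula *)

Section Multiplication.
Context {R : realType} (G : R -> R) (HG : gamma_like R G).
Context (n : nat) (n0 : (0 < n)%N).
Implicit Types x y s : R.
Local Notation gamma_pos := (gamma_pos G HG).
Local Notation gamma_add1 := (gamma_add1 G HG).
Local Notation gamma_reflection := (gamma_reflection G HG).

Let N0 : 0 < n%:R :> R. Proof. by rewrite ltr0n. Qed.

(** The quotient of the two sides of the multiplication formula, up to a factor
which does not depend on x. *)
Definition gauss_ratio x : R :=
  n%:R `^ (n%:R * x) * \prod_(k < n) G (x + k%:R / n%:R) / G (n%:R * x).

Lemma gauss_prod_gt0 x : 0 < x -> 0 < \prod_(k < n) G (x + k%:R / n%:R).
Proof. by move=> x0; apply: prodr_gt0 => k _; rewrite gamma_pos// ltr_wpDr. Qed.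

Lemma gauss_ratio_gt0 x : 0 < x -> 0 < gauss_ratio x.
Proof.
move=> x0; rewrite divr_gt0 ?mulr_gt0 ?powR_gt0 ?gamma_pos ?gauss_prod_gt0//.
by rewrite mulr_gt0.
Qed.

(** Translation by 1/n replaces the factor G(x) of the product by G(x+1), that
is by x G(x), and multiplies n^(nx) and G(nx) by n and nx. *)
Lemma gauss_ratioDV x : 0 < x -> gauss_ratio (x + n%:R^-1) = gauss_ratio x.
Proof.
move=> x0; rewrite /gauss_ratio mulrDr divff ?gt_eqF// gamma_add1 ?mulr_gt0//.
rewrite powRD ?(gt_eqF N0) ?implybT// powRr1 ?ltW//.
have -> : \prod_(k < n) G (x + n%:R^-1 + k%:R / n%:R) =
    x * \prod_(k < n) G (x + k%:R / n%:R).
  have E : G x * \prod_(k < n) G (x + n%:R^-1 + k%:R / n%:R) =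
      \prod_(k < n) G (x + k%:R / n%:R) * G (x + 1).
    have -> : G x = G (x + 0%:R / n%:R) by rewrite mul0r addr0.
    have -> : x + 1 = x + n%:R / n%:R by rewrite divff ?gt_eqF.
    transitivity (\prod_(k < n.+1) G (x + k%:R / n%:R)); last by rewrite big_ord_recr.
    rewrite big_ord_recl/=.
    congr (_ * _); apply: eq_bigr => k _; congr G.
    by rewrite /bump add1n -natr1 mulrDl mul1r -addrA [_^-1 + _]addrC.
  apply: (mulfI (lt0r_neq0 (gamma_pos x x0))).
  by rewrite E gamma_add1//; ring.
have p0 := gamma_pos (n%:R * x) (mulr_gt0 N0 x0).
by field; rewrite !gt_eqF.
Qed.

Lemma gauss_ratioDn x (m : nat) : 0 < x -> gauss_ratio (x + m%:R / n%:R) = gauss_ratio x.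
Proof.
move=> x0; elim: m => [|m IH]; first by rewrite mul0r addr0.
by rewrite -natr1 mulrDl mul1r addrA gauss_ratioDV// ltr_wpDr.
Qed.

(** Wendel's inequality above for each factor of the numerator, and below for
the denominator; the error factor tends to 1 as z grows. *)
Lemma gauss_ratio_near z s : 0 < z -> 0 <= s -> s * n%:R <= 1 ->
  gauss_ratio (z + s) <= gauss_ratio z * (1 + z^-1).
Proof.
move=> z0 s0 sn; set t := n%:R * s.
have N1 : 1 <= n%:R :> R by rewrite ler1n.
have t01 : 0 <= t <= 1 by rewrite mulr_ge0//= /t mulrC.
have s01 : 0 <= s <= 1 by rewrite s0 (le_trans _ sn)// ler_peMr.
have nz0 : 0 < n%:R * z by rewrite mulr_gt0.
have nzt0 : 0 < n%:R * z + t by rewrite ltr_wpDr//; case/andP: t01.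
have num : \prod_(k < n) G (z + s + k%:R / n%:R) <=
    (z + 1) `^ t * \prod_(k < n) G (z + k%:R / n%:R).
  have -> : (z + 1) `^ t = \prod_(k < n) (z + 1) `^ s.
    by rewrite prodr_const card_ord /t mulrC powRrM powR_mulrn ?powR_ge0.
  rewrite -big_split/=; apply: ler_prod => k _.
  have zk0 : 0 < z + k%:R / n%:R by rewrite ltr_wpDr.
  have zsk0 : 0 < z + s + k%:R / n%:R by rewrite ltr_wpDr// ltr_wpDr.
  rewrite (ltW (gamma_pos _ zsk0))/=.
  rewrite addrAC; apply: (le_trans (gamma_wendel G HG _ s zk0 s01)).
  rewrite ler_pM2r ?gamma_pos//; apply: ge0_ler_powR; rewrite ?nnegrE ?(ltW zk0)//.
    by rewrite addr_ge0// ltW.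
  by rewrite lerD2l ler_pdivrMr// mul1r ler_nat ltnW.
have den : n%:R * z * G (n%:R * z) <= (n%:R * (z + 1)) `^ (1 - t) * G (n%:R * z + t).
  apply: (le_trans (gamma_wendel_ge G HG _ t nz0 t01)).
  rewrite ler_pM2r ?gamma_pos//; apply: ge0_ler_powR; rewrite ?nnegrE ?subr_ge0 ?(ltW nzt0)//.
  - by case/andP: t01.
  - by rewrite mulr_ge0 ?ltW// addr_gt0.
  - by rewrite mulrDr lerD2l mulr1 (le_trans _ N1)//; case/andP: t01.
rewrite /gauss_ratio mulrDr -/t ler_pdivrMr ?gamma_pos//.
rewrite powRD ?(gt_eqF N0) ?implybT//.
set A := n%:R `^ _; set P := \prod_(k < n) G (z + _); set D := G (_ + t).
set B := n%:R `^ t.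
have A0 : 0 < A by rewrite powR_gt0.
have P0 : 0 < P by exact: gauss_prod_gt0.
have B0 : 0 < B by rewrite powR_gt0.
have g0 := gamma_pos _ nz0.
have z10 : 0 < z + 1 by rewrite addr_gt0.
apply: (@le_trans _ _ (A * B * ((z + 1) `^ t * P))).
  by rewrite ler_pM2l ?mulr_gt0.
have Z0 : 0 < n%:R * (z + 1) by rewrite mulr_gt0.
have eZ : B * (z + 1) `^ t * (n%:R * (z + 1)) `^ (1 - t) = n%:R * (z + 1).
  by rewrite /B -powRM ?ltW// -powRD ?(gt_eqF Z0) ?implybT// subrKC powRr1// ltW.
set c := (n%:R * (z + 1)) `^ (1 - t) in den eZ.
have c0 : 0 < c by rewrite powR_gt0.
set b := (z + 1) `^ t in eZ *.
have k1 : A * B * (b * P) * (n%:R * z * G (n%:R * z)) <= A * B * (b * P) * (c * D).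
  by rewrite ler_wpM2l// !mulr_ge0 ?powR_ge0 ?ltW.
rewrite -(ler_pM2r (mulr_gt0 nz0 g0)); apply: (le_trans k1).
rewrite [leLHS](_ : _ = (B * b * c) * (A * P * D)); last by ring.
rewrite eZ le_eqVlt; apply/orP; left; apply/eqP.
by field; rewrite !gt_eqF.
Qed.

(** By periodicity the point z in [gauss_ratio_near] can be moved arbitrarily
far to the right, where the error factor disappears. *)
Lemma gauss_ratio_nonincreasing x s : 0 < x -> 0 <= s ->
  gauss_ratio (x + s) <= gauss_ratio x.
Proof.
move=> x0 s0.
have small x' s' : 0 < x' -> 0 <= s' -> s' * n%:R <= 1 ->
    gauss_ratio (x' + s') <= gauss_ratio x'.
  move=> {}x0 {}s0 sn; rewrite -subr_le0.
  apply: (le0_small _ (gauss_ratio x')) => m.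
  have M : m.+1%:R = (m.+1 * n)%:R / n%:R :> R by rewrite natrM mulfK// gt_eqF.
  have m0 : 0 < m.+1%:R :> R by [].
  have := gauss_ratio_near (x' + m.+1%:R) s' (addr_gt0 x0 m0) s0 sn.
  rewrite addrAC {1 2}M !gauss_ratioDn ?ltr_wpDr// lerBlDl => /le_trans; apply.
  rewrite mulrDr mulr1 lerD2l ler_pM2l ?gauss_ratio_gt0//.
  by rewrite lef_pV2 ?posrE ?addr_gt0// lerDr ltW.
have sn0 : 0 <= s * n%:R by rewrite mulr_ge0// ltW.
have /andP[ms sm] := truncn_itv sn0; set m := Num.truncn (s * n%:R) in ms sm.
have -> : s = (s - m%:R / n%:R) + m%:R / n%:R by ring.
have s'0 : 0 <= s - m%:R / n%:R by rewrite subr_ge0 ler_pdivrMr.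
rewrite addrA gauss_ratioDn ?ltr_wpDr//; apply: small => //.
by rewrite mulrBl divfK ?gt_eqF// lerBlDl natr1 ltW.
Qed.

(** A nonincreasing periodic function is constant. *)
Lemma gauss_ratio_const x y : 0 < x -> 0 < y -> gauss_ratio x = gauss_ratio y.
Proof.
move=> x0 y0.
have le u v : 0 < u -> 0 < v -> gauss_ratio u <= gauss_ratio v.
  move=> u0 v0; rewrite -(gauss_ratioDn u (Num.truncn (v * n%:R)).+1)//.
  set m := (Num.truncn _).+1.
  have -> : u + m%:R / n%:R = v + (u + (m%:R / n%:R - v)) by ring.
  apply: gauss_ratio_nonincreasing => //.
  by rewrite addr_ge0 ?(ltW u0)// subr_ge0 ler_pdivlMr// ltW// truncnS_gt.
by apply/eqP; rewrite eq_le !le.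
Qed.

(** Reversing the product pairs k/n with 1 - k/n, so the square of the product
is a product of values of the reflection formula, and [prod_sin] evaluates the
sines. *)
Lemma prod_gamma_frac : \prod_(1 <= k < n) G (k%:R / n%:R) =
  (2 * pi) `^ ((n%:R - 1) / 2) * n%:R `^ (- (1 / 2)).
Proof.
have p2 : 0 < 2 * pi :> R by rewrite mulr_gt0 ?pi_gt0.
set Q := \prod_(_ <= _ < _) _.
have Q0 : 0 <= Q.
  rewrite /Q big_nat_cond; apply: prodr_ge0 => k /andP[/andP[k0 _] _].
  by rewrite ltW// gamma_pos// divr_gt0// ltr0n.
apply/eqP; rewrite -(@eqrXn2 _ 2)// ?mulr_ge0 ?powR_ge0//; apply/eqP.
rewrite exprMn -!powR_mulrn ?powR_ge0// -!powRrM.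
rewrite (_ : (n%:R - 1) / 2 * 2%:R = n.-1%:R); last first.
  by rewrite -[in LHS](prednK n0) -natr1; field.
rewrite (_ : - (1 / 2) * 2%:R = -1); last by field.
rewrite powR_inv1 ?(ltW N0)// (powR_mulrn _ (ltW p2)) ?(powR_mulrn _ Q0).
have -> : Q ^+ 2 = \prod_(1 <= k < n) (2 * pi / (2 * sin (pi * (k%:R / n%:R)))).
  rewrite expr2 {2}/Q big_nat_rev -big_split/=.
  rewrite big_nat_cond [RHS]big_nat_cond; apply: eq_bigr => k /andP[/andP[k0 kn] _].
  have e : (1 + n - k.+1)%:R / n%:R = 1 - k%:R / n%:R :> R.
    by rewrite add1n subSS natrB ?(ltnW kn)// mulrBl divff ?gt_eqF.
  rewrite e gamma_reflection//; last first.
    by rewrite divr_gt0 ?ltr0n//= ltr_pdivrMr// mul1r ltr_nat.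
  have s0 : 0 < sin (pi * (k%:R / n%:R)) :> R by apply: sin_pi_nat_gt0; rewrite k0.
  by move: (pi : R) (sin _) s0 => p s s0; field; rewrite gt_eqF.
rewrite big_split/= prodr_const_nat subn1; congr (_ * _).
by rewrite -[in RHS](prod_sin n n0) prodfV.
Qed.

(** The constant of [gauss_ratio_const] is read off at x = 1/n, where the product
is the one of [prod_gamma_frac]. *)
Lemma gamma_multiplication x : 0 < x ->
  \prod_(k < n) G (x + k%:R / n%:R) =
  n%:R `^ (1 / 2 - n%:R * x) * (2 * pi) `^ ((n%:R - 1) / 2) * G (n%:R * x).
Proof.
move=> x0; have nV0 : 0 < n%:R^-1 :> R by rewrite invr_gt0.
have := gauss_ratio_const x n%:R^-1 x0 nV0; rewrite {2}/gauss_ratio.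
have g1 : G 1 = 1 by case: HG.
rewrite divff ?gt_eqF// g1 powRr1 ?(ltW N0)//.
have -> : \prod_(k < n) G (n%:R^-1 + k%:R / n%:R) = \prod_(1 <= k < n) G (k%:R / n%:R).
  rewrite -(big_mkord xpredT (fun k => G (n%:R^-1 + k%:R / n%:R))).
  transitivity (\prod_(0 <= k < n) G (k.+1%:R / n%:R)).
    by apply: eq_bigr => k _; rewrite -natr1 mulrDl mul1r addrC.
  rewrite -(prednK n0) big_nat_recr//= prednK// divff ?gt_eqF// g1 mulr1.
  by rewrite big_add1.
rewrite prod_gamma_frac /gauss_ratio => E.
have g0 : 0 < G (n%:R * x) by rewrite gamma_pos// mulr_gt0.
have e0 : 0 < n%:R `^ (n%:R * x) :> R by rewrite powR_gt0.
have -> : n%:R `^ (1 / 2 - n%:R * x) = n%:R * n%:R `^ (- (1 / 2)) / n%:R `^ (n%:R * x) :> R.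
  rewrite powRB ?(gt_eqF N0) ?implybT//; congr (_ / _).
  have h0 : 0 < 1 / 2 :> R by rewrite divr_gt0.
  by rewrite -(mulr_powRB1 (ltW N0) h0); congr (_ * _ `^ _); field.
apply: (mulfI (lt0r_neq0 e0)); apply: (mulIf (lt0r_neq0 (_ : 0 < (G (n%:R * x))^-1))).
  by rewrite invr_gt0.
by rewrite E; field; rewrite !gt_eqF.
Qed.

End Multiplication.

(** * Sines of multiples of pi/120 *)

Section SineTable.
Context {R : realType}.
Implicit Types x y : R.
Local Notation sqrt := Num.sqrt.

(** All angles are multiples of 3/2 degrees; sines suffice because
cosines are sines of complementary angles (sixty units make a right angle). *)
Definition sn (j : nat) : R := sin (pi * (j%:R / 120)).

Lemma sn_gt0 j : (0 < j < 120)%N -> 0 < sn j.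
Proof. exact: sin_pi_nat_gt0. Qed.

Lemma sn_sym j : (j <= 120)%N -> sn (120 - j) = sn j.
Proof.
move=> j120; rewrite /sn natrB//.
have -> : pi * ((120 - j%:R) / 120) = - (pi * (j%:R / 120)) + pi :> R by move: (pi : R) => p; field.
by rewrite sinDpi sinN opprK.
Qed.

Lemma cos_sn j : (j <= 60)%N -> cos (pi * (j%:R / 120)) = sn (60 - j).
Proof.
move=> j60; rewrite /sn natrB//.
have -> : pi * ((60 - j%:R) / 120) = - (pi * (j%:R / 120)) + pi / 2 :> R by move: (pi : R) => p; field.
by rewrite sinDpihalf cosN.
Qed.

Let arcD x y : pi * ((x + y) / 120) = pi * (x / 120) + pi * (y / 120).
Proof. by rewrite (mulrDl x) mulrDr. Qed.

Let arcB x y : pi * ((x - y) / 120) = pi * (x / 120) - pi * (y / 120).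
Proof. by rewrite (mulrBl _ x) mulrBr. Qed.

Lemma sn60 : sn 60 = 1.
Proof. by rewrite -(cos_sn 0)// mul0r mulr0 cos0. Qed.

Lemma snD i j : (i <= 60)%N -> (j <= 60)%N ->
  sn (i + j) = sn i * sn (60 - j) + sn (60 - i) * sn j.
Proof. by move=> i60 j60; rewrite -!cos_sn// /sn natrD arcD sinD. Qed.

Lemma snB i j : (j <= i <= 60)%N ->
  sn (i - j) = sn i * sn (60 - j) - sn (60 - i) * sn j.
Proof.
move=> /andP[ji i60]; rewrite -!cos_sn ?(leq_trans ji)// /sn natrB// arcB.
by rewrite sinB.
Qed.

Lemma sn_double j : (j <= 60)%N -> sn (j + j) = 2 * (sn j * sn (60 - j)).
Proof. by move=> j60; rewrite snD//; ring. Qed.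

Let sn_mul_cos i j : (j <= i)%N -> sn i * sn j =
  (cos (pi * ((i - j)%:R / 120)) - cos (pi * ((i + j)%:R / 120))) / 2.
Proof.
move=> ji; rewrite natrB// natrD arcB arcD cosB cosD /sn.
by move: (sin _) (sin _) (cos _) (cos _) => a b c d; field.
Qed.

Lemma sn_mul i j : (j <= i)%N -> (i + j <= 60)%N ->
  sn i * sn j = (sn (60 - (i - j)) - sn (60 - (i + j))) / 2.
Proof.
by move=> ji ij; rewrite sn_mul_cos// !cos_sn//; apply: leq_trans ij; lia.
Qed.

Lemma sn_mul_high i j : (j <= i <= 60)%N -> (60 <= i + j)%N ->
  sn i * sn j = (sn (60 - (i - j)) + sn (i + j - 60)) / 2.
Proof.
move=> /andP[ji i60] ij; rewrite sn_mul_cos// cos_sn; last by lia.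
have -> : (i + j)%N = (120 - (120 - (i + j)))%N by lia.
rewrite natrB; last by lia.
have -> : pi * ((120 - (120 - (i + j))%:R) / 120) = - (pi * ((120 - (i + j))%:R / 120)) + pi :> R.
  by move: (pi : R) => p; field.
rewrite cosDpi cosN cos_sn; last by lia.
by rewrite opprK; congr ((_ + sn _) / 2); lia.
Qed.

Lemma sn_sqr j : (j <= 60)%N -> sn j ^+ 2 + sn (60 - j) ^+ 2 = 1.
Proof. by move=> j60; rewrite -cos_sn// addrC cos2Dsin2. Qed.

Lemma eq_sqrt x y : 0 <= y -> y ^+ 2 = x -> sqrt x = y.
Proof. by move=> y0 <-; rewrite sqrtr_sqr ger0_norm. Qed.

Lemma sqr_sqrt_nat n : sqrt n%:R ^+ 2 = n%:R :> R.
Proof. by rewrite sqr_sqrtr. Qed.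

Lemma sqrt5_bounds : 2 < sqrt 5 :> R /\ sqrt 5 < 3 :> R.
Proof.
have h := sqr_sqrt_nat 5; have h0 : 0 <= sqrt 5 :> R by exact: sqrtr_ge0.
by split; nra.
Qed.

Lemma sn20 : sn 20 = 1 / 2.
Proof.
have h := sn_double 20 isT; have p : 0 < sn 40 by exact: sn_gt0.
have : sn 40 * (1 - 2 * sn 20) = 0 by rewrite mulrBr mulr1 {1}h -[(60 - 20)%N]/40%N; ring.
by move/eqP; rewrite mulf_eq0 gt_eqF//= => /eqP; lra.
Qed.

Lemma sn40 : sn 40 = sqrt 3 / 2.
Proof.
have h := sn_sqr 40 isT; rewrite -[(60 - 40)%N]/20%N sn20 in h.
have p : 0 < sn 40 by exact: sn_gt0.
have -> : sqrt 3 = 2 * sn 40 by apply: eq_sqrt; nra.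
by field.
Qed.

Lemma sn30 : sn 30 = sqrt 2 / 2.
Proof.
have h := sn_sqr 30 isT; rewrite -[(60 - 30)%N]/30%N in h.
have p : 0 < sn 30 by exact: sn_gt0.
have -> : sqrt 2 = 2 * sn 30 by apply: eq_sqrt; nra.
by field.
Qed.

(** Duplicating 24 twice shows that the product of the two sines is 1/4, and the
product-to-sum formula that their difference is 1/2. *)
Lemma sn12_36 : sn 36 = (sqrt 5 + 1) / 4 /\ sn 12 = (sqrt 5 - 1) / 4.
Proof.
have h1 := sn_double 24 isT; have h2 := sn_double 48 isT.
have h3 := sn_mul 36 12 isT isT.
rewrite -[(24 + 24)%N]/48%N -[(60 - 24)%N]/36%N in h1.
rewrite -[(48 + 48)%N]/(120 - 24)%N -[(60 - 48)%N]/12%N sn_sym// h1 in h2.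
rewrite -[(60 - (36 - 12))%N]/36%N -[(60 - (36 + 12))%N]/12%N in h3.
have p : 0 < sn 24 by exact: sn_gt0.
have q : 0 < sn 36 by exact: sn_gt0.
have q' : 0 < sn 12 by exact: sn_gt0.
have xy : sn 36 * sn 12 = 1 / 4.
  have : sn 24 * (1 - 4 * (sn 36 * sn 12)) = 0 by rewrite mulrBr mulr1 {1}h2; ring.
  by move/eqP; rewrite mulf_eq0 gt_eqF//= => /eqP; lra.
have d : sn 36 - sn 12 = 1 / 2 by lra.
have s : sqrt 5 = 2 * (sn 36 + sn 12) by apply: eq_sqrt; nra.
by split; lra.
Qed.

Lemma sn36 : sn 36 = (sqrt 5 + 1) / 4. Proof. by case: sn12_36. Qed.
Lemma sn12 : sn 12 = (sqrt 5 - 1) / 4. Proof. by case: sn12_36. Qed.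

Lemma sn24_sqr : sn 24 ^+ 2 = phi_star / 8.
Proof.
have := sn_sqr 24 isT; rewrite -[(60 - 24)%N]/36%N sn36 /phi_star.
have := sqr_sqrt_nat 5; move: (sqrt 5) => s; nra.
Qed.

Lemma sn48_sqr : sn 48 ^+ 2 = phi / 8.
Proof.
have := sn_sqr 48 isT; rewrite -[(60 - 48)%N]/12%N sn12 /phi.
have := sqr_sqrt_nat 5; move: (sqrt 5) => s; nra.
Qed.

Lemma phi_gt0 : 0 < phi :> R.
Proof. by rewrite /phi; have [] := sqrt5_bounds; lra. Qed.

Lemma phi_star_gt0 : 0 < phi_star :> R.
Proof. by rewrite /phi_star; have [] := sqrt5_bounds; lra. Qed.

Lemma sqrt_phi : sqrt phi = 2 * sqrt 2 * sn 48.
Proof.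
have p : 0 < sn 48 by exact: sn_gt0.
apply: eq_sqrt; first by rewrite !mulr_ge0 ?sqrtr_ge0// ltW.
by rewrite !exprMn sn48_sqr sqr_sqrt_nat; field.
Qed.

Lemma sqrt_phi_star : sqrt phi_star = 2 * sqrt 2 * sn 24.
Proof.
have p : 0 < sn 24 by exact: sn_gt0.
apply: eq_sqrt; first by rewrite !mulr_ge0 ?sqrtr_ge0// ltW.
by rewrite !exprMn sn24_sqr sqr_sqrt_nat; field.
Qed.

Lemma psiE : psi * sn 24 = sqrt 5 * sn 36.
Proof.
have p : 0 < sn 24 by exact: sn_gt0.
have q : 0 < sn 36 by exact: sn_gt0.
rewrite (_ : psi = sqrt 5 * sn 36 / sn 24) ?divfK ?gt_eqF//.
apply: eq_sqrt; first by rewrite divr_ge0 ?mulr_ge0 ?sqrtr_ge0// ltW.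
rewrite expr_div_n exprMn sn24_sqr sqr_sqrt_nat sn36 /phi_star.
have [h1 h2] := sqrt5_bounds; have := sqr_sqrt_nat 5.
move: (sqrt 5) h1 h2 => s h1 h2 h; have h3 : 5 - s != 0 by lra.
apply: (mulIf h3); rewrite [LHS](_ : _ = 5 * (s + 1) ^+ 2 / 2); last by field.
by nra.
Qed.

Lemma psi_starE : psi_star * sn 48 = sqrt 5 * sn 12.
Proof.
have p : 0 < sn 48 by exact: sn_gt0.
have q : 0 < sn 12 by exact: sn_gt0.
rewrite (_ : psi_star = sqrt 5 * sn 12 / sn 48) ?divfK ?gt_eqF//.
apply: eq_sqrt; first by rewrite divr_ge0 ?mulr_ge0 ?sqrtr_ge0// ltW.
rewrite expr_div_n exprMn sn48_sqr sqr_sqrt_nat sn12 /phi.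
have [h1 h2] := sqrt5_bounds; have := sqr_sqrt_nat 5.
move: (sqrt 5) h1 h2 => s h1 h2 h; have h3 : 5 + s != 0 by lra.
apply: (mulIf h3); rewrite [LHS](_ : _ = 5 * (s - 1) ^+ 2 / 2); last by field.
by nra.
Qed.

Lemma sqrtM_nat m n : sqrt (m * n)%:R = sqrt m%:R * sqrt n%:R :> R.
Proof. by rewrite natrM sqrtrM. Qed.

Lemma sqrt_lt_nat m n : (m < n)%N -> sqrt m%:R < sqrt n%:R :> R.
Proof. by move=> mn; rewrite ltr_sqrt ?ltr_nat ?ltr0n// (leq_ltn_trans _ mn). Qed.

(** This lemma and the following ones relate each radical of the closed formulas
to a product of sines, so that its logarithm becomes a combination of
logarithms of sines. *)
Lemma sqrt2_sub1 : sn 15 = (sqrt 2 - 1) * sn 45.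
Proof.
have p : 0 < sn 15 by exact: sn_gt0.
have h1 := sn_mul 15 15 isT isT; have h2 := sn_double 15 isT.
rewrite -[(60 - (15 - 15))%N]/60%N -[(60 - (15 + 15))%N]/30%N sn60 sn30 in h1.
rewrite -[(15 + 15)%N]/30%N -[(60 - 15)%N]/45%N sn30 in h2.
have := sqr_sqrt_nat 2; move: (sqrt 2) h1 h2 => s h1 h2 h.
apply: (mulfI (lt0r_neq0 p)); rewrite h1.
have -> : sn 15 * ((s - 1) * sn 45) = (s - 1) * (2 * (sn 15 * sn 45)) / 2 by field.
by rewrite -h2; nra.
Qed.

Lemma sqrt3_sub1 : (sqrt 3 - 1) * sqrt 2 = 4 * sn 10.
Proof.
have := snB 40 30 isT; rewrite -[(40 - 30)%N]/10%N => ->.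
rewrite -[(60 - 30)%N]/30%N -[(60 - 40)%N]/20%N sn20 sn30 sn40.
by field.
Qed.

Lemma sqrt3_sub_sqrt2 : sqrt 3 - sqrt 2 = 4 * (sn 25 * sn 5).
Proof.
rewrite sn_mul// -[(60 - (25 - 5))%N]/40%N -[(60 - (25 + 5))%N]/30%N sn40 sn30.
by field.
Qed.

(** The factor sqrt phi on the left clears the nested root: the product is
sqrt phi sqrt 10 - phi, and sqrt phi is a multiple of sn 48. *)
Lemma sqrt10_sub_sqrt_phi :
  sqrt phi * (sqrt 10 - sqrt phi) = 8 * sqrt 5 * (sn 18 * sn 6).
Proof.
have -> : sqrt 10 = sqrt 2 * sqrt 5 :> R by rewrite -sqrtM_nat.
rewrite sn_mul// -[(60 - (18 - 6))%N]/48%N -[(60 - (18 + 6))%N]/36%N sn36.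
rewrite mulrBr -expr2 sqr_sqrtr ?(ltW phi_gt0)// sqrt_phi /phi.
have := sqr_sqrt_nat 5; have := sqr_sqrt_nat 2.
move: (sqrt 5) (sqrt 2) (sn 48) => s t u h1 h2.
have h3 : t ^+ 2 * (s * u) = 2 * (s * u) by rewrite h1.
by nra.
Qed.

Lemma sqrt10_sub_sqrt_phi_star :
  sqrt phi_star * (sqrt 10 - sqrt phi_star) = 8 * sqrt 5 * (sn 42 * sn 6).
Proof.
have -> : sqrt 10 = sqrt 2 * sqrt 5 :> R by rewrite -sqrtM_nat.
rewrite sn_mul// -[(60 - (42 - 6))%N]/24%N -[(60 - (42 + 6))%N]/12%N sn12.
rewrite mulrBr -expr2 sqr_sqrtr ?(ltW phi_star_gt0)// sqrt_phi_star /phi_star.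
have := sqr_sqrt_nat 5; have := sqr_sqrt_nat 2.
move: (sqrt 5) (sqrt 2) (sn 24) => s t u h1 h2.
have h3 : t ^+ 2 * (s * u) = 2 * (s * u) by rewrite h1.
by nra.
Qed.

Lemma sqrt15_sub_psi : (sqrt 15 - psi) * sn 24 = 2 * sqrt 5 * sn 4.
Proof.
have -> : sqrt 15 = sqrt 3 * sqrt 5 :> R by rewrite -sqrtM_nat.
have := snB 40 36 isT; rewrite -[(40 - 36)%N]/4%N => ->.
rewrite mulrBl psiE -[(60 - 36)%N]/24%N -[(60 - 40)%N]/20%N sn20 sn40.
by move: (sqrt 3) (sqrt 5) (sn 24) (sn 36) => a b c d; field.
Qed.

Lemma sqrt15_sub_psi_star : (sqrt 15 - psi_star) * sn 48 = 2 * sqrt 5 * sn 28.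
Proof.
have -> : sqrt 15 = sqrt 3 * sqrt 5 :> R by rewrite -sqrtM_nat.
have := snB 40 12 isT; rewrite -[(40 - 12)%N]/28%N => ->.
rewrite mulrBl psi_starE -[(60 - 12)%N]/48%N -[(60 - 40)%N]/20%N sn20 sn40.
by move: (sqrt 3) (sqrt 5) (sn 48) (sn 12) => a b c d; field.
Qed.

(** Here and in [sqr_sqrt3_sub1] it is the square that factors, because the
paired products of sines are sums of sines involving only sqrt 3 and sqrt 5. *)
Lemma sqr_sqrt5_sub_sqrt3 :
  (sqrt 5 - sqrt 3) ^+ 2 = 32 * ((sn 22 * sn 2) * (sn 34 * sn 14)).
Proof.
rewrite !sn_mul// -[(60 - (22 - 2))%N]/40%N -[(60 - (22 + 2))%N]/36%N.
rewrite -[(60 - (34 + 14))%N]/12%N sn40 sn36 sn12.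
have := sqr_sqrt_nat 5; have := sqr_sqrt_nat 3.
by move: (sqrt 5) (sqrt 3) => s t h1 h2; nra.
Qed.

Lemma sqr_sqrt3_sub1 :
  (sqrt 3 - 1) ^+ 2 = 32 * ((sn 22 * sn 2) * (sn 46 * sn 26)).
Proof.
rewrite sn_mul// sn_mul_high// -[(60 - (22 - 2))%N]/40%N -[(60 - (22 + 2))%N]/36%N.
rewrite -[(46 + 26 - 60)%N]/12%N sn40 sn36 sn12.
have := sqr_sqrt_nat 5; have := sqr_sqrt_nat 3.
by move: (sqrt 5) (sqrt 3) => s t h1 h2; nra.
Qed.

End SineTable.

(** * Logarithms of these sines *)

Section LogSineTable.
Context {R : realType}.
Implicit Types x y : R.
Local Notation sqrt := Num.sqrt.

(** The closed formulas are multiplicative identities between positive numbers;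
in terms of the following logarithms they are linear identities with rational
coefficients. *)
Definition lns (j : nat) : R := ln (sn j).
Definition ln2 : R := ln 2.
Definition ln3 : R := ln 3.
Definition ln5 : R := ln 5.
Definition lnpi : R := ln pi.
Definition lnphi : R := ln phi.
(** Of each pair of conjugate radicals only the one with the minus sign gets a
name: the product of the pair is 1, 2, 2 phi, phi, 2 phi_star or phi_star, so the
logarithm of the other is a combination of the named ones. *)
Definition lnr2 : R := ln (sqrt 2 - 1).
Definition lnr3 : R := ln (sqrt 3 - 1).
Definition lnr23 : R := ln (sqrt 3 - sqrt 2).
Definition lnr53 : R := ln (sqrt 5 - sqrt 3).
Definition lnA : R := ln (sqrt 15 - psi).
Definition lnB : R := ln (sqrt 15 - psi_star).
Definition lnC : R := ln (sqrt 10 - sqrt phi).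
Definition lnD : R := ln (sqrt 10 - sqrt phi_star).

Lemma ln_mul x y : 0 < x -> 0 < y -> ln (x * y) = ln x + ln y.
Proof. by move=> x0 y0; rewrite lnM. Qed.

Lemma ln_inv x : 0 < x -> ln x^-1 = - ln x.
Proof. by move=> x0; rewrite lnV. Qed.

Lemma ln_sqrt x : 0 < x -> ln (sqrt x) = ln x / 2.
Proof. by move=> x0; rewrite -powR12_sqrt ?ltW// ln_powR mulrC. Qed.

Lemma ln_sqr x : 0 < x -> ln (x ^+ 2) = 2 * ln x.
Proof. by move=> x0; rewrite lnXn// mulr2n; ring. Qed.

Lemma ln_4 : ln 4 = 2 * ln2.
Proof. by rewrite -ln_sqr//; congr ln; ring. Qed.

Lemma ln_8 : ln 8 = 3 * ln2.
Proof. by rewrite (_ : 8 = 4 * 2) ?ln_mul// ?ln_4 -/ln2; ring. Qed.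

Lemma ln_32 : ln 32 = 5 * ln2.
Proof. by rewrite (_ : 32 = 4 * 8) ?ln_mul// ?ln_4 ?ln_8; ring. Qed.

Lemma sqrt_nat_gt0 n : (0 < n)%N -> 0 < sqrt n%:R :> R.
Proof. by move=> n0; rewrite sqrtr_gt0 ltr0n. Qed.

Lemma r2_gt0 : 0 < sqrt 2 - 1 :> R.
Proof. by rewrite subr_gt0 -[ltLHS]sqrtr1; exact: (sqrt_lt_nat 1 2). Qed.

Lemma r3_gt0 : 0 < sqrt 3 - 1 :> R.
Proof. by rewrite subr_gt0 -[ltLHS]sqrtr1; exact: (sqrt_lt_nat 1 3). Qed.

Lemma r23_gt0 : 0 < sqrt 3 - sqrt 2 :> R.
Proof. by rewrite subr_gt0; exact: (sqrt_lt_nat 2 3). Qed.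

Lemma r53_gt0 : 0 < sqrt 5 - sqrt 3 :> R.
Proof. by rewrite subr_gt0; exact: (sqrt_lt_nat 3 5). Qed.

Let pos_factor x y : 0 < x -> 0 < x * y -> 0 < y.
Proof. by move=> x0; rewrite pmulr_rgt0. Qed.

Lemma A_gt0 : 0 < sqrt 15 - psi :> R.
Proof.
apply: (@pos_factor (sn 24)); first exact: sn_gt0.
by rewrite mulrC sqrt15_sub_psi !mulr_gt0// ?sn_gt0// sqrt_nat_gt0.
Qed.

Lemma B_gt0 : 0 < sqrt 15 - psi_star :> R.
Proof.
apply: (@pos_factor (sn 48)); first exact: sn_gt0.
by rewrite mulrC sqrt15_sub_psi_star !mulr_gt0// ?sn_gt0// sqrt_nat_gt0.
Qed.

Lemma C_gt0 : 0 < sqrt 10 - sqrt phi :> R.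
Proof.
apply: (@pos_factor (sqrt phi)); first by rewrite sqrtr_gt0 phi_gt0.
by rewrite sqrt10_sub_sqrt_phi !mulr_gt0// ?sn_gt0// sqrt_nat_gt0.
Qed.

Lemma D_gt0 : 0 < sqrt 10 - sqrt phi_star :> R.
Proof.
apply: (@pos_factor (sqrt phi_star)); first by rewrite sqrtr_gt0 phi_star_gt0.
by rewrite sqrt10_sub_sqrt_phi_star !mulr_gt0// ?sn_gt0// sqrt_nat_gt0.
Qed.

Let ln_conj x y z : 0 < x -> 0 < z -> x * y = z -> ln y = ln z - ln x.
Proof.
move=> x0 z0 E; have y0 : 0 < y by apply: (pos_factor x _ x0); rewrite E.
by rewrite -E ln_mul//; ring.
Qed.

Lemma ln_phi_star : ln phi_star = 2 * ln2 + ln5 - lnphi.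
Proof.
rewrite -ln_4 -ln_mul//; apply: ln_conj => //; first exact: phi_gt0.
by rewrite /phi /phi_star; have := sqr_sqrt_nat (R:=R) 5; nra.
Qed.

Lemma ln_r2' : ln (sqrt 2 + 1) = - lnr2.
Proof.
rewrite -[RHS]add0r -(@ln1 R); apply: ln_conj => //; first exact: r2_gt0.
by have := sqr_sqrt_nat (R:=R) 2; nra.
Qed.

Lemma ln_r3' : ln (sqrt 3 + 1) = ln2 - lnr3.
Proof.
apply: ln_conj => //; first exact: r3_gt0.
by have := sqr_sqrt_nat (R:=R) 3; nra.
Qed.

Lemma ln_r23' : ln (sqrt 3 + sqrt 2) = - lnr23.
Proof.
rewrite -[RHS]add0r -(@ln1 R); apply: ln_conj => //; first exact: r23_gt0.
by have := sqr_sqrt_nat (R:=R) 2; have := sqr_sqrt_nat (R:=R) 3; nra.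
Qed.

Lemma ln_r53' : ln (sqrt 5 + sqrt 3) = ln2 - lnr53.
Proof.
apply: ln_conj => //; first exact: r53_gt0.
by have := sqr_sqrt_nat (R:=R) 5; have := sqr_sqrt_nat (R:=R) 3; nra.
Qed.

Lemma ln_A' : ln (sqrt 15 + psi) = 3 * ln2 + ln5 - lnphi - lnA.
Proof.
have -> : 3 * ln2 + ln5 - lnphi = ln (2 * phi_star).
  by rewrite ln_mul// ?phi_star_gt0// ln_phi_star -/ln2; ring.
apply: ln_conj; [exact: A_gt0|by rewrite mulr_gt0// phi_star_gt0|].
have h : psi ^+ 2 = 5 + 2 * sqrt 5 :> R.
  by rewrite sqr_sqrtr// addr_ge0// mulr_ge0// sqrtr_ge0.
by rewrite /phi_star; have := sqr_sqrt_nat (R:=R) 15; nra.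
Qed.

Lemma ln_B' : ln (sqrt 15 + psi_star) = ln2 + lnphi - lnB.
Proof.
rewrite -ln_mul// ?phi_gt0//.
apply: ln_conj; [exact: B_gt0|by rewrite mulr_gt0// phi_gt0|].
have h : psi_star ^+ 2 = 5 - 2 * sqrt 5 :> R.
  by rewrite sqr_sqrtr//; have := sqrt5_bounds (R:=R); have := sqr_sqrt_nat (R:=R) 5; nra.
by rewrite /phi; have := sqr_sqrt_nat (R:=R) 15; nra.
Qed.

Lemma ln_C' : ln (sqrt 10 + sqrt phi) = 2 * ln2 + ln5 - lnphi - lnC.
Proof.
rewrite -ln_phi_star; apply: ln_conj; [exact: C_gt0|exact: phi_star_gt0|].
have h : sqrt phi ^+ 2 = phi :> R by rewrite sqr_sqrtr// ltW// phi_gt0.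
by have := sqr_sqrt_nat (R:=R) 10; move: h; rewrite /phi_star /phi; nra.
Qed.

Lemma ln_D' : ln (sqrt 10 + sqrt phi_star) = lnphi - lnD.
Proof.
apply: ln_conj; [exact: D_gt0|exact: phi_gt0|].
have h : sqrt phi_star ^+ 2 = phi_star :> R by rewrite sqr_sqrtr// ltW// phi_star_gt0.
by have := sqr_sqrt_nat (R:=R) 10; move: h; rewrite /phi_star /phi; nra.
Qed.

Lemma lns_double j : (0 < j < 60)%N -> lns (j + j) = ln2 + lns j + lns (60 - j).
Proof.
move=> /andP[j0 j60]; rewrite /lns sn_double ?(ltnW j60)//.
have p1 : 0 < sn j :> R by apply: sn_gt0; lia.
have p2 : 0 < sn (60 - j) :> R by apply: sn_gt0; lia.
by rewrite ln_mul ?mulr_gt0// ln_mul// addrA.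
Qed.

(** The identity sin 3x = 4 sin x sin(60 - x) sin(60 + x), in degrees; together
with [lns_double] it generates the relations used to solve for the
table below. *)
Lemma lns_triple j : (0 < j <= 20)%N ->
  lns (j + j + j) = 2 * ln2 + lns j + lns (40 - j) + lns (40 + j).
Proof.
move=> /andP[j0 j20].
have p1 : 0 < sn j :> R by apply: sn_gt0; lia.
have p2 : 0 < sn (40 - j) :> R by apply: sn_gt0; lia.
have p3 : 0 < sn (40 + j) :> R by apply: sn_gt0; lia.
rewrite /lns -ln_4 -!ln_mul ?mulr_gt0//; congr ln.
have j60 : (j <= 60)%N by lia.
have jj60 : (j + j <= 60)%N by lia.
have j40 : (j <= 40 <= 60)%N by lia.
rewrite (snD (j + j) j jj60 j60) (sn_double j j60) (snB 40 j j40) (snD 40 j isT j60).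
have h1 := sn_sqr (R:=R) j j60; have h2 := sn_mul (R:=R) j j (leqnn j) jj60.
rewrite subnn -[(60 - 0)%N]/60%N sn60 in h2.
rewrite -[(60 - 40)%N]/20%N sn20 sn40.
have -> : sn (60 - (j + j)) = 1 - 2 * sn j ^+ 2 :> R by rewrite expr2 h2; field.
have h3 := sqr_sqrt_nat (R:=R) 3.
have h4 : sn (60 - j) ^+ 2 = 1 - sn j ^+ 2 :> R by rewrite -h1; ring.
move: (sn j) (sn (60 - j)) (sqrt 3) h3 h4 => s c t h3 h4.
rewrite [LHS](_ : _ = s * (2 * c ^+ 2 + 1 - 2 * s ^+ 2)); last by ring.
rewrite [RHS](_ : _ = s * (t ^+ 2 * c ^+ 2 - s ^+ 2)); last by field.
by rewrite h3 h4; ring.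
Qed.

Lemma lns60 : lns 60 = 0.
Proof. by rewrite /lns sn60 ln1. Qed.

Lemma lns20 : lns 20 = - ln2.
Proof. by rewrite /lns sn20 div1r ln_inv. Qed.

Lemma lns30 : lns 30 = - ln2 / 2.
Proof. by rewrite /lns sn30 ln_mul ?sqrt_nat_gt0// ln_sqrt// ln_inv// -/ln2; field. Qed.

Lemma lns40 : lns 40 = - ln2 + ln3 / 2.
Proof. by rewrite /lns sn40 ln_mul ?sqrt_nat_gt0// ln_sqrt// ln_inv// -/ln2 -/ln3; ring. Qed.

Lemma lns24 : lns 24 = - ln2 / 2 + ln5 / 2 - lnphi / 2.
Proof.
have p : 0 < sn 24 :> R by exact: sn_gt0.
have := congr1 (@ln R) (sn24_sqr (R:=R)); rewrite ln_sqr// ln_mul ?phi_star_gt0//.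
by rewrite ln_inv// ln_8 ln_phi_star -/(lns 24); lra.
Qed.

Lemma lns48 : lns 48 = - 3 / 2 * ln2 + lnphi / 2.
Proof.
have p : 0 < sn 48 :> R by exact: sn_gt0.
have := congr1 (@ln R) (sn48_sqr (R:=R)); rewrite ln_sqr// ln_mul ?phi_gt0//.
by rewrite ln_inv// ln_8 -/(lns 48) -/lnphi; lra.
Qed.

Let sqrt5_sqr_half : ln (sqrt 5) = ln5 / 2.
Proof. by rewrite ln_sqrt. Qed.

Lemma lns36 : lns 36 = - 2 * ln2 - ln5 / 2 + lnphi.
Proof.
have p : 0 < sn 36 :> R by exact: sn_gt0.
have E : 4 * (sqrt 5 * sn 36) = phi :> R.
  by rewrite sn36 /phi; have := sqr_sqrt_nat (R:=R) 5; nra.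
have := congr1 (@ln R) E; rewrite !ln_mul ?mulr_gt0 ?sqrt_nat_gt0//.
by rewrite sqrt5_sqr_half ln_4 -/(lns 36) -/lnphi; lra.
Qed.

Lemma lns12 : lns 12 = ln5 / 2 - lnphi.
Proof.
have p : 0 < sn 12 :> R by exact: sn_gt0.
have E : 4 * (sqrt 5 * sn 12) = phi_star :> R.
  by rewrite sn12 /phi_star; have := sqr_sqrt_nat (R:=R) 5; nra.
have := congr1 (@ln R) E; rewrite !ln_mul ?mulr_gt0 ?sqrt_nat_gt0//.
by rewrite sqrt5_sqr_half ln_4 -/(lns 12) ln_phi_star; lra.
Qed.

Lemma lns10 : lns 10 = - 3 / 2 * ln2 + lnr3.
Proof.
have p : 0 < sn 10 :> R by exact: sn_gt0.
have := congr1 (@ln R) (sqrt3_sub1 (R:=R)).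
rewrite !ln_mul ?sqrt_nat_gt0 ?r3_gt0// ln_sqrt// ln_4.
by rewrite -/(lns 10) -/lnr3 -/ln2; lra.
Qed.

Lemma lns15_45 : lns 15 = lnr2 + lns 45.
Proof. by rewrite /lns sqrt2_sub1 ln_mul ?r2_gt0// sn_gt0. Qed.

Lemma lns5_25 : lnr23 = 2 * ln2 + lns 25 + lns 5.
Proof. by rewrite /lnr23 sqrt3_sub_sqrt2 !ln_mul ?mulr_gt0 ?sn_gt0// ln_4 addrA. Qed.

Lemma lns6_18 : lnphi / 2 + lnC = 3 * ln2 + ln5 / 2 + lns 18 + lns 6.
Proof.
have := congr1 (@ln R) (sqrt10_sub_sqrt_phi (R:=R)).
rewrite !ln_mul ?mulr_gt0 ?sn_gt0 ?C_gt0 ?sqrtr_gt0 ?phi_gt0//.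
by rewrite ln_sqrt ?phi_gt0// sqrt5_sqr_half ln_8 -/lnphi -/lnC -/(lns 18) -/(lns 6); lra.
Qed.

Lemma lns6_42 : ln2 + ln5 / 2 - lnphi / 2 + lnD = 3 * ln2 + ln5 / 2 + lns 42 + lns 6.
Proof.
have := congr1 (@ln R) (sqrt10_sub_sqrt_phi_star (R:=R)).
rewrite !ln_mul ?mulr_gt0 ?sn_gt0 ?D_gt0 ?sqrtr_gt0 ?phi_star_gt0//.
rewrite ln_sqrt ?phi_star_gt0// ln_phi_star sqrt5_sqr_half ln_8.
by rewrite -/lnD -/(lns 42) -/(lns 6); lra.
Qed.

Lemma lns4_24 : lnA + lns 24 = ln2 + ln5 / 2 + lns 4.
Proof.
have := congr1 (@ln R) (sqrt15_sub_psi (R:=R)).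
rewrite !ln_mul ?mulr_gt0 ?sn_gt0 ?A_gt0 ?sqrtr_gt0//.
by rewrite sqrt5_sqr_half -/lnA -/(lns 24) -/(lns 4) -/ln2.
Qed.

Lemma lns28_48 : lnB + lns 48 = ln2 + ln5 / 2 + lns 28.
Proof.
have := congr1 (@ln R) (sqrt15_sub_psi_star (R:=R)).
rewrite !ln_mul ?mulr_gt0 ?sn_gt0 ?B_gt0 ?sqrtr_gt0//.
by rewrite sqrt5_sqr_half -/lnB -/(lns 48) -/(lns 28) -/ln2.
Qed.

Lemma lns2_14_22_34 : 2 * lnr53 = 5 * ln2 + lns 2 + lns 14 + lns 22 + lns 34.
Proof.
have := congr1 (@ln R) (sqr_sqrt5_sub_sqrt3 (R:=R)).
rewrite ln_sqr ?r53_gt0// !ln_mul ?mulr_gt0 ?sn_gt0// ln_32 -/lnr53.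
by rewrite -/(lns 2) -/(lns 14) -/(lns 22) -/(lns 34); lra.
Qed.

Lemma lns2_22_26_46 : 2 * lnr3 = 5 * ln2 + lns 2 + lns 22 + lns 26 + lns 46.
Proof.
have := congr1 (@ln R) (sqr_sqrt3_sub1 (R:=R)).
rewrite ln_sqr ?r3_gt0// !ln_mul ?mulr_gt0 ?sn_gt0// ln_32 -/lnr3.
by rewrite -/(lns 2) -/(lns 22) -/(lns 26) -/(lns 46); lra.
Qed.

(** From here on each value is obtained by solving a small linear system of
duplication and triplication relations and factorizations of radicals. *)
Lemma lns4 : lns 4 = - 3 / 2 * ln2 - lnphi / 2 + lnA.
Proof.
by have := lns24; have := lns4_24; lra.
Qed.

Lemma lns28 : lns 28 = - 5 / 2 * ln2 - ln5 / 2 + lnphi / 2 + lnB.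
Proof.
by have := lns48; have := lns28_48; lra.
Qed.

Lemma lns50 : lns 50 = - ln2 / 2 - lnr3.
Proof.
have := lns_double 10 isT : lns 20 = ln2 + lns 10 + lns 50.
by have := lns10; have := lns20; lra.
Qed.

Lemma lns44 : lns 44 = 3 / 2 * ln2 + ln5 - 3 / 2 * lnphi - lnA.
Proof.
have := lns_triple 4 isT : lns 12 = 2 * ln2 + lns 4 + lns 36 + lns 44.
by have := lns4; have := lns12; have := lns36; lra.
Qed.

Lemma lns52 : lns 52 = - 3 / 2 * ln2 - ln5 / 2 + 3 / 2 * lnphi - lnB.
Proof.
have := lns_triple 12 isT : lns 36 = 2 * ln2 + lns 12 + lns 28 + lns 52.
by have := lns12; have := lns28; have := lns36; lra.
Qed.

Lemma lns15 : lns 15 = - 3 / 4 * ln2 + lnr2 / 2.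
Proof.
have := lns_double 15 isT : lns 30 = ln2 + lns 15 + lns 45.
by have := lns30; have := lns15_45; lra.
Qed.

Lemma lns45 : lns 45 = - 3 / 4 * ln2 - lnr2 / 2.
Proof.
by have := lns15; have := lns15_45; lra.
Qed.

Lemma lns6 : lns 6 = - ln2 - lnphi / 2 + lnC / 2 + lnD / 2.
Proof.
have := lns_double 18 isT : lns 36 = ln2 + lns 18 + lns 42.
by have := lns36; have := lns6_18; have := lns6_42; lra.
Qed.

Lemma lns18 : lns 18 = - 2 * ln2 - ln5 / 2 + lnphi + lnC / 2 - lnD / 2.
Proof.
by have := lns6; have := lns6_18; lra.
Qed.

Lemma lns42 : lns 42 = - ln2 - lnC / 2 + lnD / 2.
Proof.
by have := lns6; have := lns6_42; lra.
Qed.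

Lemma lns54 : lns 54 = ln5 / 2 - lnphi / 2 - lnC / 2 - lnD / 2.
Proof.
have := lns_double 6 isT : lns 12 = ln2 + lns 6 + lns 54.
by have := lns6; have := lns12; lra.
Qed.

Lemma lns8 : lns 8 = - 3 / 2 * ln2 - lnphi / 2 + lnA / 2 + lnB / 2.
Proof.
have := lns_triple 8 isT : lns 24 = 2 * ln2 + lns 8 + lns 32 + lns 48.
have := lns_double 16 isT : lns 32 = ln2 + lns 16 + lns 44.
have := lns_double 8 isT : lns 16 = ln2 + lns 8 + lns 52.
by have := lns24; have := lns44; have := lns48; have := lns52; lra.
Qed.

Lemma lns16 : lns 16 = - 2 * ln2 - ln5 / 2 + lnphi + lnA / 2 - lnB / 2.
Proof.
have := lns_double 8 isT : lns 16 = ln2 + lns 8 + lns 52.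
by have := lns8; have := lns52; lra.
Qed.

Lemma lns5 : lns 5 = - 5 / 4 * ln2 + lnr2 / 2 + lnr3 / 2 + lnr23 / 2.
Proof.
have := lns_triple 5 isT : lns 15 = 2 * ln2 + lns 5 + lns 35 + lns 45.
have := lns_double 25 isT : lns 50 = ln2 + lns 25 + lns 35.
by have := lns15; have := lns45; have := lns50; have := lns5_25; lra.
Qed.

Lemma lns2 : lns 2 = - 9 / 4 * ln2 - ln5 / 4 + lnr3 / 2 + lnr53 / 2 + lnA / 2 + lnC / 2.
Proof.
have := lns_triple 2 isT : lns 6 = 2 * ln2 + lns 2 + lns 38 + lns 42.
have := lns_double 26 isT : lns 52 = ln2 + lns 26 + lns 34.
have := lns_double 14 isT : lns 28 = ln2 + lns 14 + lns 46.
have := lns_double 22 isT : lns 44 = ln2 + lns 22 + lns 38.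
by have := lns6; have := lns28; have := lns42; have := lns44; have := lns52; have := lns2_14_22_34; have := lns2_22_26_46; lra.
Qed.

Lemma lns14 : lns 14 = - 7 / 4 * ln2 - ln5 / 4 - lnr3 / 2 + lnr53 / 2 + lnB / 2 + lnD / 2.
Proof.
have := lns_triple 6 isT : lns 18 = 2 * ln2 + lns 6 + lns 34 + lns 46.
have := lns_double 14 isT : lns 28 = ln2 + lns 14 + lns 46.
have := lns_double 26 isT : lns 52 = ln2 + lns 26 + lns 34.
by have := lns2; have := lns6; have := lns18; have := lns28; have := lns52; have := lns2_14_22_34; have := lns2_22_26_46; lra.
Qed.

End LogSineTable.

(** * The closed formulas *)

Section GammaFormulas.
Context {R : realType} (G : R -> R) (HG : gamma_like R G).
Implicit Types x y : R.
Local Notation sqrt := Num.sqrt.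

Definition lnG (j : nat) : R := ln (G (j%:R / 120)).

Let G_gt0 j : (0 < j)%N -> 0 < G (j%:R / 120).
Proof. by move=> j0; rewrite (gamma_pos G HG)// divr_gt0 ?ltr0n. Qed.

Lemma lnG_reflection j : (0 < j < 120)%N -> lnG j + lnG (120 - j) = lnpi - lns j.
Proof.
move=> j120; have /andP[j0 j1] := j120.
have s0 : 0 < sn j :> R by exact: sn_gt0.
rewrite /lnG /lns -ln_mul ?G_gt0 ?subn_gt0// natrB ?(ltnW j1)// mulrBl divff//.
rewrite (gamma_reflection G HG); last first.
  by rewrite divr_gt0 ?ltr0n//= ltr_pdivrMr// mul1r ltr_nat.
by rewrite ln_mul ?pi_gt0 ?invr_gt0// ln_inv.
Qed.

(** Writing 120 = n m keeps all the points that occur multiples of 1/120. *)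
Lemma lnG_multiplication n m j : (n * m = 120)%N -> (0 < j)%N ->
  \sum_(k < n) lnG (j + k * m) =
  (1 / 2 - j%:R / m%:R) * ln n%:R + (n%:R - 1) / 2 * (ln2 + lnpi) + lnG (n * j).
Proof.
move=> nm j0; have n0 : (0 < n)%N by lia.
have m0 : m%:R != 0 :> R by rewrite pnatr_eq0; lia.
have n1 : n%:R != 0 :> R by rewrite pnatr_eq0; lia.
have e120 : 120 = n%:R * m%:R :> R by rewrite -natrM nm.
have x0 : 0 < j%:R / 120 :> R by rewrite divr_gt0 ?ltr0n.
have := congr1 (@ln R) (gamma_multiplication G HG n n0 _ x0).
have nx : n%:R * (j%:R / 120) = (n * j)%:R / 120 :> R by rewrite natrM mulrA.
have -> : \prod_(k < n) G (j%:R / 120 + k%:R / n%:R) = expR (\sum_(k < n) lnG (j + k * m)).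
  rewrite expR_sum; apply: eq_bigr => k _.
  rewrite /lnG lnK ?posrE ?G_gt0 ?addn_gt0 ?j0//; congr G.
  by rewrite natrD natrM mulrDl e120; congr (_ + _); field; rewrite m0 n1.
rewrite expRK => ->; rewrite nx.
have n0' : 0 < n%:R :> R by rewrite ltr0n.
have p2 : 0 < 2 * pi :> R by rewrite mulr_gt0 ?pi_gt0.
rewrite !ln_mul ?mulr_gt0 ?powR_gt0 ?G_gt0 ?muln_gt0 ?n0//.
rewrite !ln_powR ln_mul ?pi_gt0// -/ln2 -/lnpi -/(lnG _) -nx.
by congr (_ * _ + _ + _); rewrite e120; field; rewrite m0 n1.
Qed.

Lemma lnG_duplication j : (0 < j)%N -> lnG j + lnG (j + 60) =
  (1 / 2 - j%:R / 60) * ln2 + (ln2 + lnpi) / 2 + lnG (2 * j).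
Proof.
move=> j0; have := lnG_multiplication 2 60 j erefl j0.
rewrite !big_ord_recl big_ord0 /= addn0 addr0 => ->.
by rewrite -/ln2; congr (_ + _ + _); field.
Qed.

Lemma lnG_triplication j : (0 < j)%N -> lnG j + lnG (j + 40) + lnG (j + 80) =
  (1 / 2 - j%:R / 40) * ln3 + (ln2 + lnpi) + lnG (3 * j).
Proof.
move=> j0; have := lnG_multiplication 3 40 j erefl j0.
rewrite !big_ord_recl big_ord0 /= addn0 addr0 addrA => ->.
by rewrite -/ln3; congr (_ + _ + _); field.
Qed.

Lemma lnG_quintuplication j : (0 < j)%N ->
  lnG j + lnG (j + 24) + lnG (j + 48) + lnG (j + 72) + lnG (j + 96) =
  (1 / 2 - j%:R / 24) * ln5 + 2 * (ln2 + lnpi) + lnG (5 * j).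
Proof.
move=> j0; have := lnG_multiplication 5 24 j erefl j0.
rewrite !big_ord_recl big_ord0 /= addn0 addr0 !addrA => ->.
by rewrite -/ln5; congr (_ + _ + _); field.
Qed.

(** The values follow in the order of an elimination.  Each statement is a
combination of the relations recalled in its proof, solved for one unknown in
terms of the values at 40, 30, 24, 48, 15, 8, 6, 5, 2 and 14, which
are the ten basis points of the closed formulas multiplied by 120. *)
Lemma lnG118 : lnG 118 = lnpi + 9 / 4 * ln2 + ln5 / 4 - lnr3 / 2 - lnr53 / 2 -
  lnA / 2 - lnC / 2 - lnG 2.
Proof.
have := lnG_reflection 2 isT : lnG 2 + lnG 118 = lnpi - lns 2.
by have := @lns2 R; lra.
Qed.

Lemma lnG115 : lnG 115 = lnpi + 5 / 4 * ln2 - lnr2 / 2 - lnr3 / 2 - lnr23 / 2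
  - lnG 5.
Proof.
have := lnG_reflection 5 isT : lnG 5 + lnG 115 = lnpi - lns 5.
by have := @lns5 R; lra.
Qed.

Lemma lnG114 : lnG 114 = lnpi + ln2 + lnphi / 2 - lnC / 2 - lnD / 2 - lnG 6.
Proof.
have := lnG_reflection 6 isT : lnG 6 + lnG 114 = lnpi - lns 6.
by have := @lns6 R; lra.
Qed.

Lemma lnG112 : lnG 112 = lnpi + 3 / 2 * ln2 + lnphi / 2 - lnA / 2 - lnB / 2 -
  lnG 8.
Proof.
have := lnG_reflection 8 isT : lnG 8 + lnG 112 = lnpi - lns 8.
by have := @lns8 R; lra.
Qed.

Lemma lnG106 : lnG 106 = lnpi + 7 / 4 * ln2 + ln5 / 4 + lnr3 / 2 - lnr53 / 2 -
  lnB / 2 - lnD / 2 - lnG 14.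
Proof.
have := lnG_reflection 14 isT : lnG 14 + lnG 106 = lnpi - lns 14.
by have := @lns14 R; lra.
Qed.

Lemma lnG105 : lnG 105 = lnpi + 3 / 4 * ln2 - lnr2 / 2 - lnG 15.
Proof.
have := lnG_reflection 15 isT : lnG 15 + lnG 105 = lnpi - lns 15.
by have := @lns15 R; lra.
Qed.

Lemma lnG96 : lnG 96 = lnpi + ln2 / 2 - ln5 / 2 + lnphi / 2 - lnG 24.
Proof.
have := lnG_reflection 24 isT : lnG 24 + lnG 96 = lnpi - lns 24.
by have := @lns24 R; lra.
Qed.

Lemma lnG90 : lnG 90 = lnpi + ln2 / 2 - lnG 30.
Proof.
have := lnG_reflection 30 isT : lnG 30 + lnG 90 = lnpi - lns 30.
by have := @lns30 R; lra.
Qed.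

Lemma lnG80 : lnG 80 = lnpi + ln2 - ln3 / 2 - lnG 40.
Proof.
have := lnG_reflection 40 isT : lnG 40 + lnG 80 = lnpi - lns 40.
by have := @lns40 R; lra.
Qed.

Lemma lnG72 : lnG 72 = lnpi + 3 / 2 * ln2 - lnphi / 2 - lnG 48.
Proof.
have := lnG_reflection 48 isT : lnG 48 + lnG 72 = lnpi - lns 48.
by have := @lns48 R; lra.
Qed.

Lemma lnG60 : lnG 60 = lnpi / 2.
Proof.
have := lnG_reflection 60 isT : lnG 60 + lnG 60 = lnpi - lns 60.
by have := @lns60 R; lra.
Qed.

Lemma lnG12 : lnG 12 = - lnpi / 2 - 7 / 10 * ln2 + lnphi / 2 + lnG 24 + lnG
  48.
Proof.
have := lnG_duplication 12 isT : lnG 12 + lnG 72 =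
  (1 / 2 - 12 / 60) * ln2 + (ln2 + lnpi) / 2 + lnG 24.
by have := lnG72; lra.
Qed.

Lemma lnG75 : lnG 75 = lnpi / 2 + 3 / 4 * ln2 - lnG 15 + lnG 30.
Proof.
have := lnG_duplication 15 isT : lnG 15 + lnG 75 =
  (1 / 2 - 15 / 60) * ln2 + (ln2 + lnpi) / 2 + lnG 30.
by lra.
Qed.

Lemma lnG20 : lnG 20 = - lnpi / 2 - ln2 / 3 + ln3 / 2 + 2 * lnG 40.
Proof.
have := lnG_duplication 20 isT : lnG 20 + lnG 80 =
  (1 / 2 - 20 / 60) * ln2 + (ln2 + lnpi) / 2 + lnG 40.
by have := lnG80; lra.
Qed.

Lemma lnG84 : lnG 84 = lnpi / 2 + 3 / 5 * ln2 - lnG 24 + lnG 48.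
Proof.
have := lnG_duplication 24 isT : lnG 24 + lnG 84 =
  (1 / 2 - 24 / 60) * ln2 + (ln2 + lnpi) / 2 + lnG 48.
by lra.
Qed.

Lemma lnG36 : lnG 36 = lnpi / 2 + 7 / 5 * ln2 + ln5 / 2 - lnphi + lnG 24 - lnG
  48.
Proof.
have := lnG_duplication 36 isT : lnG 36 + lnG 96 =
  (1 / 2 - 36 / 60) * ln2 + (ln2 + lnpi) / 2 + lnG 72.
by have := lnG72; have := lnG96; lra.
Qed.

Lemma lnG100 : lnG 100 = 3 / 2 * lnpi + 4 / 3 * ln2 - ln3 / 2 - 2 * lnG 40.
Proof.
have := lnG_duplication 40 isT : lnG 40 + lnG 100 =
  (1 / 2 - 40 / 60) * ln2 + (ln2 + lnpi) / 2 + lnG 80.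
by have := lnG80; lra.
Qed.

Lemma lnG45 : lnG 45 = lnpi / 2 + lnr2 / 2 + lnG 15 - lnG 30.
Proof.
have := lnG_duplication 45 isT : lnG 45 + lnG 105 =
  (1 / 2 - 45 / 60) * ln2 + (ln2 + lnpi) / 2 + lnG 90.
by have := lnG90; have := lnG105; lra.
Qed.

Lemma lnG108 : lnG 108 = 3 / 2 * lnpi + 7 / 10 * ln2 - ln5 / 2 + lnphi / 2 -
  lnG 24 - lnG 48.
Proof.
have := lnG_duplication 48 isT : lnG 48 + lnG 108 =
  (1 / 2 - 48 / 60) * ln2 + (ln2 + lnpi) / 2 + lnG 96.
by have := lnG96; lra.
Qed.

Lemma lnG54 : lnG 54 = lnpi - ln2 / 5 - ln5 / 2 + lnC / 2 + lnD / 2 + lnG 6 -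
  lnG 24 - lnG 48.
Proof.
have := lnG_duplication 54 isT : lnG 54 + lnG 114 =
  (1 / 2 - 54 / 60) * ln2 + (ln2 + lnpi) / 2 + lnG 108.
by have := lnG108; have := lnG114; lra.
Qed.

Lemma lnG85 : lnG 85 = lnpi / 2 + ln2 + 3 / 8 * ln3 - lnr2 / 2 - lnG 5 + lnG
  30.
Proof.
have := lnG_triplication 5 isT : lnG 5 + lnG 45 + lnG 85 =
  (1 / 2 - 5 / 40) * ln3 + (ln2 + lnpi) + lnG 15.
by have := lnG45; lra.
Qed.

Lemma lnG88 : lnG 88 = lnpi + ln2 + 3 / 10 * ln3 - lnG 8 + lnG 24 - lnG 48.
Proof.
have := lnG_triplication 8 isT : lnG 8 + lnG 48 + lnG 88 =
  (1 / 2 - 8 / 40) * ln3 + (ln2 + lnpi) + lnG 24.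
by lra.
Qed.

Lemma lnG32 : lnG 32 = - 3 / 2 * ln2 - 3 / 10 * ln3 - ln5 / 2 + lnphi / 2 +
  lnA / 2 + lnB / 2 + lnG 8 - lnG 24 + lnG 48.
Proof.
have := lnG_triplication 32 isT : lnG 32 + lnG 72 + lnG 112 =
  (1 / 2 - 32 / 40) * ln3 + (ln2 + lnpi) + lnG 96.
by have := lnG72; have := lnG96; have := lnG112; lra.
Qed.

Lemma lnG35 : lnG 35 = lnpi / 2 - ln2 / 4 - 3 / 8 * ln3 + lnr3 / 2 + lnr23 / 2
  + lnG 5 - lnG 30.
Proof.
have := lnG_triplication 35 isT : lnG 35 + lnG 75 + lnG 115 =
  (1 / 2 - 35 / 40) * ln3 + (ln2 + lnpi) + lnG 105.
by have := lnG75; have := lnG105; have := lnG115; lra.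
Qed.

Lemma lnG66 : lnG 66 = ln2 / 5 + lnphi / 2 - lnG 6 + lnG 24 + lnG 48.
Proof.
have := lnG_reflection 54 isT : lnG 54 + lnG 66 = lnpi - lns 54.
by have := @lns54 R; have := lnG54; lra.
Qed.

Lemma lnG10 : lnG 10 = - lnpi / 2 + ln2 / 4 + 3 / 8 * ln3 - lnr3 / 2 + lnG 30
  + lnG 40.
Proof.
have := lnG_reflection 10 isT : lnG 10 + lnG 110 = lnpi - lns 10.
have := lnG_duplication 50 isT : lnG 50 + lnG 110 =
  (1 / 2 - 50 / 60) * ln2 + (ln2 + lnpi) / 2 + lnG 100.
have := lnG_triplication 10 isT : lnG 10 + lnG 50 + lnG 90 =
  (1 / 2 - 10 / 40) * ln3 + (ln2 + lnpi) + lnG 30.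
by have := @lns10 R; have := lnG90; have := lnG100; lra.
Qed.

Lemma lnG110 : lnG 110 = 3 / 2 * lnpi + 5 / 4 * ln2 - 3 / 8 * ln3 - lnr3 / 2 -
  lnG 30 - lnG 40.
Proof.
have := lnG_reflection 10 isT : lnG 10 + lnG 110 = lnpi - lns 10.
by have := @lns10 R; have := lnG10; lra.
Qed.

Lemma lnG65 : lnG 65 = 7 / 6 * ln2 + 3 / 8 * ln3 - lnr3 / 2 - lnG 5 + lnG 30 +
  lnG 40.
Proof.
have := lnG_duplication 5 isT : lnG 5 + lnG 65 =
  (1 / 2 - 5 / 60) * ln2 + (ln2 + lnpi) / 2 + lnG 10.
by have := lnG10; lra.
Qed.

Lemma lnG70 : lnG 70 = lnpi / 2 + ln2 / 4 + ln3 / 8 + lnr3 / 2 - lnG 30 + lnG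
  40.
Proof.
have := lnG_duplication 10 isT : lnG 10 + lnG 70 =
  (1 / 2 - 10 / 60) * ln2 + (ln2 + lnpi) / 2 + lnG 20.
by have := lnG10; have := lnG20; lra.
Qed.

Lemma lnG95 : lnG 95 = lnpi / 2 + 11 / 12 * ln2 + ln3 / 2 - lnr23 / 2 - lnG 5
  + lnG 40.
Proof.
have := lnG_duplication 35 isT : lnG 35 + lnG 95 =
  (1 / 2 - 35 / 60) * ln2 + (ln2 + lnpi) / 2 + lnG 70.
by have := lnG35; have := lnG70; lra.
Qed.

Lemma lnG50 : lnG 50 = lnpi / 2 + ln2 / 4 - ln3 / 8 + lnr3 / 2 + lnG 30 - lnG
  40.
Proof.
have := lnG_duplication 50 isT : lnG 50 + lnG 110 =
  (1 / 2 - 50 / 60) * ln2 + (ln2 + lnpi) / 2 + lnG 100.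
by have := lnG100; have := lnG110; lra.
Qed.

Lemma lnG55 : lnG 55 = lnpi + ln2 / 12 - 3 / 8 * ln3 + lnr2 / 2 + lnr23 / 2 +
  lnG 5 - lnG 30 - lnG 40.
Proof.
have := lnG_duplication 55 isT : lnG 55 + lnG 115 =
  (1 / 2 - 55 / 60) * ln2 + (ln2 + lnpi) / 2 + lnG 110.
by have := lnG110; have := lnG115; lra.
Qed.

Lemma lnG25 : lnG 25 = lnpi / 2 - ln2 / 6 - ln3 / 2 + lnr2 / 2 + lnr3 / 2 +
  lnG 5 - lnG 40.
Proof.
have := lnG_triplication 25 isT : lnG 25 + lnG 65 + lnG 105 =
  (1 / 2 - 25 / 40) * ln3 + (ln2 + lnpi) + lnG 75.
by have := lnG65; have := lnG75; have := lnG105; lra.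
Qed.

Lemma lnG16 : lnG 16 = - 7 / 20 * ln3 + ln5 / 6 - lnphi / 2 + lnB / 2 + lnG 8
  - lnG 40 + lnG 48.
Proof.
have := lnG_reflection 16 isT : lnG 16 + lnG 104 = lnpi - lns 16.
have := lnG_triplication 24 isT : lnG 24 + lnG 64 + lnG 104 =
  (1 / 2 - 24 / 40) * ln3 + (ln2 + lnpi) + lnG 72.
have := lnG_quintuplication 16 isT : lnG 16 + lnG 40 + lnG 64 + lnG 88 + lnG 112 =
  (1 / 2 - 16 / 24) * ln5 + 2 * (ln2 + lnpi) + lnG 80.
by have := @lns16 R; have := lnG72; have := lnG80; have := lnG88; have :=
  lnG112; lra.
Qed.

Lemma lnG104 : lnG 104 = lnpi + 2 * ln2 + 7 / 20 * ln3 + ln5 / 3 - lnphi / 2 -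
  lnA / 2 - lnG 8 + lnG 40 - lnG 48.
Proof.
have := lnG_reflection 16 isT : lnG 16 + lnG 104 = lnpi - lns 16.
by have := @lns16 R; have := lnG16; lra.
Qed.

Lemma lnG68 : lnG 68 = lnpi / 2 + 13 / 15 * ln2 - 7 / 20 * ln3 + ln5 / 6 -
  lnphi / 2 + lnB / 2 - lnG 40 + lnG 48.
Proof.
have := lnG_duplication 8 isT : lnG 8 + lnG 68 =
  (1 / 2 - 8 / 60) * ln2 + (ln2 + lnpi) / 2 + lnG 16.
by have := lnG16; lra.
Qed.

Lemma lnG76 : lnG 76 = lnpi / 2 - 23 / 30 * ln2 + ln3 / 20 - 2 / 3 * ln5 +
  lnphi + lnA / 2 - lnG 24 + lnG 40.
Proof.
have := lnG_duplication 16 isT : lnG 16 + lnG 76 =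
  (1 / 2 - 16 / 60) * ln2 + (ln2 + lnpi) / 2 + lnG 32.
by have := lnG16; have := lnG32; lra.
Qed.

Lemma lnG44 : lnG 44 = lnpi / 2 - 11 / 15 * ln2 - ln3 / 20 - ln5 / 3 + lnphi /
  2 + lnA / 2 + lnG 24 - lnG 40.
Proof.
have := lnG_duplication 44 isT : lnG 44 + lnG 104 =
  (1 / 2 - 44 / 60) * ln2 + (ln2 + lnpi) / 2 + lnG 88.
by have := lnG88; have := lnG104; lra.
Qed.

Lemma lnG52 : lnG 52 = lnpi / 2 + 19 / 30 * ln2 + 7 / 20 * ln3 + ln5 / 3 -
  lnphi + lnB / 2 + lnG 40 - lnG 48.
Proof.
have := lnG_duplication 52 isT : lnG 52 + lnG 112 =
  (1 / 2 - 52 / 60) * ln2 + (ln2 + lnpi) / 2 + lnG 104.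
by have := lnG104; have := lnG112; lra.
Qed.

Lemma lnG4 : lnG 4 = - lnpi / 2 + 13 / 30 * ln2 + 9 / 20 * ln3 + ln5 / 3 - lnA
  / 2 + lnG 24 + lnG 40.
Proof.
have := lnG_triplication 4 isT : lnG 4 + lnG 44 + lnG 84 =
  (1 / 2 - 4 / 40) * ln3 + (ln2 + lnpi) + lnG 12.
by have := lnG12; have := lnG44; have := lnG84; lra.
Qed.

Lemma lnG92 : lnG 92 = 3 / 2 * lnpi + 37 / 15 * ln2 - 3 / 20 * ln3 + ln5 / 6 -
  lnphi / 2 - lnB / 2 - lnG 40 - lnG 48.
Proof.
have := lnG_triplication 12 isT : lnG 12 + lnG 52 + lnG 92 =
  (1 / 2 - 12 / 40) * ln3 + (ln2 + lnpi) + lnG 36.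
by have := lnG12; have := lnG36; have := lnG52; lra.
Qed.

Lemma lnG56 : lnG 56 = ln2 / 2 + 9 / 20 * ln3 + ln5 / 3 - lnB / 2 - lnG 8 +
  lnG 24 + lnG 40.
Proof.
have := lnG_triplication 16 isT : lnG 16 + lnG 56 + lnG 96 =
  (1 / 2 - 16 / 40) * ln3 + (ln2 + lnpi) + lnG 48.
by have := lnG16; have := lnG96; lra.
Qed.

Lemma lnG64 : lnG 64 = lnpi + ln2 / 2 - 9 / 20 * ln3 - ln5 / 3 + lnA / 2 + lnG
  8 - lnG 24 - lnG 40.
Proof.
have := lnG_triplication 24 isT : lnG 24 + lnG 64 + lnG 104 =
  (1 / 2 - 24 / 40) * ln3 + (ln2 + lnpi) + lnG 72.
by have := lnG72; have := lnG104; lra.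
Qed.

Lemma lnG28 : lnG 28 = - lnpi / 2 + ln2 / 30 + 3 / 20 * ln3 + ln5 / 3 - lnB /
  2 + lnG 40 + lnG 48.
Proof.
have := lnG_triplication 28 isT : lnG 28 + lnG 68 + lnG 108 =
  (1 / 2 - 28 / 40) * ln3 + (ln2 + lnpi) + lnG 84.
by have := lnG68; have := lnG84; have := lnG108; lra.
Qed.

Lemma lnG116 : lnG 116 = 3 / 2 * lnpi + 16 / 15 * ln2 - 9 / 20 * ln3 - ln5 / 3
  + lnphi / 2 - lnA / 2 - lnG 24 - lnG 40.
Proof.
have := lnG_triplication 36 isT : lnG 36 + lnG 76 + lnG 116 =
  (1 / 2 - 36 / 40) * ln3 + (ln2 + lnpi) + lnG 108.
by have := lnG36; have := lnG76; have := lnG108; lra.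
Qed.

Lemma lnG62 : lnG 62 = 7 / 5 * ln2 + 9 / 20 * ln3 + ln5 / 3 - lnA / 2 - lnG 2
  + lnG 24 + lnG 40.
Proof.
have := lnG_duplication 2 isT : lnG 2 + lnG 62 =
  (1 / 2 - 2 / 60) * ln2 + (ln2 + lnpi) / 2 + lnG 4.
by have := lnG4; lra.
Qed.

Lemma lnG74 : lnG 74 = 4 / 5 * ln2 + 3 / 20 * ln3 + ln5 / 3 - lnB / 2 - lnG 14
  + lnG 40 + lnG 48.
Proof.
have := lnG_duplication 14 isT : lnG 14 + lnG 74 =
  (1 / 2 - 14 / 60) * ln2 + (ln2 + lnpi) / 2 + lnG 28.
by have := lnG28; lra.
Qed.

Lemma lnG46 : lnG 46 = lnpi + 19 / 20 * ln2 - 3 / 20 * ln3 - ln5 / 12 - lnphi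
  / 2 - lnr3 / 2 + lnr53 / 2 + lnD / 2 + lnG 14 - lnG 40 - lnG 48.
Proof.
have := lnG_duplication 46 isT : lnG 46 + lnG 106 =
  (1 / 2 - 46 / 60) * ln2 + (ln2 + lnpi) / 2 + lnG 92.
by have := lnG92; have := lnG106; lra.
Qed.

Lemma lnG58 : lnG 58 = lnpi - 23 / 20 * ln2 - 9 / 20 * ln3 - 7 / 12 * ln5 +
  lnphi / 2 + lnr3 / 2 + lnr53 / 2 + lnC / 2 + lnG 2 - lnG 24 - lnG 40.
Proof.
have := lnG_duplication 58 isT : lnG 58 + lnG 118 =
  (1 / 2 - 58 / 60) * ln2 + (ln2 + lnpi) / 2 + lnG 116.
by have := lnG116; have := lnG118; lra.
Qed.

Lemma lnG18 : lnG 18 = lnpi / 2 + 19 / 20 * ln2 + ln5 / 8 - lnphi + lnD / 2 +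
  lnG 6 - lnG 48.
Proof.
have := lnG_reflection 18 isT : lnG 18 + lnG 102 = lnpi - lns 18.
have := lnG_duplication 42 isT : lnG 42 + lnG 102 =
  (1 / 2 - 42 / 60) * ln2 + (ln2 + lnpi) / 2 + lnG 84.
have := lnG_quintuplication 18 isT : lnG 18 + lnG 42 + lnG 66 + lnG 90 + lnG 114 =
  (1 / 2 - 18 / 24) * ln5 + 2 * (ln2 + lnpi) + lnG 90.
by have := @lns18 R; have := lnG66; have := lnG84; have := lnG114; lra.
Qed.

Lemma lnG102 : lnG 102 = lnpi / 2 + 21 / 20 * ln2 + 3 / 8 * ln5 - lnC / 2 -
  lnG 6 + lnG 48.
Proof.
have := lnG_reflection 18 isT : lnG 18 + lnG 102 = lnpi - lns 18.
by have := @lns18 R; have := lnG18; lra.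
Qed.

Lemma lnG78 : lnG 78 = lnpi / 2 + 23 / 20 * ln2 + 3 / 8 * ln5 - lnD / 2 - lnG
  6 + lnG 24.
Proof.
have := lnG_duplication 18 isT : lnG 18 + lnG 78 =
  (1 / 2 - 18 / 60) * ln2 + (ln2 + lnpi) / 2 + lnG 36.
by have := lnG18; have := lnG36; lra.
Qed.

Lemma lnG42 : lnG 42 = lnpi / 2 - 3 / 20 * ln2 - 3 / 8 * ln5 + lnC / 2 + lnG 6
  - lnG 24.
Proof.
have := lnG_duplication 42 isT : lnG 42 + lnG 102 =
  (1 / 2 - 42 / 60) * ln2 + (ln2 + lnpi) / 2 + lnG 84.
by have := lnG84; have := lnG102; lra.
Qed.

Lemma lnG82 : lnG 82 = lnpi / 2 + 23 / 20 * ln2 + 9 / 20 * ln3 + 3 / 8 * ln5 -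
  lnC / 2 - lnG 2 + lnG 24.
Proof.
have := lnG_triplication 2 isT : lnG 2 + lnG 42 + lnG 82 =
  (1 / 2 - 2 / 40) * ln3 + (ln2 + lnpi) + lnG 6.
by have := lnG42; lra.
Qed.

Lemma lnG86 : lnG 86 = lnpi / 2 + ln2 + ln3 / 2 + 5 / 24 * ln5 - lnphi / 2 +
  lnr3 / 2 - lnr53 / 2 - lnG 14 + lnG 40.
Proof.
have := lnG_triplication 6 isT : lnG 6 + lnG 46 + lnG 86 =
  (1 / 2 - 6 / 40) * ln3 + (ln2 + lnpi) + lnG 18.
by have := lnG18; have := lnG46; lra.
Qed.

Lemma lnG94 : lnG 94 = lnpi / 2 + 21 / 20 * ln2 + 3 / 20 * ln3 + ln5 / 8 - lnD
  / 2 - lnG 14 + lnG 48.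
Proof.
have := lnG_triplication 14 isT : lnG 14 + lnG 54 + lnG 94 =
  (1 / 2 - 14 / 40) * ln3 + (ln2 + lnpi) + lnG 42.
by have := lnG42; have := lnG54; lra.
Qed.

Lemma lnG98 : lnG 98 = lnpi / 2 + ln2 + ln3 / 2 - ln5 / 24 + lnphi / 2 - lnr3
  / 2 - lnr53 / 2 - lnG 2 + lnG 40.
Proof.
have := lnG_triplication 18 isT : lnG 18 + lnG 58 + lnG 98 =
  (1 / 2 - 18 / 40) * ln3 + (ln2 + lnpi) + lnG 54.
by have := lnG18; have := lnG54; have := lnG58; lra.
Qed.

Lemma lnG22 : lnG 22 = lnpi / 2 - 5 / 4 * ln2 - ln3 / 2 - 17 / 24 * ln5 +
  lnphi / 2 + lnA / 2 + lnC / 2 + lnG 2 - lnG 40.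
Proof.
have := lnG_triplication 22 isT : lnG 22 + lnG 62 + lnG 102 =
  (1 / 2 - 22 / 40) * ln3 + (ln2 + lnpi) + lnG 66.
by have := lnG62; have := lnG66; have := lnG102; lra.
Qed.

Lemma lnG26 : lnG 26 = lnpi / 2 + ln2 / 5 - 3 / 20 * ln3 + ln5 / 8 - lnphi / 2
  - lnr3 / 2 + lnr53 / 2 + lnB / 2 + lnG 14 - lnG 48.
Proof.
have := lnG_triplication 26 isT : lnG 26 + lnG 66 + lnG 106 =
  (1 / 2 - 26 / 40) * ln3 + (ln2 + lnpi) + lnG 78.
by have := lnG66; have := lnG78; have := lnG106; lra.
Qed.

Lemma lnG34 : lnG 34 = lnpi / 2 + ln2 / 4 - ln3 / 2 + ln5 / 24 - lnphi / 2 +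
  lnB / 2 + lnD / 2 + lnG 14 - lnG 40.
Proof.
have := lnG_triplication 34 isT : lnG 34 + lnG 74 + lnG 114 =
  (1 / 2 - 34 / 40) * ln3 + (ln2 + lnpi) + lnG 102.
by have := lnG74; have := lnG102; have := lnG114; lra.
Qed.

Lemma lnG38 : lnG 38 = lnpi / 2 - 7 / 5 * ln2 - 9 / 20 * ln3 - 5 / 8 * ln5 +
  lnphi / 2 + lnr3 / 2 + lnr53 / 2 + lnA / 2 + lnG 2 - lnG 24.
Proof.
have := lnG_triplication 38 isT : lnG 38 + lnG 78 + lnG 118 =
  (1 / 2 - 38 / 40) * ln3 + (ln2 + lnpi) + lnG 114.
by have := lnG78; have := lnG114; have := lnG118; lra.
Qed.

Let lnK' x : 0 < x -> x = expR (ln x).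
Proof. by move=> x0; rewrite lnK. Qed.

Let powE x r : 0 < x -> x `^ r = expR (r * ln x).
Proof. by move=> x0; rewrite /powR gt_eqF. Qed.

Let sqrtE x : 0 < x -> sqrt x = expR (ln x / 2).
Proof. by move=> x0; rewrite -ln_sqrt// -lnK' ?sqrtr_gt0. Qed.

Let sqrtE_conj n x a : (0 < n)%N -> 0 <= x -> ln (sqrt n%:R + x) = a ->
  sqrt (sqrt n%:R + x) = expR (a / 2).
Proof. by move=> n0 x0 <-; rewrite sqrtE// ltr_wpDr// sqrt_nat_gt0. Qed.

Let G_lnG a b j : (0 < a)%N -> (0 < b)%N -> (a * 120 = j * b)%N ->
  G (a%:R / b%:R) = expR (lnG j).
Proof.
move=> a0 b0 ab; have j0 : (0 < j)%N by lia.
have -> : a%:R / b%:R = j%:R / 120 :> R.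
  by apply/eqP; rewrite eqr_div ?pnatr_eq0 -?lt0n// -!natrM ab.
by rewrite -lnK'// G_gt0.
Qed.

Lemma gamma_like_formulas : gamma_formulas G.
Proof.
have s0 y : 0 <= sqrt y by exact: sqrtr_ge0.
have phi_starE : phi_star = expR (2 * ln2 + ln5 - lnphi) :> R.
  by rewrite -ln_phi_star -lnK'// phi_star_gt0.
have sqrt_phi_starE : sqrt phi_star = expR ((2 * ln2 + ln5 - lnphi) / 2) :> R.
  by rewrite -ln_phi_star -sqrtE// phi_star_gt0.
(* the inner radicals come first, lest their subterms be rewritten *)
have nested : ((
  (sqrt (sqrt 15 - psi) = expR (lnA / 2) :> R) *
  (sqrt (sqrt 15 - psi_star) = expR (lnB / 2) :> R) *
  (sqrt (sqrt 10 - sqrt phi) = expR (lnC / 2) :> R) *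
  (sqrt (sqrt 10 - sqrt phi_star) = expR (lnD / 2) :> R) *
  (sqrt (sqrt 2 - 1) = expR (lnr2 / 2) :> R) *
  (sqrt (sqrt 3 - 1) = expR (lnr3 / 2) :> R) *
  (sqrt (sqrt 3 - sqrt 2) = expR (lnr23 / 2) :> R) *
  (sqrt (sqrt 5 - sqrt 3) = expR (lnr53 / 2) :> R)) *
  ((sqrt (sqrt 15 + psi) = expR ((3 * ln2 + ln5 - lnphi - lnA) / 2) :> R) *
  (sqrt (sqrt 15 + psi_star) = expR ((ln2 + lnphi - lnB) / 2) :> R) *
  (sqrt (sqrt 10 + sqrt phi) = expR ((2 * ln2 + ln5 - lnphi - lnC) / 2) :> R) *
  (sqrt (sqrt 10 + sqrt phi_star) = expR ((lnphi - lnD) / 2) :> R) *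
  (sqrt (sqrt 2 + 1) = expR (- lnr2 / 2) :> R) *
  (sqrt (sqrt 3 + 1) = expR ((ln2 - lnr3) / 2) :> R) *
  (sqrt (sqrt 3 + sqrt 2) = expR (- lnr23 / 2) :> R) *
  (sqrt (sqrt 5 + sqrt 3) = expR ((ln2 - lnr53) / 2) :> R)))%type.
  split.
  - by do !split; apply: sqrtE; rewrite ?(A_gt0, B_gt0, C_gt0, D_gt0,
      r2_gt0, r3_gt0, r23_gt0, r53_gt0).
  - by do !split; apply: sqrtE_conj => //; try exact: s0;
      rewrite ?(ln_A', ln_B', ln_C', ln_D', ln_r2', ln_r3', ln_r23', ln_r53').
have radicals : (((sqrt phi_star = expR ((2 * ln2 + ln5 - lnphi) / 2) :> R) *
  (sqrt phi = expR (lnphi / 2) :> R) *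
  (phi_star = expR (2 * ln2 + ln5 - lnphi) :> R) *
  (phi = expR lnphi :> R)) *
  ((sqrt 2 = expR (ln2 / 2) :> R) * (sqrt 3 = expR (ln3 / 2) :> R) *
  (sqrt 5 = expR (ln5 / 2) :> R)))%type.
  split.
  - by do !split => //; [exact: sqrtE phi_gt0|exact: lnK' phi_gt0].
  - by do !split; exact: sqrtE.
have powers : (((forall r, pi `^ r = expR (r * lnpi) :> R) *
  (forall r, 2 `^ r = expR (r * ln2) :> R) *
  (forall r, 3 `^ r = expR (r * ln3) :> R) *
  (forall r, 5 `^ r = expR (r * ln5) :> R)) *
  ((sqrt pi = expR (lnpi / 2) :> R) * (pi = expR lnpi :> R)))%type.
  split; split.
  - by split; [split|] => r; apply: powE; rewrite ?pi_gt0.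
  - by move=> r; exact: powE.
  - exact: sqrtE (pi_gt0 R).
  - exact: lnK' (pi_gt0 R).
have values := (G_lnG 1 3 40 isT isT erefl,
  G_lnG 1 4 30 isT isT erefl,
  G_lnG 1 5 24 isT isT erefl,
  G_lnG 2 5 48 isT isT erefl,
  G_lnG 1 8 15 isT isT erefl,
  G_lnG 1 15 8 isT isT erefl,
  G_lnG 1 20 6 isT isT erefl,
  G_lnG 1 24 5 isT isT erefl,
  G_lnG 1 60 2 isT isT erefl,
  G_lnG 7 60 14 isT isT erefl).
have two x : 2 * expR x = expR (ln2 + x) by rewrite expRD -lnK'.
have merge : ((forall x y, (expR x * expR y = expR (x + y))%R) *
  (forall x, (expR x)^-1 = expR (- x)) *
  (forall x n, expR x ^+ n = expR (n%:R * x)))%type.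
  by split; [split|] => *; rewrite ?expRD ?expRN ?expRM_natl.
do 60 (try split).
- rewrite (G_lnG 1 2 60 isT isT erefl) ?values ?nested ?radicals ?powers ?two ?merge.
  by congr expR; rewrite lnG60; lra.
- rewrite (G_lnG 2 3 80 isT isT erefl) ?values ?nested ?radicals ?powers ?two ?merge.
  by congr expR; rewrite lnG80; lra.
- rewrite (G_lnG 3 4 90 isT isT erefl) ?values ?nested ?radicals ?powers ?two ?merge.
  by congr expR; rewrite lnG90; lra.
- rewrite (G_lnG 1 6 20 isT isT erefl) ?values ?nested ?radicals ?powers ?two ?merge.
  by congr expR; rewrite lnG20; lra.
- rewrite (G_lnG 3 5 72 isT isT erefl) ?values ?nested ?radicals ?powers ?two ?merge.
  by congr expR; rewrite lnG72; lra.
- rewrite (G_lnG 5 6 100 isT isT erefl) ?values ?nested ?radicals ?powers ?two ?merge.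
  by congr expR; rewrite lnG100; lra.
- rewrite (G_lnG 4 5 96 isT isT erefl) ?values ?nested ?radicals ?powers ?two ?merge.
  by congr expR; rewrite lnG96; lra.
- rewrite (G_lnG 3 8 45 isT isT erefl) ?values ?nested ?radicals ?powers ?two ?merge.
  by congr expR; rewrite lnG45; lra.
- rewrite (G_lnG 5 8 75 isT isT erefl) ?values ?nested ?radicals ?powers ?two ?merge.
  by congr expR; rewrite lnG75; lra.
- rewrite (G_lnG 7 8 105 isT isT erefl) ?values ?nested ?radicals ?powers ?two ?merge.
  by congr expR; rewrite lnG105; lra.
- rewrite (G_lnG 1 10 12 isT isT erefl) ?values ?nested ?radicals ?powers ?two ?merge.
  by congr expR; rewrite lnG12; lra.
- rewrite (G_lnG 3 10 36 isT isT erefl) ?values ?nested ?radicals ?powers ?two ?merge.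
  by congr expR; rewrite lnG36; lra.
- rewrite (G_lnG 7 10 84 isT isT erefl) ?values ?nested ?radicals ?powers ?two ?merge.
  by congr expR; rewrite lnG84; lra.
- rewrite (G_lnG 9 10 108 isT isT erefl) ?values ?nested ?radicals ?powers ?two ?merge.
  by congr expR; rewrite lnG108; lra.
- rewrite (G_lnG 1 12 10 isT isT erefl) ?values ?nested ?radicals ?powers ?two ?merge.
  by congr expR; rewrite lnG10; lra.
- rewrite (G_lnG 5 12 50 isT isT erefl) ?values ?nested ?radicals ?powers ?two ?merge.
  by congr expR; rewrite lnG50; lra.
- rewrite (G_lnG 7 12 70 isT isT erefl) ?values ?nested ?radicals ?powers ?two ?merge.
  by congr expR; rewrite lnG70; lra.
- rewrite (G_lnG 11 12 110 isT isT erefl) ?values ?nested ?radicals ?powers ?two ?merge.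
  by congr expR; rewrite lnG110; lra.
- rewrite (G_lnG 2 15 16 isT isT erefl) ?values ?nested ?radicals ?powers ?two ?merge.
  by congr expR; rewrite lnG16; lra.
- rewrite (G_lnG 4 15 32 isT isT erefl) ?values ?nested ?radicals ?powers ?two ?merge.
  by congr expR; rewrite lnG32; lra.
- rewrite (G_lnG 7 15 56 isT isT erefl) ?values ?nested ?radicals ?powers ?two ?merge.
  by congr expR; rewrite lnG56; lra.
- rewrite (G_lnG 8 15 64 isT isT erefl) ?values ?nested ?radicals ?powers ?two ?merge.
  by congr expR; rewrite lnG64; lra.
- rewrite (G_lnG 11 15 88 isT isT erefl) ?values ?nested ?radicals ?powers ?two ?merge.
  by congr expR; rewrite lnG88; lra.
- rewrite (G_lnG 13 15 104 isT isT erefl) ?values ?nested ?radicals ?powers ?two ?merge.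
  by congr expR; rewrite lnG104; lra.
- rewrite (G_lnG 14 15 112 isT isT erefl) ?values ?nested ?radicals ?powers ?two ?merge.
  by congr expR; rewrite lnG112; lra.
- rewrite (G_lnG 3 20 18 isT isT erefl) ?values ?nested ?radicals ?powers ?two ?merge.
  by congr expR; rewrite lnG18; lra.
- rewrite (G_lnG 7 20 42 isT isT erefl) ?values ?nested ?radicals ?powers ?two ?merge.
  by congr expR; rewrite lnG42; lra.
- rewrite (G_lnG 9 20 54 isT isT erefl) ?values ?nested ?radicals ?powers ?two ?merge.
  by congr expR; rewrite lnG54; lra.
- rewrite (G_lnG 11 20 66 isT isT erefl) ?values ?nested ?radicals ?powers ?two ?merge.
  by congr expR; rewrite lnG66; lra.
- rewrite (G_lnG 13 20 78 isT isT erefl) ?values ?nested ?radicals ?powers ?two ?merge.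
  by congr expR; rewrite lnG78; lra.
- rewrite (G_lnG 17 20 102 isT isT erefl) ?values ?nested ?radicals ?powers ?two ?merge.
  by congr expR; rewrite lnG102; lra.
- rewrite (G_lnG 19 20 114 isT isT erefl) ?values ?nested ?radicals ?powers ?two ?merge.
  by congr expR; rewrite lnG114; lra.
- rewrite (G_lnG 5 24 25 isT isT erefl) ?values ?nested ?radicals ?powers ?two ?merge.
  by congr expR; rewrite lnG25; lra.
- rewrite (G_lnG 7 24 35 isT isT erefl) ?values ?nested ?radicals ?powers ?two ?merge.
  by congr expR; rewrite lnG35; lra.
- rewrite (G_lnG 11 24 55 isT isT erefl) ?values ?nested ?radicals ?powers ?two ?merge.
  by congr expR; rewrite lnG55; lra.
- rewrite (G_lnG 13 24 65 isT isT erefl) ?values ?nested ?radicals ?powers ?two ?merge.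
  by congr expR; rewrite lnG65; lra.
- rewrite (G_lnG 17 24 85 isT isT erefl) ?values ?nested ?radicals ?powers ?two ?merge.
  by congr expR; rewrite lnG85; lra.
- rewrite (G_lnG 19 24 95 isT isT erefl) ?values ?nested ?radicals ?powers ?two ?merge.
  by congr expR; rewrite lnG95; lra.
- rewrite (G_lnG 23 24 115 isT isT erefl) ?values ?nested ?radicals ?powers ?two ?merge.
  by congr expR; rewrite lnG115; lra.
- rewrite (G_lnG 1 30 4 isT isT erefl) ?values ?nested ?radicals ?powers ?two ?merge.
  by congr expR; rewrite lnG4; lra.
- rewrite (G_lnG 7 30 28 isT isT erefl) ?values ?nested ?radicals ?powers ?two ?merge.
  by congr expR; rewrite lnG28; lra.
- rewrite (G_lnG 11 30 44 isT isT erefl) ?values ?nested ?radicals ?powers ?two ?merge.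
  by congr expR; rewrite lnG44; lra.
- rewrite (G_lnG 13 30 52 isT isT erefl) ?values ?nested ?radicals ?powers ?two ?merge.
  by congr expR; rewrite lnG52; lra.
- rewrite (G_lnG 17 30 68 isT isT erefl) ?values ?nested ?radicals ?powers ?two ?merge.
  by congr expR; rewrite lnG68; lra.
- rewrite (G_lnG 19 30 76 isT isT erefl) ?values ?nested ?radicals ?powers ?two ?merge.
  by congr expR; rewrite lnG76; lra.
- rewrite (G_lnG 23 30 92 isT isT erefl) ?values ?nested ?radicals ?powers ?two ?merge.
  by congr expR; rewrite lnG92; lra.
- rewrite (G_lnG 29 30 116 isT isT erefl) ?values ?nested ?radicals ?powers ?two ?merge.
  by congr expR; rewrite lnG116; lra.
- rewrite (G_lnG 11 60 22 isT isT erefl) ?values ?nested ?radicals ?powers ?two ?merge.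
  by congr expR; rewrite lnG22; lra.
- rewrite (G_lnG 13 60 26 isT isT erefl) ?values ?nested ?radicals ?powers ?two ?merge.
  by congr expR; rewrite lnG26; lra.
- rewrite (G_lnG 17 60 34 isT isT erefl) ?values ?nested ?radicals ?powers ?two ?merge.
  by congr expR; rewrite lnG34; lra.
- rewrite (G_lnG 19 60 38 isT isT erefl) ?values ?nested ?radicals ?powers ?two ?merge.
  by congr expR; rewrite lnG38; lra.
- rewrite (G_lnG 23 60 46 isT isT erefl) ?values ?nested ?radicals ?powers ?two ?merge.
  by congr expR; rewrite lnG46; lra.
- rewrite (G_lnG 29 60 58 isT isT erefl) ?values ?nested ?radicals ?powers ?two ?merge.
  by congr expR; rewrite lnG58; lra.
- rewrite (G_lnG 31 60 62 isT isT erefl) ?values ?nested ?radicals ?powers ?two ?merge.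
  by congr expR; rewrite lnG62; lra.
- rewrite (G_lnG 37 60 74 isT isT erefl) ?values ?nested ?radicals ?powers ?two ?merge.
  by congr expR; rewrite lnG74; lra.
- rewrite (G_lnG 41 60 82 isT isT erefl) ?values ?nested ?radicals ?powers ?two ?merge.
  by congr expR; rewrite lnG82; lra.
- rewrite (G_lnG 43 60 86 isT isT erefl) ?values ?nested ?radicals ?powers ?two ?merge.
  by congr expR; rewrite lnG86; lra.
- rewrite (G_lnG 47 60 94 isT isT erefl) ?values ?nested ?radicals ?powers ?two ?merge.
  by congr expR; rewrite lnG94; lra.
- rewrite (G_lnG 49 60 98 isT isT erefl) ?values ?nested ?radicals ?powers ?two ?merge.
  by congr expR; rewrite lnG98; lra.
- rewrite (G_lnG 53 60 106 isT isT erefl) ?values ?nested ?radicals ?powers ?two ?merge.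
  by congr expR; rewrite lnG106; lra.
- rewrite (G_lnG 59 60 118 isT isT erefl) ?values ?nested ?radicals ?powers ?two ?merge.
  by congr expR; rewrite lnG118; lra.
Qed.
End GammaFormulas.

(** * Algebraic constants and expressible values *)

Section Algebraic.
Context {R : realType}.
Local Notation alg := (algebraicOver (@ratr R)).

Lemma algebraic_root n (a : R) : (0 < n)%N -> alg (a ^+ n) -> alg a.
Proof.
move=> n0 [p p0 /rootP pa]; exists (p \Po 'X^n).
  by rewrite comp_poly_eq0// size_polyXn ltnS.
apply/rootP; rewrite map_comp_poly map_polyXn horner_comp hornerXn.
exact: pa.
Qed.

Lemma algebraic_expn (a : R) n : alg a -> alg (a ^+ n).
Proof.
move=> aa; elim: n => [|n IH]; last by rewrite exprS; exact: algebraic_mul.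
by rewrite expr0; exact: algebraic1.
Qed.

Lemma algebraic_ratr (q : rat) : alg (ratr q).
Proof. exact: algebraic_id. Qed.

Lemma algebraic_natr n : alg n%:R.
Proof. by rewrite -(ratr_nat R n); exact: algebraic_ratr. Qed.

Lemma algebraic_powR (a : R) (q : rat) : 0 < a -> alg a -> alg (a `^ ratr q).
Proof.
move=> a0 aa; have d0 : (0 < `|denq q|)%N by rewrite absz_gt0 denq_eq0.
apply: (algebraic_root _ _ d0).
rewrite -powR_mulrn ?powR_ge0// -powRrM.
have -> : ratr q * `|denq q|%:R = (numq q)%:~R :> R.
  have -> : `|denq q|%:R = (denq q)%:~R :> R by rewrite -[in RHS]absz_denq.
  by rewrite /ratr divfK// intr_eq0 denq_neq0.
rewrite powR_intmul ?ltW//.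
case: (numq q) => n; first exact: algebraic_expn.
by rewrite NegzE -exprnN; apply: algebraic_inv; exact: algebraic_expn.
Qed.

Lemma algebraic_sqrt (a : R) : alg a -> alg (Num.sqrt a).
Proof.
move=> aa; have [a0|a0] := leP 0 a.
  by apply: (algebraic_root 2) => //; rewrite sqr_sqrtr.
by rewrite ler0_sqrtr ?ltW//; exact: algebraic0.
Qed.

(** The sines of 20, 24, 36 and 40 units are radicals; subtracting 20 from 24
gives 4 units, two halvings reach one unit, and addition formulas then reach
every multiple. *)
Lemma algebraic_sn j : (0 < j < 120)%N -> alg (sn j).
Proof.
have half i : (i <= 30)%N -> alg (sn (60 - (i + i))) -> alg (sn i) /\ alg (sn (60 - i)).
  move=> i30 ha.
  have i60 : (i <= 60)%N by lia.
  have ii60 : (i + i <= 60)%N by lia.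
  have h1 := sn_mul (R:=R) i i (leqnn i) ii60; rewrite subnn -[(60 - 0)%N]/60%N sn60 in h1.
  have a1 : alg (sn i ^+ 2).
    rewrite expr2 h1; apply: algebraic_div; last exact: (algebraic_natr 2).
    by apply: algebraic_sub => //; exact: algebraic1.
  split; apply: (algebraic_root 2) => //.
  have -> : sn (60 - i) ^+ 2 = 1 - sn i ^+ 2 :> R by rewrite -(sn_sqr i i60); ring.
  by apply: algebraic_sub => //; exact: algebraic1.
have n2 : alg 2 by exact: (algebraic_natr 2).
have a20 : alg (sn 20) by rewrite sn20; apply: algebraic_div => //; exact: algebraic1.
have a40 : alg (sn 40).
  by rewrite sn40; apply: algebraic_div => //; apply: algebraic_sqrt; exact: (algebraic_natr 3).
have a5 : alg (Num.sqrt 5) by apply: algebraic_sqrt; exact: (algebraic_natr 5).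
have a36 : alg (sn 36).
  rewrite sn36; apply: algebraic_div; last exact: (algebraic_natr 4).
  by apply: algebraic_add => //; exact: algebraic1.
have a24 : alg (sn 24).
  apply: (algebraic_root 2) => //; rewrite sn24_sqr; apply: algebraic_div.
    by apply: algebraic_sub => //; exact: (algebraic_natr 5).
  exact: (algebraic_natr 8).
have a56 : alg (sn 56).
  apply: (algebraic_root 2) => //.
  have -> : sn 56 ^+ 2 = 1 - sn 4 ^+ 2 :> R by rewrite -(sn_sqr 4 isT); ring.
  apply: algebraic_sub; [exact: algebraic1|apply: algebraic_expn].
  have -> : sn 4 = sn 24 * sn 40 - sn 36 * sn 20 :> R by exact: (snB 24 20 isT).
  by apply: algebraic_sub; exact: algebraic_mul.
have [a2 a58] := half 2 isT a56.
have [a1 a59] := half 1 isT a58.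
have low i : (i <= 60)%N -> alg (sn i) /\ alg (sn (60 - i)).
  elim: i => [_|i IH i60].
    by rewrite subn0 sn60 /sn mul0r mulr0 sin0; split; [exact: algebraic0|exact: algebraic1].
  have [h1 h2] := IH (ltnW i60); split.
    rewrite -addn1 (snD i 1 (ltnW i60) isT).
    by apply: algebraic_add; exact: algebraic_mul.
  have -> : (60 - i.+1 = (60 - i) - 1)%N by lia.
  rewrite snB; last by lia.
  rewrite subKn; last by lia.
  by apply: algebraic_sub; exact: algebraic_mul.
move=> j120; have [/low[]//|j60] := leqP j 60.
have -> : j = (120 - (120 - j))%N by lia.
rewrite sn_sym; last by lia.
have j' : (120 - j <= 60)%N by lia.
by have [] := low _ j'.
Qed.

End Algebraic.

Section Expressible.
Context (R : realType).
Local Notation alg := (algebraicOver (@ratr R)).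
Local Notation std := (@standard_solution R).

(** The logarithm of a monomial in pi and the basis values with an algebraic
coefficient, as a function of the standard solution.  In this logarithmic form
the functions are closed under rational linear combinations. *)
Definition expressible (f : (rat -> R) -> R) : Prop :=
  exists (alpha : R) (r : rat) (m : rat -> rat),
    [/\ 0 < alpha, alg alpha &
        forall G, std G -> f G = ln alpha + ratr r * ln pi +
          \sum_(y <- setB ++ setE) ratr (m y) * ln (G y)].

Lemma expressible_ext f g : expressible f ->
  (forall G, std G -> g G = f G) -> expressible g.
Proof.
move=> [a [r [m [a0 aa H]]]] fg; exists a, r, m; split=> // G sG.
by rewrite fg// H.
Qed.

Lemma expressibleD f g : expressible f -> expressible g ->
  expressible (fun G => f G + g G).
Proof.
move=> [a [r [m [a0 aa Hf]]]] [b [s [n [b0 ab Hg]]]].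
exists (a * b), (r + s), (fun y => m y + n y); split.
- exact: mulr_gt0.
- exact: algebraic_mul.
- move=> G sG; rewrite Hf// Hg// ln_mul// rmorphD/=.
  under [in RHS]eq_bigr do rewrite rmorphD mulrDl.
  by rewrite big_split/=; ring.
Qed.

(** This is where rational powers of algebraic numbers appear. *)
Lemma expressibleZ (q : rat) f : expressible f ->
  expressible (fun G => ratr q * f G).
Proof.
move=> [a [r [m [a0 aa Hf]]]]; exists (a `^ ratr q), (q * r), (fun y => q * m y).
split; [exact: powR_gt0|exact: algebraic_powR|].
move=> G sG; rewrite Hf// ln_powR rmorphM/=.
under [in RHS]eq_bigr do rewrite rmorphM/= -mulrA.
by rewrite -mulr_sumr; ring.
Qed.

Lemma expressible_ln (a : R) : 0 < a -> alg a -> expressible (fun=> ln a).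
Proof.
move=> a0 aa; exists a, 0, (fun=> 0); split=> // G _.
by rewrite rmorph0 mul0r addr0 big1 ?addr0// => y _; rewrite mul0r.
Qed.

Lemma expressible0 : expressible (fun=> 0).
Proof.
by apply: (expressible_ext _ _ (expressible_ln 1 ltr01 (algebraic1 _))) => G _; rewrite ln1.
Qed.

Lemma expressible_pi : expressible (fun=> ln pi).
Proof.
exists 1, 1, (fun=> 0); split=> //; first exact: algebraic1.
move=> G _; rewrite ln1 add0r rmorph1 mul1r big1 ?addr0// => y _.
by rewrite rmorph0 mul0r.
Qed.

Lemma basis_uniq : uniq (setB ++ setE).
Proof. by vm_compute. Qed.

Lemma expressible_base y : y \in setB ++ setE -> expressible (fun G => ln (G y)).
Proof.
move=> yB; exists 1, 0, (fun z => (z == y)%:R); split=> //; first exact: algebraic1.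
move=> G _; rewrite ln1 rmorph0 mul0r !add0r.
have := basis_uniq; move: (setB ++ setE) yB => s ys us.
rewrite (bigD1_seq y)//= eqxx rmorph1 mul1r big1 ?addr0// => z /negbTE ->.
by rewrite rmorph0 mul0r.
Qed.

Lemma expressible_sum (I : Type) (s : seq I) (P : pred I) (F : I -> (rat -> R) -> R) :
  (forall i, P i -> expressible (F i)) ->
  expressible (fun G => \sum_(i <- s | P i) F i G).
Proof.
move=> H; elim: s => [|i s IH].
  by apply: (expressible_ext _ _ expressible0) => G _; rewrite big_nil.
have [Pi|Pi] := boolP (P i).
  apply: (expressible_ext _ _ (expressibleD _ _ (H i Pi) IH)) => G _.
  by rewrite big_cons Pi.
by apply: (expressible_ext _ _ IH) => G _; rewrite big_cons (negbTE Pi).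
Qed.

End Expressible.

(** * Linear relations between logarithms of gamma values *)

(** Instances of the reflection formula at j/120, and of the multiplication
formula for n at j/120. *)
Inductive relation := Reflection of nat | Multiplication of nat & nat.

Definition relation_ok (r : relation) : bool :=
  match r with
  | Reflection j => (0 < j < 120)%N
  | Multiplication n j => [&& (0 < n)%N, (n %| 120)%N, (0 < j)%N & (n * j < 120)%N]
  end.

(** The two sides list the points, multiplied by 120, at which the relation
involves the solution. *)
Definition relation_lhs (r : relation) : seq nat :=
  match r with
  | Reflection j => [:: j; (120 - j)%N]
  | Multiplication n j => [seq (j + k * (120 %/ n))%N | k <- iota 0 n]
  end.

Definition relation_rhs (r : relation) : seq nat :=
  match r with Reflection _ => [::] | Multiplication n j => [:: (n * j)%N] end.

Definition relation_coef (r : relation) (k : nat) : int :=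
  (count_mem k (relation_lhs r))%:Z - (count_mem k (relation_rhs r))%:Z.

Definition combination : Type := seq (int * relation).

Definition comb_coef (e : combination) (k : nat) : int :=
  foldr (fun cr s => cr.1 * relation_coef cr.2 k + s) 0 e.

(** A combination of relations isolates the point je.1 if it occurs with a
nonzero coefficient and all other points that occur are already known. *)
Definition step_ok (known : seq nat) (je : nat * combination) : bool :=
  [&& all (fun cr => relation_ok cr.2) je.2, (je.1 < 120)%N, comb_coef je.2 je.1 != 0 &
      all (fun k => [|| comb_coef je.2 k == 0, k \in known | k == je.1]) (iota 0 120)].

Fixpoint plan_ok (known : seq nat) (p : seq (nat * combination)) : bool :=
  if p is je :: p' then step_ok known je && plan_ok (je.1 :: known) p' else true.

(** The points of the two given sets multiplied by 120, in the same order. *)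
Definition basis_points : seq nat :=
  [:: 40; 30; 24; 48; 15; 8; 6; 5; 2; 14; 3; 9; 21; 1; 7; 11]%N.

Local Notation r := Reflection.
Local Notation m := Multiplication.
(** Found by Gaussian elimination; most points need a single relation. *)
Definition elimination_plan : seq (nat * combination) :=
  [:: (119%N, [:: (1, r 1)]); (118%N, [:: (1, r 2)]); (117%N, [:: (1, r 3)]);
      (115%N, [:: (1, r 5)]); (114%N, [:: (1, r 6)]); (113%N, [:: (1, r 7)]);
      (112%N, [:: (1, r 8)]); (111%N, [:: (1, r 9)]); (109%N, [:: (1, r 11)]);
      (106%N, [:: (1, r 14)]); (105%N, [:: (1, r 15)]);
      (99%N, [:: (1, r 21)]); (96%N, [:: (1, r 24)]); (90%N, [:: (1, r 30)]);
      (80%N, [:: (1, r 40)]); (72%N, [:: (1, r 48)]); (60%N, [:: (1, r 60)]);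
      (61%N, [:: (1, m 2 1)]); (63%N, [:: (1, m 2 3)]);
      (67%N, [:: (1, m 2 7)]); (12%N, [:: (1, m 2 12)]);
      (75%N, [:: (1, m 2 15)]); (20%N, [:: (1, m 2 20)]);
      (84%N, [:: (1, m 2 24)]); (36%N, [:: (1, m 2 36)]);
      (100%N, [:: (1, m 2 40)]); (45%N, [:: (1, m 2 45)]);
      (108%N, [:: (1, m 2 48)]); (53%N, [:: (1, m 2 53)]);
      (54%N, [:: (1, m 2 54)]); (57%N, [:: (1, m 2 57)]);
      (59%N, [:: (1, m 2 59)]); (85%N, [:: (1, m 3 5)]);
      (88%N, [:: (1, m 3 8)]); (19%N, [:: (1, m 3 19)]);
      (101%N, [:: (1, m 3 21)]); (32%N, [:: (1, m 3 32)]);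
      (35%N, [:: (1, m 3 35)]); (66%N, [:: (1, r 54)]);
      (10%N, [:: (1, r 10); (- 1, m 2 50); (1, m 3 10)]);
      (110%N, [:: (1, r 10)]); (65%N, [:: (1, m 2 5)]);
      (70%N, [:: (1, m 2 10)]); (95%N, [:: (1, m 2 35)]);
      (50%N, [:: (1, m 2 50)]); (55%N, [:: (1, m 2 55)]);
      (25%N, [:: (1, m 3 25)]);
      (16%N, [:: (1, r 16); (- 1, m 3 24); (1, m 5 16)]);
      (104%N, [:: (1, r 16)]); (68%N, [:: (1, m 2 8)]);
      (76%N, [:: (1, m 2 16)]); (44%N, [:: (1, m 2 44)]);
      (52%N, [:: (1, m 2 52)]); (4%N, [:: (1, m 3 4)]);
      (92%N, [:: (1, m 3 12)]); (56%N, [:: (1, m 3 16)]);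
      (64%N, [:: (1, m 3 24)]); (28%N, [:: (1, m 3 28)]);
      (116%N, [:: (1, m 3 36)]); (62%N, [:: (1, m 2 2)]);
      (74%N, [:: (1, m 2 14)]); (46%N, [:: (1, m 2 46)]);
      (58%N, [:: (1, m 2 58)]);
      (18%N, [:: (1, r 18); (- 1, m 2 42); (1, m 5 18)]);
      (102%N, [:: (1, r 18)]); (69%N, [:: (1, m 2 9)]);
      (78%N, [:: (1, m 2 18)]); (39%N, [:: (1, m 2 39)]);
      (42%N, [:: (1, m 2 42)]); (51%N, [:: (1, m 2 51)]);
      (82%N, [:: (1, m 3 2)]); (86%N, [:: (1, m 3 6)]);
      (94%N, [:: (1, m 3 14)]); (98%N, [:: (1, m 3 18)]);
      (22%N, [:: (1, m 3 22)]); (26%N, [:: (1, m 3 26)]);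
      (34%N, [:: (1, m 3 34)]); (38%N, [:: (1, m 3 38)]);
      (79%N, [:: (1, m 3 39)]); (27%N, [:: (1, m 5 3)]);
      (87%N, [:: (1, m 5 15)]); (93%N, [:: (1, m 5 21)]);
      (33%N, [:: (1, r 33)]); (81%N, [:: (1, r 39)]); (41%N, [:: (1, r 41)]);
      (71%N, [:: (1, m 2 11)]); (49%N, [:: (1, m 2 49)]);
      (47%N, [:: (1, m 3 7)]); (89%N, [:: (1, m 3 9)]);
      (91%N, [:: (1, m 3 11)]); (13%N, [:: (1, m 3 13)]);
      (107%N, [:: (1, m 3 27)]); (29%N, [:: (1, m 3 29)]);
      (31%N, [:: (1, m 3 31)]); (73%N, [:: (1, m 3 33)]);
      (97%N, [:: (1, m 5 1)]); (77%N, [:: (1, m 5 5)]);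
      (103%N, [:: (1, m 5 7)]); (83%N, [:: (1, m 5 11)]);
      (37%N, [:: (1, m 5 13)]); (17%N, [:: (1, m 5 17)]);
      (43%N, [:: (1, m 5 19)]); (23%N, [:: (1, m 5 23)])].

Lemma elimination_plan_ok : plan_ok basis_points elimination_plan.
Proof. by vm_compute. Qed.

Lemma elimination_plan_full :
  all (fun k => (k \in basis_points) || (k \in unzip1 elimination_plan)) (iota 1 119).
Proof. by vm_compute. Qed.

Lemma gamma_dom_gt0 (x : rat) : 0 < x -> gamma_dom x.
Proof.
move=> x0; rewrite /gamma_dom; apply/negP => /natrP[n E].
have : 0 <= - x by rewrite E.
by rewrite oppr_ge0 leNgt x0.
Qed.

Lemma frac_notint (j N : nat) : (0 < j < N)%N -> (j%:R / N%:R : rat) \isn't a Num.int.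
Proof.
move=> /andP[j0 jN]; apply/negP => /intrP[z E].
have N0 : N%:R != 0 :> rat by rewrite pnatr_eq0; lia.
have : (j%:Z)%:~R == (z * N%:Z)%:~R :> rat by rewrite rmorphM/= -E divfK.
rewrite eqr_int => /eqP jz; have [z0|z0] := leP z 0.
  have : z * N%:Z <= 0 by rewrite mulr_le0_ge0.
  by rewrite -jz; lia.
have : 1 * N%:Z <= z * N%:Z by rewrite ler_wpM2r; lia.
by rewrite -jz; lia.
Qed.

(** The denominator is a variable in most lemmas, so that rational arithmetic
is never carried out on literals. *)
Definition pt_of (N k : nat) : rat := k%:R / N%:R.
Definition pt : nat -> rat := pt_of 120.

Section Points.
Context (N : nat) (N0 : (0 < N)%N).
Local Notation pt := (pt_of N).

Let N1 : N%:R != 0 :> rat. Proof. by rewrite pnatr_eq0 -lt0n. Qed.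

Lemma pt_of_gt0 k : (0 < k)%N -> 0 < pt k.
Proof. by move=> k0; rewrite divr_gt0 ?ltr0n. Qed.

Lemma pt_ofC j : (j <= N)%N -> 1 - pt j = pt (N - j).
Proof. by move=> jN; rewrite /pt_of natrB// mulrBl divff. Qed.

Lemma pt_ofM n j : n%:R * pt j = pt (n * j).
Proof. by rewrite /pt_of natrM mulrA. Qed.

Lemma pt_ofD n m j k : (n * m = N)%N -> pt j + k%:R / n%:R = pt (j + k * m).
Proof.
move=> nm; rewrite /pt_of natrD natrM mulrDl -nm natrM; congr (_ + _).
have : n%:R * m%:R != 0 :> rat by rewrite -natrM nm.
by rewrite mulf_eq0 negb_or => /andP[n0 m0]; field; rewrite m0 n0.
Qed.

Lemma ratr_pt_of (R : realType) k : ratr (pt k) = k%:R / N%:R :> R.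
Proof. by rewrite /pt_of rmorphM fmorphV/= !ratr_nat. Qed.

End Points.

Lemma pt_gt0 k : (0 < k)%N -> 0 < pt k. Proof. exact: pt_of_gt0. Qed.
Lemma ptC j : (j <= 120)%N -> 1 - pt j = pt (120 - j). Proof. exact: pt_ofC. Qed.
Lemma ptM n j : n%:R * pt j = pt (n * j). Proof. exact: pt_ofM. Qed.
Lemma ptD n m j k : (n * m = 120)%N -> pt j + k%:R / n%:R = pt (j + k * m).
Proof. exact: pt_ofD. Qed.
Lemma ratr_pt (R : realType) k : ratr (pt k) = k%:R / 120 :> R.
Proof. exact: ratr_pt_of. Qed.
Lemma pt_notint j : (0 < j < 120)%N -> pt j \isn't a Num.int.
Proof. exact: frac_notint. Qed.

Section Elimination.
Context (R : realType).
Local Notation alg := (algebraicOver (@ratr R)).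
Local Notation std := (@standard_solution R).
Local Notation expressible := (@expressible R).

Definition lnv (k : nat) (G : rat -> R) : R := ln (G (pt k)).

Definition relation_const (q : relation) : R :=
  match q with
  | Reflection j => ln pi - ln (sn j)
  | Multiplication n j => (1 / 2 - n%:R * (j%:R / 120)) * ln n%:R +
      (n%:R - 1) / 2 * (ln 2 + ln pi)
  end.

Lemma std_gt0 G k : std G -> (0 < k)%N -> 0 < G (pt k).
Proof. by move=> [_ [H _]] k0; apply: H; exact: pt_gt0. Qed.

(** Evaluating a relation at an arbitrary standard solution uses only the
clauses of the definition, not the formulas proved for Euler's integral. *)
Lemma relation_constP q G : relation_ok q -> std G ->
  \sum_(k <- relation_lhs q) lnv k G =
  relation_const q + \sum_(k <- relation_rhs q) lnv k G.
Proof.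
case: q => [j j120|n j] /=.
  move=> sG; have [_ [_ [_ [_ [refl _]]]]] := sG.
  have /andP[j0 j1] := j120; have s0 := sn_gt0 (R:=R) j j120.
  rewrite big_cons big_seq1 big_nil addr0 /lnv -ln_mul ?std_gt0 ?subn_gt0//.
  rewrite -ptC ?(ltnW j1)// refl ?pt_notint// ratr_pt -/(sn j).
  by rewrite ln_mul ?pi_gt0 ?invr_gt0// ln_inv.
move=> /and4P[n0 n120 j0 nj] sG; have [_ [_ [_ [_ [_ mul]]]]] := sG.
rewrite big_map big_seq1.
have e120 : (n * (120 %/ n) = 120)%N by rewrite mulnC divnK.
set m := (120 %/ n)%N in e120 *.
have nj0 : (0 < n * j)%N by rewrite muln_gt0 n0.
have := mul n (pt j) n0; rewrite ptM => /(_ (gamma_dom_gt0 _ (pt_gt0 _ nj0))) H.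
have -> : \sum_(k <- iota 0 n) lnv (j + k * m) G =
    ln (\prod_(k < n) G (pt j + k%:R / n%:R)).
  rewrite -(big_mkord xpredT (fun k => G (pt j + k%:R / n%:R))) /index_iota subn0.
  rewrite -[LHS]expRK expR_sum; congr ln; apply: eq_bigr => k _.
  by rewrite (ptD _ _ _ _ e120) /lnv lnK// posrE std_gt0// addn_gt0 j0.
rewrite H.
have p2 : 0 < 2 * pi :> R by rewrite mulr_gt0 ?pi_gt0.
have nR0 : 0 < n%:R :> R by rewrite ltr0n.
rewrite !ln_mul ?mulr_gt0 ?powR_gt0 ?std_gt0//.
by rewrite !ln_powR ln_mul ?pi_gt0// ratr_pt.
Qed.

Lemma relation_const_expressible q : relation_ok q ->
  expressible (fun=> relation_const q).
Proof.
case: q => [j j120|n j] /=.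
  apply: (expressible_ext _ _ _ (expressibleD _ _ _ (expressible_pi R)
    (expressibleZ _ (-1) _ (expressible_ln _ _ (sn_gt0 j j120) (algebraic_sn j j120))))).
  by move=> G _; rewrite rmorphN1 mulN1r.
move=> /and4P[n0 _ _ _].
have n0' : 0 < n%:R :> R by rewrite ltr0n.
apply: (expressible_ext _ _ _ (expressibleD _ _ _
  (expressibleZ _ (1 / 2 - n%:R * pt j) _
     (expressible_ln _ _ n0' (algebraic_natr n)))
  (expressibleZ _ ((n%:R - 1) / 2) _ (expressibleD _ _ _
     (expressible_ln _ 2 (ltr0Sn R 1) (algebraic_natr 2)) (expressible_pi R))))).
have e1 (x : rat) : ratr (1 / 2 - n%:R * x) = 1 / 2 - n%:R * ratr x :> R.
  by rewrite rmorphB/= !rmorphM/= fmorphV/= rmorph1 !ratr_nat.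
have e2 : ratr ((n%:R - 1) / 2) = (n%:R - 1) / 2 :> R.
  by rewrite rmorphM/= fmorphV/= rmorphB/= rmorph1 !ratr_nat.
by move=> G _; rewrite e1 e2 ratr_pt.
Qed.

Lemma sum_count (s : seq nat) (F : nat -> R) : all (fun k => k < 120)%N s ->
  \sum_(k < 120) (count_mem (k : nat) s)%:R * F k = \sum_(k <- s) F k.
Proof.
elim: s => [_|a s IH /= /andP[a120 s120]].
  by rewrite big_nil big1// => k _; rewrite mul0r.
rewrite big_cons -IH// -(big_mkord xpredT (fun k => ((a == k) + count_mem k s)%:R * F k)).
under eq_bigr do rewrite natrD mulrDl.
rewrite big_split/= big_mkord -[in RHS](big_mkord xpredT (fun k => (count_mem k s)%:R * F k)) big_mkord.
congr (_ + _); rewrite (bigD1 (Ordinal a120))//= eqxx mul1r big1 ?addr0// => k ka.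
suff -> : (a == k) = false by rewrite mul0r.
by apply/negbTE; apply: contra ka => /eqP ak; apply/eqP/val_inj.
Qed.

End Elimination.

(** * Elimination *)

Lemma relation_lhs_lt q : relation_ok q -> all (fun k => k < 120)%N (relation_lhs q).
Proof.
case: q => [j|n j] /=; first by lia.
move=> /and4P[n0 n120 j0 nj]; apply/allP => _ /mapP[k + ->].
rewrite mem_iota add0n => /andP[_ kn].
have e120 : (n * (120 %/ n) = 120)%N by rewrite mulnC divnK.
set m := (120 %/ n)%N in e120 *.
have jm : (j < m)%N by rewrite -(ltn_pmul2l n0) e120.
apply: (@leq_trans (m + k * m)); first by rewrite ltn_add2r.
by rewrite -e120 -mulSn leq_mul2r kn orbT.
Qed.

Lemma relation_rhs_lt q : relation_ok q -> all (fun k => k < 120)%N (relation_rhs q).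
Proof. by case: q => [j|n j] //= /and4P[_ _ _ ->]. Qed.

Lemma basis_pointsP : all (fun k => pt k \in setB ++ setE) basis_points.
Proof. by vm_compute. Qed.

Lemma basis_gt0 : all (fun y : rat => 0 < y) (setB ++ setE).
Proof. by vm_compute. Qed.

Section Elimination.
Context (R : realType).
Local Notation alg := (algebraicOver (@ratr R)).
Local Notation std := (@standard_solution R).
Local Notation expressible := (@expressible R).
Local Notation lnv := (lnv R).

Lemma relation_coefP q G : relation_ok q -> std G ->
  \sum_(k < 120) (relation_coef q k)%:~R * lnv k G = relation_const R q.
Proof.
move=> qok sG; have := relation_constP R q G qok sG.
rewrite -(sum_count R _ (lnv^~ G) (relation_lhs_lt q qok)).
rewrite -(sum_count R _ (lnv^~ G) (relation_rhs_lt q qok)).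
move/eqP; rewrite -subr_eq => /eqP <-; rewrite -sumrB; apply: eq_bigr => k _.
by rewrite /relation_coef rmorphB/= mulrBl.
Qed.

Lemma comb_coefP (e : combination) G : all (fun cr => relation_ok cr.2) e -> std G ->
  \sum_(k < 120) (comb_coef e k)%:~R * lnv k G =
  \sum_(cr <- e) (cr.1)%:~R * relation_const R cr.2.
Proof.
move=> + sG; elim: e => [_|[c q] e IH /= /andP[qok eok]].
  by rewrite big_nil big1// => k _; rewrite mul0r.
rewrite big_cons -IH// -(relation_coefP q G qok sG) mulr_sumr -big_split/=.
by apply: eq_bigr => k _; rewrite rmorphD rmorphM/=; ring.
Qed.

(** The combination is an affine identity between the values, which is solved
for the one at je.1. *)
Lemma step_expressible (known : seq nat) je :
  (forall k, k \in known -> expressible (lnv k)) -> step_ok known je ->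
  expressible (lnv je.1).
Proof.
move: je => [j e] Hk /and4P[eok j120 vj /allP others].
rewrite -[(j, e).1]/j -[(j, e).2]/e in eok j120 vj others *.
have v0 : (comb_coef e j)%:~R != 0 :> R by rewrite intr_eq0.
pose rest G := \sum_(k < 120 | k != Ordinal j120) ratr (- (comb_coef e k)%:~R) * lnv k G.
have e_rest : expressible rest.
  apply: expressible_sum => k kj.
  have := others k; rewrite mem_iota ltn_ord => /(_ isT) /or3P[/eqP ->|kk|/eqP kE].
  - by apply: (expressible_ext _ _ _ (expressible0 R)) => G _; rewrite oppr0 rmorph0 mul0r.
  - by apply: expressibleZ; exact: Hk.
  - by case/eqP: kj; exact: val_inj.
have e_const : expressible (fun=> \sum_(cr <- e) (cr.1)%:~R * relation_const R cr.2).
  move: eok {v0 others rest e_rest vj}; elim: e => [_|[c q] e IH /= /andP[qok eok]].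
    by apply: (expressible_ext _ _ _ (expressible0 R)) => G _; rewrite big_nil.
  apply: (expressible_ext _ _ _ (expressibleD _ _ _
    (expressibleZ _ c%:~R _ (relation_const_expressible R q qok)) (IH eok))).
  by move=> G _; rewrite big_cons/= ratr_int.
apply: (expressible_ext _ _ _ (expressibleZ _ (comb_coef e j)%:~R^-1 _
  (expressibleD _ _ _ e_const e_rest))) => G sG.
rewrite -(comb_coefP e G eok sG) (bigD1 (Ordinal j120))//= /rest -addrA -big_split/=.
rewrite big1 ?addr0 => [|k _]; last first.
  by rewrite rmorphN/= ratr_int mulNr subrr.
by rewrite fmorphV/= ratr_int mulKf.
Qed.

Lemma plan_expressible known p :
  (forall k, k \in known -> expressible (lnv k)) -> plan_ok known p ->
  forall j, j \in unzip1 p -> expressible (lnv j).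
Proof.
elim: p known => [|je p IH] known Hk //= /andP[sok pok] j.
have Hj := step_expressible known je Hk sok.
rewrite inE => /predU1P[->//|]; apply: (IH _ _ pok) => k.
by rewrite inE => /predU1P[->//|]; exact: Hk.
Qed.

Lemma lnv_expressible j : (0 < j < 120)%N -> expressible (lnv j).
Proof.
move=> j120; have base k : k \in basis_points -> expressible (lnv k).
  by move=> /(allP basis_pointsP); exact: expressible_base.
have := allP elimination_plan_full j; rewrite mem_iota => /(_ j120) /orP[/base//|].
exact: plan_expressible base elimination_plan_ok j.
Qed.

Lemma gamma_dom_notint (x : rat) : x \isn't a Num.int -> gamma_dom x.
Proof.
move=> xi; rewrite /gamma_dom; apply: contra xi => /natrP[n E].
by rewrite -[x]opprK E rpredN; apply: rpred_nat.
Qed.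

(** The difference equation multiplies by nonzero rationals, and the factor is
the same for all standard solutions. *)
Lemma shift_up (x : rat) n : 0 < x -> exists q : rat,
  q != 0 /\ forall G, std G -> G (x + n%:R) = ratr q * G x.
Proof.
move=> x0; elim: n => [|n [q [q0 H]]].
  by exists 1; split=> // G _; rewrite addr0 rmorph1 mul1r.
have xn : 0 < x + n%:R by rewrite ltr_wpDr.
exists ((x + n%:R) * q); split; first by rewrite mulf_neq0// gt_eqF.
move=> G sG; have [_ [_ [_ [shift _]]]] := sG.
by rewrite -natr1 addrA shift ?gamma_dom_gt0// (H G sG) rmorphM/= mulrA.
Qed.

Lemma shift_down (x : rat) n : x \isn't a Num.int -> exists q : rat,
  q != 0 /\ forall G, std G -> G (x - n%:R) = ratr q * G x.
Proof.
move=> xi; elim: n => [|n [q [q0 H]]].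
  by exists 1; split=> // G _; rewrite subr0 rmorph1 mul1r.
have xn : x - n.+1%:R \isn't a Num.int.
  by apply: contra xi => h; rewrite -(subrK n.+1%:R x) rpredD// rpred_nat.
have xn0 : x - n.+1%:R != 0 by apply: contraNneq xn => ->; exact: rpred0.
exists ((x - n.+1%:R)^-1 * q); split; first by rewrite mulf_neq0// invr_eq0.
move=> G sG; have [_ [_ [_ [shift _]]]] := sG.
have := shift _ (gamma_dom_notint _ xn).
rewrite (_ : x - n.+1%:R + 1 = x - n%:R); last by rewrite -natr1; ring.
rewrite (H G sG) => E; move: (x - n.+1%:R) xn0 E => y y0 E.
have ry0 : ratr y != 0 :> R by rewrite fmorph_eq0.
by apply: (mulfI ry0); rewrite -E rmorphM/= fmorphV !mulrA divff// mul1r.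
Qed.

Lemma pt120 : pt 120 = 1. Proof. by rewrite /pt /pt_of divff. Qed.

Lemma pt_of_decomp (N j : nat) (x : rat) (m : int) : (0 < N)%N ->
  N%:R * x = (m * N%:Z + j%:Z)%:~R -> x = pt_of N j + m%:~R.
Proof.
move=> N0 E; have n0 : N%:R != 0 :> rat by rewrite pnatr_eq0 -lt0n.
apply: (mulfI n0); rewrite E rmorphD rmorphM/= mulrDr addrC /pt_of mulrCA divff//.
by rewrite mulr1 [in RHS]mulrC.
Qed.

(** The representative is taken in ]0, 1] instead of [0, 1[, so that integers
are represented by 1, where standard solutions are normalized. *)
Lemma reduce_to_unit (x : rat) : gamma_dom x -> 120 * x \is a Num.int ->
  exists (j : nat) (q : rat), [/\ (0 < j <= 120)%N, q != 0 &
    forall G, std G -> G x = ratr q * G (pt j)].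
Proof.
move=> xd /intrP[z zE].
have e : 120%:R * x = z%:~R by [].
have n120 : 120%:R != 0 :> rat by rewrite pnatr_eq0.
have [m [j [j120 zj]]] : exists (m : int) (j : nat), (0 < j <= 120)%N /\ z = m * 120%:Z + j%:Z.
  exists ((z - 1) %/ 120)%Z, (`|((z - 1) %% 120)%Z|%N).+1.
  by split; lia.
have xE : x = pt j + m%:~R.
  by rewrite zj in e; exact: (pt_of_decomp 120 j x m isT e).
have /andP[j0 j1] := j120.
case: m zj xE => [n _ ->|n _ xE].
  have [q [q0 H]] := shift_up (pt j) n (pt_gt0 _ j0).
  by exists j, q; split.
move: j1; rewrite leq_eqVlt => /predU1P[j1|j1].
  move: xd; rewrite /gamma_dom xE j1 pt120 NegzE rmorphN/= opprD opprK.
  have -> : - 1 + n.+1%:R = n%:R :> rat by rewrite -natr1; ring.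
  by rewrite natr_nat.
have jn := pt_notint j; rewrite j0 j1 in jn.
have [q [q0 H]] := shift_down (pt j) n.+1 (jn isT).
by exists j, q; split=> [//|//|G sG]; rewrite xE NegzE rmorphN/= (H G sG).
Qed.

Lemma gamma_values_120 (x : rat) : gamma_dom x -> 120 * x \is a Num.int ->
  exists (alpha : R) (r : rat) (m : rat -> rat),
    alpha != 0 /\ alg alpha /\
    (forall G : rat -> R, std G ->
       G x = alpha * pi `^ ratr r *
             \prod_(y <- setB ++ setE) G y `^ ratr (m y)).
Proof.
move=> xd xi; have [j [q [j120 q0 H]]] := reduce_to_unit x xd xi.
move=> {xd xi}; have /andP[j0 j1] := j120.
have rq0 : ratr q != 0 :> R by rewrite fmorph_eq0.
move: j1; rewrite leq_eqVlt => /predU1P[j1|j1].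
  exists (ratr q), 0, (fun=> 0); split; first exact: rq0.
  split; first exact: algebraic_ratr.
  move=> G sG; rewrite (H G sG) j1 pt120; have [_ [_ [-> _]]] := sG.
  by rewrite rmorph0 powRr0 big1 ?mulr1// => y _; rewrite powRr0.
have [a [r [m [a0 aa Ha]]]] : expressible (lnv j) by apply: lnv_expressible; rewrite j0.
exists (ratr q * a), r, m; split; first by rewrite mulf_neq0// gt_eqF.
split; first by apply: algebraic_mul => //; exact: algebraic_ratr.
move=> G sG; rewrite (H G sG) -(mulrA (ratr q * a)) -(mulrA (ratr q)); congr (_ * _).
have Gj := std_gt0 R G j sG j0.
have Hj : ln (G (pt j)) = _ := Ha G sG.
rewrite -[LHS](lnK Gj) Hj !expRD (lnK a0) -(mulrA a); congr (_ * (_ * _)).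
  by rewrite /powR gt_eqF ?pi_gt0.
rewrite expR_sum big_seq [RHS]big_seq; apply: eq_bigr => y yB.
have y0 : 0 < G y by have [_ [Gp _]] := sG; apply: Gp; exact: (allP basis_gt0).
by rewrite /powR gt_eqF.
Qed.

End Elimination.

(** * Odd distributions on Q/Z *)

Section Distributions.
Local Set Implicit Arguments.
Local Unset Strict Implicit.

(** These are the functions that may be added to the logarithm of a standard
solution: the three conditions are the homogeneous forms of the difference
equation, of the reflection formula and of the multiplication formula. *)
Definition odd_distribution (V : zmodType) (h : rat -> V) : Prop :=
  [/\ forall x, h (x + 1) = h x, forall x, h (- x) = - h x &
      forall (n : nat) x, (0 < n)%N -> \sum_(k < n) h (x + k%:R / n%:R) = h (n%:R * x)].

Lemma odd_distribution_sum (R : pzRingType) (I : eqType) (s : seq I) (c : I -> R)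
    (f : I -> rat -> R) :
  (forall i, i \in s -> odd_distribution (f i)) ->
  odd_distribution (fun x => \sum_(i <- s) c i * f i x).
Proof.
move=> fi; split=> [x|x|n x n0].
- by apply: eq_big_seq => i /fi[-> _ _].
- by rewrite -sumrN; apply: eq_big_seq => i /fi[_ -> _]; rewrite mulrN.
- rewrite exchange_big/=; apply: eq_big_seq => i /fi[_ _ <-//].
  by rewrite mulr_sumr.
Qed.

Lemma odd_distribution_ratr (R : realType) (h : rat -> rat) :
  odd_distribution h -> odd_distribution (fun x => ratr (h x) : R).
Proof.
case=> h1 h2 h3; split=> [x|x|n x n0]; first by rewrite h1.
  by rewrite h2 rmorphN.
by rewrite -h3// rmorph_sum.
Qed.

Section Sawtooth.
Local Notation floor := Num.floor.

Lemma floorDz (x : rat) (m : int) : floor (x + m%:~R) = floor x + m.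
Proof. by rewrite floorDrz ?intr_int// intrKfloor. Qed.

(** The difference of the two sides is 1/n-periodic, and both sides vanish on
[0, 1/n[. *)
Lemma hermite_identity n (x : rat) : (0 < n)%N ->
  \sum_(k < n) floor (x + k%:R / n%:R) = floor (n%:R * x).
Proof.
move=> n0; have nR : 0 < n%:R :> rat by rewrite ltr0n.
have nN0 : n%:R != 0 :> rat by rewrite gt_eqF.
pose F (x : rat) : int := \sum_(k < n) floor (x + k%:R / n%:R) - floor (n%:R * x).
suff : F x = 0 by move/eqP; rewrite subr_eq0 => /eqP.
have step (y : rat) : F (y + n%:R^-1) = F y.
  rewrite /F mulrDr divff// -[1]/(1%:~R) floorDz opprD addrA.
  pose f (k : nat) := floor (y + k%:R / n%:R).
  have -> : \sum_(k < n) floor (y + n%:R^-1 + k%:R / n%:R) = \sum_(k < n) f k.+1.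
    by apply: eq_bigr => k _; rewrite /f -natr1 mulrDl mul1r [_ / _ + _]addrC addrA.
  have fn : f n = f 0%N + 1 by rewrite /f divff// mul0r addr0 -[1 in LHS]/(1%:~R) floorDz.
  rewrite -(big_mkord xpredT (fun k => f k.+1)) -(big_mkord xpredT f).
  case: (n) n0 fn => // m _ fn.
  rewrite big_nat_recr//= big_nat_recl//= fn; ring.
have zstep (m : int) (y : rat) : F (y + m%:~R / n%:R) = F y.
  have nstep (p : nat) (z : rat) : F (z + p%:R / n%:R) = F z.
    by elim: p => [|p IH]; rewrite ?mul0r ?addr0// -natr1 mulrDl mul1r addrA step.
  case: m => p; first exact: nstep.
  by rewrite NegzE rmorphN/= mulNr -[RHS](nstep p.+1 y) -(nstep p.+1 (_ - _)) subrK nstep.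
pose y := x - (floor (n%:R * x))%:~R / n%:R.
have -> : x = y + (floor (n%:R * x))%:~R / n%:R by rewrite subrK.
rewrite zstep.
have nyE : n%:R * y = n%:R * x - (floor (n%:R * x))%:~R.
  by rewrite mulrBr mulrCA divff// mulr1.
have ny0 : 0 <= n%:R * y by rewrite nyE subr_ge0 floor_le.
have ny1 : n%:R * y < 1.
  by rewrite nyE ltrBlDl; have := floorD1_gt (n%:R * x); rewrite rmorphD.
have y0 : 0 <= y by rewrite -(pmulr_rge0 _ nR).
have floor0 (z : rat) : 0 <= z -> z < 1 -> floor z = 0.
  by move=> z0 z1; apply: floor_def; rewrite z0 add0r.
rewrite /F (floor0 (_ * _))// subr0 big1// => k _; apply: floor0.
  by rewrite addr_ge0// divr_ge0.
rewrite -(ltr_pM2l nR) mulr1 mulrDr mulrCA divff// mulr1.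
apply: (@lt_le_trans _ _ (1 + k%:R)); first by rewrite ltrD2r.
by rewrite nat1r ler_nat.
Qed.

(** This is x - 1/2 on ]0, 1[, extended by periodicity with the value 0 at
integers, that is, the first Bernoulli function; averaging floor and ceiling
makes it odd everywhere. *)
Definition saw (x : rat) : rat := x - ((floor x)%:~R - (floor (- x))%:~R) / 2.

Lemma saw_addz x (m : int) : saw (x + m%:~R) = saw x.
Proof.
have fN : floor (- x - m%:~R) = floor (- x) - m by rewrite -floorDz rmorphN.
rewrite /saw opprD fN floorDz !rmorphD rmorphN/=.
by move: (floor x)%:~R (floor (- x))%:~R m%:~R => a b c; field.
Qed.

Lemma saw_odd_distribution : odd_distribution saw.
Proof.
split=> [x|x|n x n0]; first by rewrite -[1]/(1%:~R) saw_addz.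
  by rewrite /saw opprK; move: (floor x)%:~R (floor _)%:~R => a b; field.
have nN0 : n%:R != 0 :> rat by rewrite pnatr_eq0 -lt0n.
have sum_nat : \sum_(k < n) (k%:R : rat) = n%:R * (n%:R - 1) / 2.
  elim: (n) => [|m IH]; first by rewrite big_ord0 mul0r.
  by rewrite big_ord_recr/= IH -[m.+1%:R]natr1; move: (m%:R : rat) => a; field.
have floorN : \sum_(k < n) floor (- (x + k%:R / n%:R)) = floor (- (n%:R * x)) + 1 - n%:Z.
  transitivity (\sum_(k < n) floor ((n%:R^-1 - x - 1) + k%:R / n%:R)).
    rewrite (reindex_inj rev_ord_inj)/=; apply: eq_bigr => k _; congr floor.
    rewrite natrB//= mulrBl divff// -natr1 mulrDl mul1r; ring.
  rewrite hermite_identity//.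
  have -> : n%:R * (n%:R^-1 - x - 1) = - (n%:R * x) + (1 - n%:Z)%:~R :> rat.
    by rewrite !mulrBr divff// rmorphB/=; ring.
  by rewrite floorDz addrA.
rewrite /saw sumrB -mulr_suml sumrB -!rmorph_sum/= hermite_identity// floorN.
rewrite big_split/= sumr_const card_ord -mulr_suml sum_nat !rmorphD/= rmorphN/=.
move: (floor (_ * _))%:~R (floor (- _))%:~R => a b.
rewrite -[x *+ n]mulr_natl -[n%:Z%:~R]/(n%:R) -[1%:~R]/(1).
by move: (n%:R : rat) nN0 => N N0; field.
Qed.

(** Multiplication by c permutes the residues modulo n. *)
Lemma saw_coprime c n x : (0 < n)%N -> coprime c n ->
  \sum_(k < n) saw (x + c%:R * (k%:R / n%:R)) = saw (n%:R * x).
Proof.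
move=> n0 cn; have [_ _ <-//] := saw_odd_distribution.
have nN0 : n%:R != 0 :> rat by rewrite pnatr_eq0 -lt0n.
pose f (k : 'I_n) : 'I_n := Ordinal (ltn_pmod (c * k) n0).
have f_inj : injective f.
  have key (i j : 'I_n) : (i <= j)%N -> c * i = c * j %[mod n] -> i = j.
    move=> ij /esym/eqP; rewrite eqn_mod_dvd ?leq_mul2l ?ij ?orbT//.
    rewrite -mulnBr Gauss_dvdr 1?coprime_sym// => d; apply/val_inj/eqP => /=.
    rewrite eqn_leq ij /= -subn_eq0; apply/eqP; case: (j - i)%N (leq_subr i j) d => // m mj.
    by move/dvdn_leq => /(_ isT); rewrite leqNgt (leq_ltn_trans mj).
  move=> i j /(congr1 val)/= ij; have [le|le] := leqP i j; first exact: key.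
  by apply/esym/key => //; rewrite ltnW.
rewrite [RHS](reindex_inj f_inj)/=; apply: eq_bigr => k _.
have -> : c%:R * (k%:R / n%:R) = ((c * k) %% n)%:R / n%:R + ((c * k) %/ n)%:Z%:~R :> rat.
  by rewrite mulrA -natrM {1}(divn_eq (c * k) n) natrD natrM mulrDl mulfK// addrC.
by rewrite addrA saw_addz.
Qed.

Lemma saw_frac (N b : nat) : (0 < N)%N -> ~~ (N %| b)%N ->
  saw (b%:R / N%:R) = ((b %% N).*2%:Z - N%:Z)%:~R / N.*2%:R.
Proof.
move=> N0 Nb; have NR : 0 < N%:R :> rat by rewrite ltr0n.
have -> : b%:R / N%:R = (b %% N)%:R / N%:R + (b %/ N)%:Z%:~R :> rat.
  by rewrite {1}(divn_eq b N) natrD natrM mulrDl mulfK ?gt_eqF// addrC.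
have r0 : (0 < b %% N)%N by rewrite lt0n.
rewrite saw_addz /saw; move: (b %% N)%N (ltn_pmod b N0) r0 => r rN r0.
have q0 : 0 < r%:R / N%:R :> rat by rewrite divr_gt0 ?ltr0n.
have q1 : r%:R / N%:R < 1 :> rat by rewrite ltr_pdivrMr// mul1r ltr_nat.
rewrite (_ : floor (r%:R / N%:R) = 0); last by apply: floor_def; rewrite (ltW q0) add0r.
rewrite (_ : floor (- _) = -1); last first.
  by apply: floor_def; rewrite addNr oppr_lt0 q0 rmorphN/= lerN2 ltW.
rewrite rmorphB rmorphN/= -!mul2n !PoszM -!pmulrn !natrM.
by move: (N%:R : rat) NR (r%:R : rat) => M M0 s; field; rewrite gt_eqF.
Qed.

Section Twist.
Context (pi : nat_pred) (u : nat) (pi_u : pi^'.-nat u).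

(** The automorphism of Q/Z that multiplies the pi-primary part by u and is the
identity on the rest is multiplication by this integer on the M-torsion. *)
Definition twist_mult (M : nat) : nat := chinese M`_pi M`_pi^' u 1.

(** The sawtooth composed with that automorphism; the denominator of x is the
smallest level at which the multiplier can be taken. *)
Definition twisted_saw (x : rat) : rat := saw ((twist_mult `|denq x|)%:R * x).

(** Being prime to M, the multiplier permutes the fibres of multiplication by
divisors of M; this is what the distribution relation needs. *)
Lemma twist_mult_coprime M : (0 < M)%N -> coprime (twist_mult M) M.
Proof.
move=> M0; rewrite -{2}(partnC pi M0) coprimeMr; apply/andP; split.
  rewrite -coprime_modl chinese_modl ?coprime_partC// coprime_modl.
  by rewrite coprime_sym (pnat_coprime (part_pnat _ _)).
by rewrite -coprime_modl chinese_modr ?coprime_partC// coprime_modl coprime1n.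
Qed.

Lemma twist_mult_dvd N M : (0 < M)%N -> (N %| M)%N -> twist_mult M = twist_mult N %[mod N].
Proof.
move=> M0 NM; have N0 : (0 < N)%N by exact: dvdn_gt0 NM.
apply/eqP; rewrite -{1 3}(partnC pi N0) chinese_remainder ?coprime_partC//.
rewrite chinese_modl ?coprime_partC// chinese_modr ?coprime_partC//.
have dl := partn_dvd pi M0 NM; have dr := partn_dvd pi^' M0 NM.
rewrite -(modn_dvdm _ dl) chinese_modl ?coprime_partC// modn_dvdm// eqxx.
by rewrite -(modn_dvdm _ dr) chinese_modr ?coprime_partC// modn_dvdm// eqxx.
Qed.

Lemma saw_mul_eqmod (a b N : nat) (x : rat) : N%:R * x \is a Num.int ->
  a = b %[mod N] -> saw (a%:R * x) = saw (b%:R * x).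
Proof.
move=> /intrP[m Nx] ab.
rewrite (divn_eq a N) (divn_eq b N) ab !natrD !natrM !mulrDl -!mulrA Nx.
by rewrite ![_%:R * m%:~R + _]addrC !pmulrn -!intrM !saw_addz.
Qed.

Lemma denq_dvd (M : nat) (x : rat) : M%:R * x \is a Num.int -> (`|denq x| %| M)%N.
Proof.
move=> /intrP[m Mx]; have co := coprime_num_den x.
rewrite -(@Gauss_dvdl _ _ `|numq x|%N) 1?coprime_sym//.
have E : M%:Z * numq x = m * denq x.
  apply: (@intr_inj rat); rewrite !intrM numqE mulrA -Mx //.
by move: (congr1 absz E); rewrite !abszM absz_nat => ->; rewrite dvdn_mull.
Qed.

(** Any level M that kills x modulo 1 may be used, since the multipliers of the
different levels are congruent. *)
Lemma twisted_sawE (M : nat) (x : rat) : (0 < M)%N -> M%:R * x \is a Num.int ->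
  twisted_saw x = saw ((twist_mult M)%:R * x).
Proof.
move=> M0 Mx; apply/esym/(@saw_mul_eqmod _ _ `|denq x|).
  by rewrite natr_absz normr_denq mulrC -numqE intr_int.
exact/twist_mult_dvd/denq_dvd.
Qed.

(** At a common level all the points involved are multiplied by the same integer
prime to n, and [saw_coprime] applies. *)
Lemma twisted_saw_odd_distribution : odd_distribution twisted_saw.
Proof.
have [s1 s2 _] := saw_odd_distribution.
have level (x : rat) : exists2 M, (0 < M)%N & M%:R * x \is a Num.int.
  exists `|denq x|%N; first by rewrite absz_gt0 denq_neq0.
  by rewrite natr_absz normr_denq mulrC -numqE intr_int.
split=> [x|x|n x n0]; have [M M0 Mx] := level x.
- rewrite !(twisted_sawE M0)//; last by rewrite mulrDr mulr1 rpredD ?natr_int.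
  by rewrite mulrDr mulr1 [X in _ + X]pmulrn saw_addz.
- by rewrite !(twisted_sawE M0) ?mulrN ?rpredN// s2.
have nM0 : (0 < n * M)%N by rewrite muln_gt0 n0.
have nN0 : n%:R != 0 :> rat by rewrite pnatr_eq0 -lt0n.
have co : coprime (twist_mult (n * M)) n.
  by have := twist_mult_coprime nM0; rewrite coprimeMr => /andP[].
have nMx : (n * M)%:R * x \is a Num.int by rewrite natrM -mulrA rpredM ?natr_int.
rewrite (twisted_sawE nM0); last by rewrite mulrCA rpredM ?natr_int.
rewrite mulrCA -(saw_coprime _ n0 co); apply: eq_bigr => k _.
rewrite (twisted_sawE nM0) ?mulrDr// rpredD//.
have -> : (n * M)%:R * (k%:R / n%:R) = (M * k)%:R :> rat by rewrite !natrM; field.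
exact: natr_int.
Qed.

Lemma twisted_saw_frac (N a : nat) : (0 < N)%N -> pi.-nat N -> ~~ (N %| u * a)%N ->
  twisted_saw (a%:R / N%:R) = ((u * a %% N).*2%:Z - N%:Z)%:~R / N.*2%:R.
Proof.
move=> N0 piN Na; have NR : N%:R != 0 :> rat by rewrite pnatr_eq0 -lt0n.
have Nx : N%:R * (a%:R / N%:R : rat) \is a Num.int by rewrite mulrC mulfVK// natr_int.
rewrite (twisted_sawE N0)// (saw_mul_eqmod (b := u) Nx); last first.
  have := chinese_modl (coprime_partC pi N N) u 1.
  by rewrite {2 3}(part_pnat_id piN).
by rewrite mulrA -natrM saw_frac.
Qed.

End Twist.
End Sawtooth.

End Distributions.

(** * Twisting the gamma function by an odd distribution *)

Section StandardSolutions.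
Context (R : realType).

Lemma sin_pi_notint_neq0 (x : rat) : x \isn't a Num.int -> sin (pi * ratr x) != 0 :> R.
Proof.
move=> xi; pose f := x - (Num.floor x)%:~R.
have fi : f \isn't a Num.int.
  by apply: contra xi => h; rewrite -(subrK (Num.floor x)%:~R x) rpredD// intr_int.
have /andP[f0 f1] : 0 < f < 1.
  have /andP[h1 h2] := floor_itv x; rewrite rmorphD/= in h2.
  rewrite /f ltrBlDl h2 andbT subr_gt0 lt_neqAle h1 andbT.
  by apply: contraNneq fi => fl; rewrite /f fl subrr; exact: rpred0.
have fs : sin (pi * ratr f) != 0 :> R.
  rewrite gt_eqF// sin_gt0_pi// mulr_gt0 ?pi_gt0 ?ltr0q//=.
  by rewrite gtr_pMr ?pi_gt0// -(rmorph1 (@ratr R)) ltr_rat.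
have step (y : R) : (sin (pi * (y + 1)) == 0) = (sin (pi * y) == 0).
  by rewrite mulrDr mulr1 sinDpi oppr_eq0.
have nat_step n (y : R) : (sin (pi * (y + n%:R)) == 0) = (sin (pi * y) == 0).
  elim: n => [|n IH]; first by rewrite addr0.
  by rewrite -natr1 addrA step.
have xE : x = f + (Num.floor x)%:~R by rewrite /f subrK.
move: xE fs; move: f (Num.floor x) {fi f0 f1} => f m -> fs.
rewrite rmorphD/= ratr_int; case: m => n; first by rewrite nat_step.
by rewrite NegzE rmorphN/= -(nat_step n.+1 (_ - _)) subrK.
Qed.

Context (G : R -> R) (HG : gamma_like R G).

(** The reflection formula forces the values at nonpositive arguments. *)
Definition gamma_ext (x : R) : R :=
  if 0 < x then G x else pi / (sin (pi * x) * G (1 - x)).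

Lemma gamma_ext_pos x : 0 < x -> gamma_ext x = G x.
Proof. by rewrite /gamma_ext => ->. Qed.

(** The formula chosen for x <= 0 persists on ]0, 1[, by the reflection formula
itself; so both pieces of the definition agree on an overlap. *)
Lemma gamma_ext_lt1 x : x < 1 -> sin (pi * x) != 0 ->
  gamma_ext x = pi / (sin (pi * x) * G (1 - x)).
Proof.
move=> x1 sx; rewrite /gamma_ext; case: ifPn => // x0.
have g0 : G (1 - x) != 0 by rewrite gt_eqF// (gamma_pos G HG)// subr_gt0.
rewrite invfM mulrA -(gamma_reflection G HG); last by rewrite x0 x1.
by rewrite mulfK.
Qed.

Lemma gamma_ext_neq0 x : 0 < x \/ sin (pi * x) != 0 -> gamma_ext x != 0.
Proof.
rewrite /gamma_ext; case: ifPn => [x0 _|x0 [//|sx]]; first by rewrite gt_eqF// (gamma_pos G HG).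
have g0 : G (1 - x) != 0.
  by rewrite gt_eqF// (gamma_pos G HG)// subr_gt0 (le_lt_trans _ ltr01)// leNgt.
by rewrite mulf_neq0 ?invr_eq0 ?mulf_neq0// gt_eqF// pi_gt0.
Qed.

Lemma gamma_ext_add1 x : 0 < x \/ sin (pi * x) != 0 ->
  gamma_ext (x + 1) = x * gamma_ext x.
Proof.
have [x0 _|x0 [//|sx]] := ltP 0 x.
  by rewrite !gamma_ext_pos ?addr_gt0// (gamma_add1 G HG).
have sx1 : sin (pi * (x + 1)) = - sin (pi * x) by rewrite mulrDr mulr1 sinDpi.
have x1 : x < 1 by rewrite (le_lt_trans x0).
have xn : x != 0 by apply: contraNneq sx => ->; rewrite mulr0 sin0.
have x0' : 0 < - x by rewrite oppr_gt0 lt_neqAle xn.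
rewrite gamma_ext_lt1 ?sx1 ?oppr_eq0//; last by rewrite -ltrBrDr subrr -oppr_gt0.
rewrite gamma_ext_lt1//.
have -> : 1 - x = - x + 1 by ring.
have -> : 1 - (x + 1) = - x by ring.
rewrite (gamma_add1 G HG)//.
have g0 : G (- x) != 0 by rewrite gt_eqF// (gamma_pos G HG).
by move: (pi : R) (sin _) sx (G _) g0 => p s s0 g g0; field; rewrite xn s0 g0.
Qed.

Lemma gamma_ext_reflection x : sin (pi * x) != 0 ->
  gamma_ext x * gamma_ext (1 - x) = pi / sin (pi * x).
Proof.
have key y : y < 1 -> sin (pi * y) != 0 ->
    gamma_ext y * gamma_ext (1 - y) = pi / sin (pi * y).
  move=> y1 sy; rewrite gamma_ext_lt1// gamma_ext_pos ?subr_gt0//.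
  have g0 : G (1 - y) != 0 by rewrite gt_eqF// (gamma_pos G HG)// subr_gt0.
  by rewrite invfM mulrA mulfVK.
move=> sx; have [x1|x1] := ltP x 1; first exact: key.
have sE : sin (pi * (1 - x)) = sin (pi * x).
  by rewrite mulrBr mulr1 addrC sinDpi sinN opprK.
have xn : x != 1 by apply: contraNneq sx => ->; rewrite mulr1 sinpi.
rewrite mulrC -{2}(subKr 1 x) key ?sE// ltrBlDr ltrDl.
by rewrite (lt_le_trans ltr01).
Qed.

Context (h : rat -> R) (Hh : odd_distribution h).

Definition twisted_gamma (x : rat) : R := gamma_ext (ratr x) * expR (h x).

Let dom_cases (x : rat) : gamma_dom x ->
  0 < (ratr x : R) \/ sin (pi * ratr x) != 0 :> R.
Proof.
move=> xd; have [xi|xi] := boolP (x \is a Num.int); last first.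
  by right; exact: sin_pi_notint_neq0.
left; rewrite ltr0q; case/intrP: xi xd => -[n ->|n ->]; rewrite /gamma_dom.
  case: n => [|n _]; last by rewrite ltr0z.
  by rewrite oppr0 rpred0.
by move/negP=> []; rewrite NegzE rmorphN/= opprK; exact: natr_nat.
Qed.

(** For positive x this is the multiplication formula for G.  Replacing x + 1/n by
x divides both sides by x, by the difference equation, so the formula descends
to all admissible x. *)
Lemma twisted_gamma_multiplication n x : (0 < n)%N -> gamma_dom (n%:R * x) ->
  \prod_(k < n) twisted_gamma (x + k%:R / n%:R) =
  n%:R `^ (1 / 2 - n%:R * ratr x) * (2 * pi) `^ ((n%:R - 1) / 2) *
  twisted_gamma (n%:R * x).
Proof.
move=> n0; have nR0 : n%:R != 0 :> rat by rewrite pnatr_eq0 -lt0n.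
have nR : 0 < n%:R :> R by rewrite ltr0n.
have [_ _ hn] := Hh.
have dom_pos y : 0 < n%:R * y -> \prod_(k < n) gamma_ext (ratr (y + k%:R / n%:R)) =
    n%:R `^ (1 / 2 - n%:R * ratr y) * (2 * pi) `^ ((n%:R - 1) / 2) *
    gamma_ext (ratr (n%:R * y)).
  rewrite pmulr_rgt0 ?ltr0n// => y0.
  have y0R : 0 < ratr y :> R by rewrite ltr0q.
  rewrite rmorphM/= ratr_nat (gamma_ext_pos _ (mulr_gt0 nR y0R)).
  rewrite -(gamma_multiplication G HG)//; apply: eq_bigr => k _.
  rewrite rmorphD/= fmorph_div/= !ratr_nat gamma_ext_pos//.
  by rewrite ltr_wpDr// divr_ge0.
have desc y : gamma_dom (n%:R * y) -> \prod_(k < n) gamma_ext (ratr (y + n%:R^-1 + k%:R / n%:R)) =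
    n%:R `^ (1 / 2 - n%:R * ratr (y + n%:R^-1)) * (2 * pi) `^ ((n%:R - 1) / 2) *
    gamma_ext (ratr (n%:R * (y + n%:R^-1))) ->
    \prod_(k < n) gamma_ext (ratr (y + k%:R / n%:R)) =
    n%:R `^ (1 / 2 - n%:R * ratr y) * (2 * pi) `^ ((n%:R - 1) / 2) *
    gamma_ext (ratr (n%:R * y)).
  move=> yd; have yd0 : gamma_dom y.
    apply: contra yd => yn; by rewrite -mulrN rpredM// natr_nat.
  have y0 : y != 0 by apply: contraNneq yd0 => ->; rewrite oppr0 rpred0.
  have yR0 : ratr y != 0 :> R by rewrite fmorph_eq0.
  have shift : \prod_(k < n) gamma_ext (ratr (y + n%:R^-1 + k%:R / n%:R)) =
      ratr y * \prod_(k < n) gamma_ext (ratr (y + k%:R / n%:R)).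
    pose f (k : nat) := gamma_ext (ratr (y + k%:R / n%:R)).
    have -> : \prod_(k < n) gamma_ext (ratr (y + n%:R^-1 + k%:R / n%:R)) =
        \prod_(k < n) f k.+1.
      apply: eq_bigr => k _; rewrite /f; congr (gamma_ext (ratr _)).
      by rewrite -natr1 mulrDl mul1r [_ / _ + _]addrC addrA.
    have fn : f n = ratr y * f 0%N.
      rewrite /f divff// mul0r addr0 rmorphD/= rmorph1 gamma_ext_add1//.
      exact: dom_cases.
    rewrite -(big_mkord xpredT (fun k => f k.+1)) -(big_mkord xpredT f).
    case: (n) n0 fn => // m _ fn.
    by rewrite big_nat_recr//= big_nat_recl//= fn mulrC mulrA.
  have nyE : n%:R * (y + n%:R^-1) = n%:R * y + 1 by rewrite mulrDr divff.
  rewrite shift nyE [ratr (_ * y + 1)]rmorphD/= rmorph1.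
  rewrite gamma_ext_add1; last exact: dom_cases.
  rewrite [ratr (n%:R * y)]rmorphM/= ratr_nat rmorphD/= fmorphV/= ratr_nat mulrDr divff ?gt_eqF//.
  rewrite opprD addrA powRB; last by rewrite (gt_eqF nR) implybT.
  rewrite powRr1 ?(ltW nR)//.
  move=> H; apply: (mulfI yR0); rewrite H.
  move: (_ `^ (_ - _)) (_ `^ (_ / 2)) (gamma_ext (_ * _)) => a b c.
  by field; rewrite gt_eqF.
move=> xd; rewrite /twisted_gamma big_split/= -expR_sum hn// mulrA.
congr (_ * _).
have [m] : exists m : nat, 0 < n%:R * x + m%:R.
  have [m hm] : exists m : nat, - (n%:R * x) < m%:R.
    exists (Num.bound `|n%:R * x|); rewrite (le_lt_trans (ler_norm _))// normrN.
    by rewrite archi_boundP.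
  by exists m; rewrite -ltrBlDl sub0r.
elim: m x xd => [|m IH] x xd; first by rewrite addr0 => /dom_pos.
move=> xm; apply: desc => //.
have [xp|xp] := ltP 0 (n%:R * x + 1).
  by apply: dom_pos; rewrite mulrDr divff.
apply: IH; last by rewrite mulrDr divff// -addrA nat1r.
rewrite mulrDr divff//; apply: contra xd => hx.
by rewrite -[- _](subrK 1) -opprD rpredD// rpred1.
Qed.

Lemma twisted_gamma_standard : standard_solution twisted_gamma.
Proof.
have [h1 hN hn] := Hh.
have h0 : h 0 = 0.
  have := hN 0; rewrite oppr0 => /eqP; rewrite -addr_eq0 -mulr2n mulrn_eq0/=.
  by move/eqP.
split; [|split; [|split; [|split; [|split]]]].
- by move=> x /dom_cases xd; rewrite mulf_neq0 ?gamma_ext_neq0// gt_eqF ?expR_gt0.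
- move=> x x0; rewrite mulr_gt0 ?expR_gt0// gamma_ext_pos ?(gamma_pos G HG)//.
  + by rewrite ltr0q.
  + by rewrite ltr0q.
- rewrite /twisted_gamma -(add0r 1) h1 h0 expR0 mulr1 add0r rmorph1.
  by rewrite gamma_ext_pos//; case: HG.
- move=> x /dom_cases xd.
  by rewrite /twisted_gamma rmorphD/= rmorph1 gamma_ext_add1// h1 mulrA.
- move=> x xi; have sx := sin_pi_notint_neq0 _ xi.
  rewrite /twisted_gamma mulrACA rmorphB/= rmorph1 gamma_ext_reflection//.
  by rewrite -expRD [1 - x]addrC h1 hN subrr expR0 mulr1.
- exact: twisted_gamma_multiplication.
Qed.

End StandardSolutions.

(** * Interpolation at the basis points *)

(** Representatives of the units modulo 120 up to sign; as the distributions are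
odd, the sign does not matter. *)
Definition unit_residues : seq nat :=
  [:: 1; 7; 11; 13; 17; 19; 23; 29; 31; 37; 41; 43; 47; 49; 53; 59]%N.

(** Row k of 960 times the inverse of the matrix with entries
2 (u b mod 120) - 120, where u is a unit residue and b a basis point. *)
Definition dual_weights (k : nat) : seq int :=
  match k with
  | 40%N => [:: -1; -1; 3; -3; 1; 1; 1; 3; -1; -3; 1; -3; 1; -1; 3; -1]
  | 30%N => [:: -2; 0; 4; -2; -4; 4; 0; 0; 2; -2; 2; -2; 0; 2; -2; 0]
  | 24%N => [:: 1; 1; -3; -1; 3; -1; 3; 1; -3; -1; -5; 3; -1; 1; 1; 1]
  | 48%N => [:: -2; 2; 2; -2; -2; 2; -2; 2; -2; 2; 2; -2; 2; 2; -2; -2]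
  | 15%N => [:: 3; 3; -5; 1; 5; -7; 1; -1; -1; 1; -7; 5; 1; -5; 3; 3]
  | 8%N => [:: -1; 1; 1; 1; -1; -1; -1; 1; -1; 1; 1; 1; -1; -1; -1; 1]
  | 6%N => [:: 1; -1; -1; 3; 1; 1; -3; -1; 1; -1; -1; -1; 1; -3; 1; 3]
  | 5%N => [:: -1; -1; -1; 1; 1; 1; 1; -1; -1; 1; 1; 1; 1; -1; -1; -1]
  | 2%N => [:: 1; -1; -1; -1; 1; -3; 1; -1; 1; 3; -1; 3; 1; 1; 1; 3]
  | 14%N => [:: 0; 2; -2; 0; 2; -2; 2; -2; 0; 0; 0; 0; -2; 0; 0; 2]
  | 3%N => [:: -2; -2; 2; -2; -2; 2; 2; 2; 2; 2; 2; -2; -2; 2; -2; -2]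
  | 9%N => [:: -4; 0; 4; 0; -4; 4; 0; 0; 0; 0; 4; -4; 0; 4; 0; -4]
  | 21%N => [:: 2; 2; -2; -2; 6; -6; 2; -2; -2; 2; -6; 6; -2; -2; 2; 2]
  | 1%N => [:: -1; -1; -1; 1; -3; 1; -3; -1; -1; -3; 1; -3; 1; -1; -1; -1]
  | 7%N => [:: -2; -2; 2; 2; -2; 2; -2; 2; 2; -2; 2; -2; 2; 2; -2; -2]
  | 11%N => [:: -3; 1; 1; -1; -1; 3; -1; 1; 1; -1; 3; -1; -1; 1; 1; -3]
  | _ => [::]
  end.

Definition dual_pairing (N a b : nat) : int :=
  \sum_(uw <- zip unit_residues (dual_weights a))
    uw.2 * ((uw.1 * b %% N).*2%:Z - N%:Z).

(** That the weights invert the matrix, together with the arithmetic facts that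
relate the matrix to values of twisted sawtooths; a boolean, to be evaluated
once at N = 120. *)
Definition dual_at (N : nat) : bool :=
  all (fun a => all (fun b =>
    foldr (fun uw s => uw.2 * ((uw.1 * b %% N).*2%:Z - N%:Z) + s) 0
      (zip unit_residues (dual_weights a)) ==
    if a == b then (8 * N)%:Z else 0) basis_points) basis_points
  && all (coprime N) unit_residues && all (fun b => (0 < b < N)%N) basis_points.

Lemma dual_at_120 : dual_at 120.
Proof. by vm_compute. Qed.

Lemma basis_points_uniq : uniq basis_points.
Proof. by vm_compute. Qed.

Lemma setBE_points : all (fun y => has (fun a => y == pt a) basis_points) (setB ++ setE).
Proof. by vm_compute. Qed.

Lemma mem_zip1 (S T : eqType) (s : seq S) (t : seq T) p : p \in zip s t -> p.1 \in s.
Proof.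
elim: s t => [|x s IH] [|y t]//=; rewrite !inE => /orP[/eqP->|/IH->]; first by rewrite eqxx.
by rewrite orbT.
Qed.

Section Interpolation.
Context (R : realType) (N : nat) (N0 : (0 < N)%N) (dualN : dual_at N).

(** The factor 1/4: the sawtooth at b/N is (2 (b mod N) - N) / (2 N), and the
weights are normalized to 8 N. *)
Definition dual_distribution (a : nat) (x : rat) : R :=
  \sum_(uw <- zip unit_residues (dual_weights a))
    uw.2%:~R / 4 * ratr (twisted_saw \pi(N) uw.1 x).

Let unitN a uw : uw \in zip unit_residues (dual_weights a) -> coprime N uw.1.
Proof.
have [/andP[_ /allP co] _] := andP dualN => uwz; apply: co.
exact: mem_zip1 uwz.
Qed.

Let unit_pi a uw : uw \in zip unit_residues (dual_weights a) -> \pi(N)^'.-nat uw.1.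
Proof.
move=> uwz; rewrite -coprime_pi' ?(unitN a uw uwz)//.
have /allP pos : all (leq 1) unit_residues by [].
exact/pos/(mem_zip1 _ _ _ _ _ uwz).
Qed.

Lemma dual_distribution_odd a : odd_distribution (dual_distribution a).
Proof.
apply: odd_distribution_sum => uw /unit_pi pu.
exact/odd_distribution_ratr/twisted_saw_odd_distribution.
Qed.

Lemma dual_distribution_pt a b : a \in basis_points -> b \in basis_points ->
  dual_distribution a (pt_of N b) = (a == b)%:R.
Proof.
have [/andP[/allP dual _] /allP bN] := andP dualN.
move=> aB bB; have /andP[b0 bltN] := bN _ bB.
have NR : N%:R != 0 :> R by rewrite pnatr_eq0 -lt0n.
have -> : dual_distribution a (pt_of N b) = (dual_pairing N a b)%:~R / (8 * N)%:R.
  rewrite /dual_pairing rmorph_sum mulr_suml/=; apply: eq_big_seq => uw uwz.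
  have Nub : ~~ (N %| uw.1 * b)%N.
    rewrite Gauss_dvdr ?(unitN a uw uwz)//; apply/negP => /(dvdn_leq b0) le.
    by move: bltN; rewrite ltnNge le.
  rewrite /pt_of (twisted_saw_frac N0 (pnat_pi N0) Nub).
  rewrite fmorph_div/= ratr_int ratr_nat rmorphM/= -!mul2n !natrM.
  move: (_ - _)%:~R uw.2%:~R NR => e w; move: (N%:R : R) => M M0.
  by field.
have /allP/(_ _ bB) := dual _ aB.
have -> : foldr (fun uw s => uw.2 * ((uw.1 * b %% N).*2%:Z - N%:Z) + s) 0
    (zip unit_residues (dual_weights a)) = dual_pairing N a b.
  rewrite /dual_pairing; elim: (zip _ _) => [|uw s IH]; first by rewrite big_nil.
  by rewrite big_cons /= IH.
move=> /eqP ->.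
case: eqP => _; last by rewrite mul0r.
by rewrite divff// pnatr_eq0 muln_eq0 -lt0n N0.
Qed.

(** Twist by the combination of the dual distributions whose coefficients are
the logarithms of the desired ratios. *)
Lemma standard_solution_interpolation (G : R -> R) (HG : gamma_like R G) (t : rat -> R) :
  (forall b, b \in basis_points -> 0 < t (pt_of N b)) ->
  exists F : rat -> R, standard_solution F /\
    forall b, b \in basis_points -> F (pt_of N b) = t (pt_of N b).
Proof.
move=> t0; have [_ /allP bN] := andP dualN.
pose c a := ln (t (pt_of N a) / G (ratr (pt_of N a))).
pose h x := \sum_(a <- basis_points) c a * dual_distribution a x.
have hodd : odd_distribution h.
  by apply: odd_distribution_sum => a _; exact: dual_distribution_odd.
exists (twisted_gamma R G h); split; first exact: twisted_gamma_standard.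
move=> b bB; have /andP[b0 _] := bN _ bB.
have p0 : 0 < ratr (pt_of N b) :> R by rewrite ltr0q divr_gt0 ?ltr0n.
have g0 := gamma_pos G HG _ p0.
have hb : h (pt_of N b) = c b.
  rewrite /h (bigD1_seq b)//= ?basis_points_uniq// dual_distribution_pt// eqxx mulr1.
  rewrite big_seq_cond big1 ?addr0// => a /andP[aB ab].
  by rewrite dual_distribution_pt// (negPf ab) mulr0.
rewrite /twisted_gamma hb gamma_ext_pos// lnK; last by rewrite posrE divr_gt0// t0.
by rewrite mulrC divfK// gt_eqF.
Qed.

End Interpolation.

Section Freedom.
Context (R : realType) (G : R -> R) (HG : gamma_like R G).

Lemma standard_solution_free (t : rat -> R) :
  (forall y, y \in setB ++ setE -> 0 < t y) ->
  exists F : rat -> R,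
    standard_solution F /\ (forall y, y \in setB ++ setE -> F y = t y).
Proof.
move=> t0; have [b bB|F [sF Ft]] := standard_solution_interpolation R 120 isT dual_at_120 G HG t.
  by apply: t0; move/allP: basis_pointsP => /(_ _ bB).
exists F; split=> // y yBE.
have /hasP[a aB /eqP ->] := allP setBE_points _ yBE.
exact: Ft.
Qed.

Lemma standard_solution_free_setB (t : rat -> R) :
  (forall y, y \in setB -> 0 < t y) ->
  exists F : rat -> R,
    standard_solution F /\ (forall y, y \in setB -> F y = t y).
Proof.
move=> t0; have [y _|F [sF Ft]] := standard_solution_free (fun y => if y \in setB then t y else 1).
  by case: ifP => // /t0.
by exists F; split=> // y yB; rewrite Ft ?mem_cat ?yB.
Qed.
End Freedom.

Theorem theorem3p4 (R : realType) :
  gamma_formulas (@Gamma R) /\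
  (forall x : rat, gamma_dom x -> 120 * x \is a Num.int ->
     exists (alpha : R) (r : rat) (m : rat -> rat),
       alpha != 0 /\ algebraicOver (@ratr R) alpha /\
       (forall G : rat -> R, standard_solution G ->
          G x = alpha * pi `^ ratr r *
                \prod_(y <- setB ++ setE) G y `^ ratr (m y))) /\
  (forall t : rat -> R, (forall y, y \in setB -> 0 < t y) ->
     exists G : rat -> R,
       standard_solution G /\ (forall y, y \in setB -> G y = t y)) /\
  (forall t : rat -> R, (forall y, y \in setB ++ setE -> 0 < t y) ->
     exists G : rat -> R,
       standard_solution G /\ (forall y, y \in setB ++ setE -> G y = t y)).
Proof.
have HG := Gamma_gamma_like R.
split; first exact: gamma_like_formulas HG.
split; first exact: gamma_values_120.
by split=> t t0; [exact: standard_solution_free_setB HG t t0|exact: standard_solution_free HG t t0].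
Qed.
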